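(* Let $M$ be a Riemannian manifold with geodesic distance $d$, and for $p\in M$ let $R_p\colon T_pM\to M$ be a retraction of order $1$. Let $J\colon M\to\mathbb{R}$ be a three times differentiable functional and let $p^*\in M$ be a critical point of $J$. Let $\operatorname{grad}J(p)\in T_pM$ and $\operatorname{Hess}J(p)\colon T_pM\to T_pM$ be the Riemannian gradient and Riemannian Hessian of $J$ at $p$ defined via the retraction $R_p$, and let $$\phi(p):=R_p\left(-(\operatorname{Hess}J(p))^{-1}\operatorname{grad}J(p)\right)$$ be the geometric Newton iteration at $p$. Assume that $\operatorname{Hess}J(p^* )$ is invertible. Then there exist a neighborhood $U$ of $p^*$ in $M$ and a constant $C>0$ such that $$d(\phi(p),p^* )\le C\, d(p,p^* )^2\qquad\text{for all } p\in U.$$ The constant $C$ depends only on the third derivative of $J\circ R_{p^*}$ at $0$ and on the operator norm of $(\operatorname{Hess}J(p^* ))^{-1}$.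
   Context: Retraction: for a Riemannian manifold $M$ and $p\in M$, a $C^\infty$-map $R_p\colon T_pM\to M$ is called a retraction of order $k\in\mathbb{N}$ (at $p$) if there are constants $C,\delta>0$ such that $d(R_p(v),\exp_p(v))\le C|v|^{k+1}$ for all $v\in T_pM$ with $|v|<\delta$, where $d$ is the geodesic distance on $M$, $\exp_p\colon T_pM\to M$ is the exponential map, and $|\cdot|$ is the norm induced by the Riemannian inner product $\langle\cdot,\cdot\rangle$ on $T_pM$. Riemannian gradient and Hessian with respect to a retraction $R_p$ of order $1$ at $p$: $\operatorname{grad}J(p)\in T_pM$ and $\operatorname{Hess}J(p)\colon T_pM\to T_pM$ are the unique vector and the unique self-adjoint linear operator, respectively, such that $$J(R_p(v))=J(p)+\langle v,\operatorname{grad}J(p)\rangle+\tfrac12\langle v,\operatorname{Hess}J(p)v\rangle+\mathcal{O}(|v|^3),$$ where $\mathcal{O}(|v|^3)$ is a term bounded by a constant (depending on the third derivative of $J\circ R_p$ at $0$) times $|v|^3$ for $|v|$ small enough. Equivalently, they are the classical gradient and classical Hessian at $0$ of $J\circ R_p$ on the inner product space $T_pM$. The Hessian in general depends on the choice of the retraction. The Newton iteration $\phi(p)$ is defined at points $p$ where $\operatorname{Hess}J(p)$ is invertible.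
   Formalization: The retractions R_p are additionally assumed to depend smoothly on p (the map R: TM → M is C^∞); without regularity in p the claim fails, e.g. M=ℝ, J=x²/2, R_p(v)=p+v+|p|^(-1/2)v² for p≠0, R_0(v)=v. *)

(* Defs.v *)
From HB Require Import structures.
From mathcomp Require Import all_boot all_order all_algebra.
From mathcomp Require Import all_classical all_reals all_analysis.
Set Implicit Arguments.
Unset Strict Implicit.
Unset Printing Implicit Defensive.
Import Order.TTheory GRing.Theory Num.Theory.
Import numFieldNormedType.Exports.
Local Open Scope classical_set_scope.
Local Open Scope ring_scope.

(* [k] times Frechet differentiable on the open set [A].  In finite dimension
   the derivative of order [i] is differentiable iff all iterated directional
   derivatives of order [i] are. *)
Fixpoint kdiff (R : realType) (V W : normedModType R) (k : nat) (A : set V)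
    (f : V -> W) : Prop :=
  if k is k'.+1 then
    (forall x, A x -> differentiable f x) /\ forall v, kdiff k' A ('D_v f)
  else True.

Definition smooth_on (R : realType) (V W : normedModType R) (A : set V)
    (f : V -> W) : Prop := forall k, kdiff k A f.

(* A smooth [n]-manifold, given by a smooth atlas indexed by the points of [M]:
   [chart p] is a chart around [p], with domain [dom p] and inverse [param p].
   Any smooth structure has an atlas of this form (pick a chart at each point),
   and the values of [chart p] and [param p] off their domains are irrelevant. *)
Record smoothManifold (R : realType) (n : nat) := SmoothManifold {
  carrier :> topologicalType;
  dom : carrier -> set carrier;
  chart : carrier -> carrier -> 'rV[R]_n;
  param : carrier -> 'rV[R]_n -> carrier;
  carrier_hausdorff : hausdorff_space carrier;
  carrier_second_countable : @second_countable carrier;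
  dom_open : forall p, open (dom p);
  dom_center : forall p, dom p p;
  codom_open : forall p, open (chart p @` dom p);
  chartK : forall p q, dom p q -> param p (chart p q) = q;
  chart_continuous : forall p q, dom p q -> {for q, continuous (chart p)};
  param_continuous : forall p x, (chart p @` dom p) x ->
    {for x, continuous (param p)};
  chart_compatible : forall p q,
    smooth_on (chart p @` (dom p `&` dom q)) (chart q \o param p)
}.

(* T_p M is identified with R^n through the preferred chart [chart p] at [p]. *)
Definition tangent (R : realType) (n : nat) (M : smoothManifold R n) (p : M) :=
  'rV[R]_n.

(* The tangent vector at [param p x] whose coordinates in [chart p] are [v]. *)
Definition tframe (R : realType) (n : nat) (M : smoothManifold R n) (p : M)
    (x v : 'rV[R]_n) : tangent (param p x) :=
  'd (chart (param p x) \o param p) x v.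

(* [metric p] is the Gram matrix of the inner product of [tangent p]. *)
Record riemannianManifold (R : realType) (n : nat) := RiemannianManifold {
  base :> smoothManifold R n;
  metric : base -> 'M[R]_n;
  metric_sym : forall p, (metric p)^T = metric p;
  metric_pos : forall (p : base) (v : 'rV[R]_n),
    v != 0 -> 0 < (v *m metric p *m v^T) 0 0;
  metric_smooth : forall (p : base) (u v : 'rV[R]_n),
    smooth_on (chart p @` dom p) (fun x =>
      (tframe p x u *m metric (param p x) *m (tframe p x v)^T) 0 0 : R)
}.

Section Riemannian.
Context (R : realType) (n : nat) (M : riemannianManifold R n).
Implicit Types (p q : M) (c : R -> M) (t : R).

Definition inner p (u v : tangent p) : R := (u *m metric p *m v^T) 0 0.

Definition tnorm p (v : tangent p) : R := Num.sqrt (inner v v).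

Definition velocity c t : tangent (c t) := derive1 (chart (c t) \o c) t.

Definition C1_at c t : Prop :=
  [/\ {for t, continuous c},
      \forall s \near t, derivable (chart (c t) \o c) s 1 &
      {for t, continuous (derive1 (chart (c t) \o c))}].

(* [c] is piecewise C^1 on [0, 1]: on each closed piece it agrees with a curve
   that is C^1 on a neighborhood of that piece. *)
Definition piecewise_C1 c : Prop :=
  exists (k : nat) (tau : nat -> R), [/\ tau 0 = 0, tau k = 1 &
    forall i, (i < k)%N -> tau i < tau i.+1 /\
      exists c' : R -> M, forall t, tau i <= t <= tau i.+1 ->
        C1_at c' t /\ c t = c' t].

Definition curve_length c : \bar R :=
  (\int[lebesgue_measure]_(t in `[0%R, 1%R]) (tnorm (velocity c t))%:E)%E.

(* Infinite between distinct connected components. *)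
Definition dist p q : \bar R :=
  ereal_inf [set curve_length c |
    c in [set c | [/\ piecewise_C1 c, c 0 = p & c 1 = q]]].

(* The metric in the coordinates [chart p]. *)
Definition metric_in p (u v x : 'rV[R]_n) : R :=
  inner (tframe p x u) (tframe p x v).

(* Christoffel symbol of the first kind: its value on the basis vectors
   [e_i], [e_j], [e_k] is (d_i g_jk + d_j g_ik - d_k g_ij) / 2. *)
Definition christoffel1 p (x u v w : 'rV[R]_n) : R :=
  ('D_u (metric_in p v w) x + 'D_v (metric_in p u w) x
   - 'D_w (metric_in p u v) x) / 2.

(* The geodesic equation at time [t] in every chart around [c t], with its free
   index lowered: g_lk (x''^l + Gamma^l_ij x'^i x'^j) = 0 for every k. *)
Definition geodesic_at c t : Prop :=
  {for t, continuous c} /\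
  forall p, dom p (c t) ->
    let x := chart p \o c in
    [/\ \forall s \near t, derivable x s 1,
        derivable (derive1 x) t 1 &
        forall w, metric_in p (derive1 (derive1 x) t) w (x t)
          + christoffel1 p (x t) (derive1 x t) (derive1 x t) w = 0].

(* The graph of the (possibly partially defined) exponential map:
   [exp_p(v)] is defined and equal to [q]. *)
Definition is_exp p (v : tangent p) q : Prop :=
  exists (c : R -> M) (e : R), [/\ 0 < e,
    forall t, - e < t < 1 + e -> geodesic_at c t,
    c 0 = p,
    derive1 (chart p \o c) 0 = v &
    c 1 = q].

Definition smooth_from_tangent p (f : tangent p -> M) : Prop :=
  continuous (f : 'rV[R]_n -> M) /\
  forall q, smooth_on [set v : 'rV[R]_n | dom q (f v)] (chart q \o f).

(* Smoothness of a map defined on the tangent bundle, in the bundle charts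
   [(x, v) |-> (param p x, tframe p x v)]. *)
Definition smooth_from_bundle (F : forall p, tangent p -> M) : Prop :=
  forall p,
    let Fp := fun z : 'rV[R]_n * 'rV[R]_n =>
      F (param p z.1) (tframe p z.1 z.2) in
    let A := [set z : 'rV[R]_n * 'rV[R]_n | (chart p @` dom p) z.1] in
    (forall z, A z -> {for z, continuous Fp}) /\
    forall q, smooth_on (A `&` [set z | dom q (Fp z)]) (chart q \o Fp).

Definition retraction (k : nat) p (f : tangent p -> M) : Prop :=
  smooth_from_tangent f /\
  exists C delta : R, [/\ 0 < C, 0 < delta &
    forall v : tangent p, tnorm v < delta ->
      exists2 q, is_exp v q & (dist (f v) q <= (C * tnorm v ^+ k.+1)%:E)%E].

Definition times_differentiable (k : nat) (J : M -> R) : Prop :=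
  forall p, kdiff k (chart p @` dom p) (J \o param p : 'rV[R]_n -> R).

Definition critical_point (J : M -> R) p : Prop :=
  forall v, 'd (J \o param p : 'rV[R]_n -> R) (chart p p) v = 0.

(* Linear operators on [tangent p] are matrices acting on row vectors by
   [v |-> v *m H]. *)
Definition self_adjoint p (H : 'M[R]_n) : Prop :=
  forall u v : tangent p, inner (p := p) (u *m H) v = inner (p := p) u (v *m H).

Definition second_order_expansion (J : M -> R) p (f : tangent p -> M)
    (g : tangent p) (H : 'M[R]_n) : Prop :=
  exists C delta : R, 0 < delta /\ forall v : tangent p, tnorm v < delta ->
    `|J (f v) - (J p + inner v g + inner (p := p) v (v *m H) / 2)|
      <= C * tnorm v ^+ 3.

(* The pair (gradient, Hessian) at [p] with respect to [f]: the unique pair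
   with the properties below (an irrelevant value if there is none). *)
Definition grad_hess (J : M -> R) p (f : tangent p -> M) :
    'rV[R]_n * 'M[R]_n :=
  xget (0, 0) [set gH : 'rV[R]_n * 'M[R]_n |
    self_adjoint p gH.2 /\ second_order_expansion J f gH.1 gH.2].

Definition grad (J : M -> R) p (f : tangent p -> M) : tangent p :=
  (grad_hess J f).1.

Definition hess (J : M -> R) p (f : tangent p -> M) : 'M[R]_n :=
  (grad_hess J f).2.

Definition newton (J : M -> R) (F : forall p, tangent p -> M) p : M :=
  F p (- (grad J (F p) *m invmx (hess J (F p)))).

Definition opnorm p (A : 'M[R]_n) : R :=
  sup [set tnorm (p := p) (v *m A) | v in [set v : tangent p | tnorm v <= 1]].

(* The norm of the third derivative at 0 of [h], a trilinear form on the inner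
   product space [tangent p]. *)
Definition norm_D3 p (h : tangent p -> R) : R :=
  let D3 (u v w : 'rV[R]_n) : R :=
    'D_u ('D_v ('D_w (h : 'rV[R]_n -> R))) 0 in
  sup [set a | exists u v w : tangent p,
    [/\ tnorm u <= 1, tnorm v <= 1, tnorm w <= 1 & a = `|D3 u v w|]].

End Riemannian.

(* Main.v *)
(* In the chart at the critical point put k(x, v) = J(F_x(v)), where F_x(v) is
   the retraction at the point with coordinates x.  The Newton step v solves
   d_v k(x, 0) + d_v^2 k(x, 0)(v, .) = 0, and v = -x + o(x), so a second-order
   expansion of d_v k in v gives
   d_v k(x, v) = (1/2) d_v^3 k(0, 0)(v, v, .) + o(|x|^2).
   The left-hand side is the differential of J at the new point composed with
   d_v F_x(v), which is close to the identity because the order-one condition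
   forces F_q(0) = q and dF_q(0) = id.  Hence the Hessian at the critical point
   maps the new error E to (1/2) d_v^3 k(0, 0)(v, v, .) + o(|x|^2) + o(E), and
   |E| is at most a constant times |H^-1| |D^3| |x|^2, up to o(|x|^2).
   Near the critical point coordinates and the geodesic distance differ by a
   factor bounded by a universal constant: segments bound the distance from
   above, bump functions bound it from below. *)
Require Import Defs.
From HB Require Import structures.
From mathcomp Require Import all_boot all_order all_algebra.
From mathcomp Require Import all_classical all_reals all_analysis.
From mathcomp Require Import ring lra measurable_realfun.
Import Order.TTheory GRing.Theory Num.Theory.
Import numFieldNormedType.Exports.
Local Open Scope classical_set_scope.
Local Open Scope ring_scope.
Set Implicit Arguments.
Unset Strict Implicit.
Unset Printing Implicit Defensive.

(** * Differential calculus *)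

(** The manifold, its metric and the family [F] may influence the size of the neighbourhood but not
    the constant, beyond the two norms it depends on. Hence every chart-dependent quantity has to
    appear with a factor that tends to 0 at the critical point, to be absorbed by shrinking the
    neighbourhood. The one third derivative that survives is taken along the fibre over [pstar]. In
    the bundle chart this fibre is [tangent pstar] itself, so the bound is in terms of
    [J \o F pstar] and is independent of the chart. [J] is three times differentiable, with no
    continuity of its third derivatives. All expansions are therefore anchored at a single point,
    where the second derivatives are differentiable, and mean value inequalities carry them along
    segments. The exponential map is given only as the relation [is_exp], so a bound valid for every
    geodesic with small initial velocity takes the place of its smoothness. Likewise [grad] and
    [hess] are values chosen by [xget], which become usable only after existence and uniqueness have
    been proved. *)

Lemma nbhs_distP (R : realType) (V : normedModType R) (x : V) (P : set V) :
  nbhs x P <-> exists2 d : R, 0 < d & forall y, `|y - x| < d -> P y.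
Proof.
split=> [/nbhs_normP[d /= d0 dP]|[d d0 dP]].
  by exists d => // y yx; apply: dP; rewrite /ball_ /= distrC.
by apply/nbhs_normP; exists d => //= y /=; rewrite distrC; exact: dP.
Qed.

Section OneVariable.
Context {R : realType}.
Implicit Types (f : R -> R) (a b C : R).

Lemma mvt_bound f a b C : a <= b ->
  (forall t, a <= t <= b -> derivable f t 1 /\ `|derive1 f t| <= C) ->
  `|f b - f a| <= C * (b - a).
Proof.
move=> ab fd.
have [||c cab ->] := @MVT_segment R f (derive1 f) a b ab.
- move=> x; rewrite in_itv /= => /andP[ax xb]; rewrite derive1E.
  by apply/derivableP; apply: (fd _ _).1; rewrite !ltW.
- apply: derivable_within_continuous => x; rewrite in_itv /= => xab.
  by have [] := fd x xab.
- rewrite normrM (ger0_norm (x := b - a)) ?subr_ge0//.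
  by rewrite ler_wpM2r ?subr_ge0//; have [|] := fd c.
Qed.

End OneVariable.

(** * Mean value inequalities along segments *)

Section Lines.
Context {R : realType} {V : normedModType R}.

Lemma is_derive_line (W : normedModType R) (f : V -> W) (x v : V) (t : R) :
  derivable f (x + t *: v) v ->
  is_derive t 1 (fun s => f (x + s *: v)) ('D_v f (x + t *: v)).
Proof.
have E : (fun h : R => h^-1 *: (f (x + (h *: 1 + t) *: v) - f (x + t *: v))) =
   (fun h => h^-1 *: (f (h *: v + (x + t *: v)) - f (x + t *: v))).
  apply/funext => h; congr (_ *: (f _ - _)).
  by rewrite scalerDl addrCA /GRing.scale /= mulr1.
move=> df; split; first by rewrite /derivable E.
by rewrite /derive E.
Qed.

(** Subtracting [c * t + e / 2 * t ^+ 2] from [f] along the segment leaves a function whose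
    derivative is at most [C] in absolute value. The derivative only has to exist, so this replaces
    a Taylor formula with integral remainder. *)
Lemma mvt_line2 (f : V -> R) (x v : V) (c e C : R) :
  (forall t : R, 0 <= t <= 1 -> derivable f (x + t *: v) v /\
     `|'D_v f (x + t *: v) - c - t * e| <= C) ->
  `|f (x + v) - f x - c - e / 2| <= C.
Proof.
move=> H; pose g (t : R) := f (x + t *: v) - c * t - e / 2 * t ^+ 2.
have gd (t : R) : 0 <= t <= 1 ->
    is_derive t 1 g ('D_v f (x + t *: v) - c - t * e).
  move=> /H[df _].
  have h1 := is_derive_line df.
  have h2 := is_deriveZ c (is_derive_id t (1 : R)).
  have h3 := is_deriveZ (e / 2) (is_deriveX 2 (is_derive_id t (1 : R))).
  apply: (is_derive_eq (is_deriveB (is_deriveB h1 h2) h3)).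
  by rewrite /GRing.scale /= expr1; field.
have := @mvt_bound _ g 0 1 C ler01.
rewrite subr0 mulr1 /g scale1r mulr1 scale0r addr0 mulr0 subr0 expr1n expr0n /=.
rewrite mulr1 mulr0 subr0 (_ : f (x + v) - c - e / 2 - f x =
  f (x + v) - f x - c - e / 2); last by ring.
apply=> t /[dup] t01 /gd ?; split=> //.
by rewrite derive1E derive_val; have [] := H _ t01.
Qed.

Lemma mvt_line (f : V -> R) (x v : V) (c C : R) :
  (forall t : R, 0 <= t <= 1 -> derivable f (x + t *: v) v /\
     `|'D_v f (x + t *: v) - c| <= C) ->
  `|f (x + v) - f x - c| <= C.
Proof.
move=> H; have := @mvt_line2 f x v c 0 C; rewrite mul0r subr0; apply=> t /H.
by rewrite mulr0 subr0.
Qed.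

End Lines.

Section RowNorm.
Context {R : realType} {n : nat}.
Implicit Types v w : 'rV[R]_n.

Lemma coord_le_norm v i : `|v 0 i| <= `|v|.
Proof.
by rewrite [leRHS]/Num.Def.normr /= mx_normrE; apply: (le_bigmax _ _ (0, i)).
Qed.

Lemma rV_norm_le v C : 0 <= C -> (forall i, `|v 0 i| <= C) -> `|v| <= C.
Proof.
move=> C0 vC; rewrite [leLHS]/Num.Def.normr /= mx_normrE bigmax_le// => -[i j]
  _ /=.
by rewrite ord1.
Qed.

Lemma norm_sum_le v (a : 'I_n -> R) C : (forall i, `|a i| <= C) ->
  `|\sum_i v 0 i * a i| <= n%:R * (`|v| * C).
Proof.
move=> aC; apply: le_trans (ler_norm_sum _ _ _) _.
have <- : \sum_(i < n) `|v| * C = n%:R * (`|v| * C).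
  by rewrite sumr_const card_ord mulr_natl.
apply: ler_sum => i _.
by rewrite normrM ler_pM// coord_le_norm.
Qed.

Lemma norm_sum2_le v w (a : 'I_n -> 'I_n -> R) C :
  (forall i j, `|a i j| <= C) ->
  `|\sum_i v 0 i * \sum_j w 0 j * a i j| <= n%:R ^+ 2 * C * `|v| * `|w|.
Proof.
move=> aC; apply: le_trans (norm_sum_le _ _) _.
  by move=> i; apply: norm_sum_le; exact: aC.
by rewrite le_eqVlt; apply/orP; left; apply/eqP; ring.
Qed.

End RowNorm.

Section Differentiability.
Context {R : realType} {V W : normedModType R}.
Implicit Types (f g : V -> W) (e : R).

Lemma differentiable_eps f x e : differentiable f x -> 0 < e ->
  exists2 d : R, 0 < d & forall y, `|y - x| < d ->
    `|f y - f x - 'D_(y - x) f x| <= e * `|y - x|.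
Proof.
move=> fx e0.
have /eqaddoP /(_ e e0) := diff_locally fx.
move=> /nbhs_distP[d d0 dP]; exists d => // y yx.
have := dP (y - x); rewrite subr0 => /(_ yx) /=.
by rewrite deriveE// !fctE /= subrK opprD addrA.
Qed.

Lemma near_eq_differentiable f g x : {near x, f =1 g} ->
  differentiable f x -> differentiable g x.
Proof.
move=> fg fx.
have dfc := @diff_continuous _ _ _ (nbhs x) f fx.
have E : g \o shift x = cst (g x) + 'd f x +o_ 0 id.
  apply/eqaddoP => e e0; have /eqaddoP /(_ e e0) := diff_locally fx.
  have : \forall y \near 0, f (y + x) = g (y + x).
    by move: fg; rewrite (near_shift 0 x) /= subr0.
  apply: filterS2 => y /= E.
  by rewrite !fctE /= E (nbhs_singleton fg).
apply/diff_locallyP; rewrite (diff_unique dfc E); split=> //.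
Qed.

Lemma differentiable_derivable f x v : differentiable f x -> derivable f x v.
Proof. by move=> /diff_derivable. Qed.

Lemma derive_sumv f x n (a : 'I_n -> R) (v : 'I_n -> V) : differentiable f x ->
  'D_(\sum_i a i *: v i) f x = \sum_i a i *: 'D_(v i) f x.
Proof.
move=> fx; rewrite deriveE// linear_sum; apply: eq_bigr => i _.
by rewrite linearZ /= deriveE.
Qed.

Lemma deriveZv f x a v : differentiable f x -> 'D_(a *: v) f x = a *: 'D_v f x.
Proof. by move=> fx; rewrite !deriveE// linearZ. Qed.

Lemma deriveDv f x u v : differentiable f x ->
  'D_(u + v) f x = 'D_u f x + 'D_v f x.
Proof. by move=> fx; rewrite !deriveE// linearD. Qed.

End Differentiability.

Lemma derive_rV (R : realType) (n : nat) (V W : normedModType R)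
    (L : {linear 'rV[R]_n -> V}) (f : V -> W) x v : differentiable f x ->
  'D_(L v) f x = \sum_i v 0 i *: 'D_(L 'e_i) f x.
Proof.
move=> fx; rewrite [v in LHS]row_sum_delta linear_sum -derive_sumv//.
by under eq_bigr do rewrite linearZ /=.
Qed.

(** * Calculus of [k] times differentiable maps *)

Section Kdiff.
Context {R : realType} {V : normedModType R}.

Lemma kdiffS (W : normedModType R) k (A : set V) (f : V -> W) :
  kdiff k.+1 A f -> kdiff k A f.
Proof.
elim: k A f => [//|k IH] A f [fd fD]; split=> // v.
by apply: IH; exact: fD.
Qed.

(** On an open set, equality of two maps passes to their directional derivatives, which is what the
    induction requires. *)
Lemma kdiff_congr (W : normedModType R) k (A : set V) (f g : V -> W) :
  open A -> (forall x, A x -> f x = g x) -> kdiff k A f -> kdiff k A g.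
Proof.
move=> Ao; elim: k f g => [//|k IH] f g fg [fd fD].
have nfg x : A x -> {near x, f =1 g}.
  by move=> Ax; apply: filterS (open_nbhs_nbhs (conj Ao Ax)) => y /fg.
split=> [x Ax|v]; first exact: near_eq_differentiable (nfg x Ax) (fd x Ax).
by apply: IH (fD v) => x Ax; apply: near_eq_derive; exact: nfg.
Qed.

Lemma kdiff_cst (W : normedModType R) k (A : set V) (c : W) :
  open A -> kdiff k A (cst c).
Proof.
move=> Ao; elim: k c => [//|k IH] c; split=> [x _|v].
  exact: differentiable_cst.
by apply: kdiff_congr Ao _ (IH 0) => x _; rewrite derive_cst.
Qed.

Lemma kdiffD (W : normedModType R) k (A : set V) (f g : V -> W) : open A ->
  kdiff k A f -> kdiff k A g -> kdiff k A (fun x => f x + g x).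
Proof.
move=> Ao; elim: k f g => [//|k IH] f g [fd fD] [gd gD]; split=> [x Ax|v].
  by apply: differentiableD; [exact: fd|exact: gd].
apply: kdiff_congr Ao _ (IH _ _ (fD v) (gD v)) => x Ax.
by rewrite -deriveD//; apply: differentiable_derivable; [exact: fd|exact: gd].
Qed.

Lemma kdiffM k (A : set V) (f g : V -> R) : open A ->
  kdiff k A f -> kdiff k A g -> kdiff k A (fun x => f x * g x).
Proof.
move=> Ao; elim: k f g => [//|k IH] f g fk gk.
case: (fk) (gk) => [fd fD] [gd gD]; split=> [x Ax|v].
  by apply: differentiableM; [exact: fd|exact: gd].
apply: (kdiff_congr Ao _ (kdiffD Ao (IH _ _ (kdiffS fk) (gD v))
                                    (IH _ _ (kdiffS gk) (fD v)))) => x Ax.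
by rewrite [RHS]deriveM//; apply: differentiable_derivable;
  [exact: fd|exact: gd].
Qed.

Lemma kdiff_sum n k (A : set V) (f : 'I_n -> V -> R) : open A ->
  (forall i, kdiff k A (f i)) -> kdiff k A (fun x => \sum_i f i x).
Proof.
move=> Ao; elim: n f => [|n IH] f fk.
  by apply: kdiff_congr Ao _ (kdiff_cst k 0 Ao) => x _; rewrite big_ord0.
apply: (kdiff_congr Ao _ (kdiffD Ao (fk ord0) (IH _ (fun i => fk (lift ord0
  i))))).
by move=> x _; rewrite big_ord_recl.
Qed.

Lemma differentiable_entry n (f : V -> 'rV[R]_n) x i :
  differentiable f x -> differentiable (fun y => f y 0 i) x.
Proof.
move=> fx; apply: (@differentiable_comp _ _ _ _ f (fun w : 'rV[R]_n => w 0 i))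
  => //.
exact: differentiable_coord.
Qed.

Lemma derive_entry n (f : V -> 'rV[R]_n) x v i : derivable f x v ->
  'D_v (fun y => f y 0 i) x = 'D_v f x 0 i.
Proof. by move=> /derive_mx ->; rewrite mxE. Qed.

Lemma kdiff_entry n k (A : set V) (f : V -> 'rV[R]_n) i : open A ->
  kdiff k A f -> kdiff k A (fun x => f x 0 i).
Proof.
move=> Ao; elim: k f => [//|k IH] f [fd fD]; split=> [x Ax|v].
  by apply: differentiable_entry; exact: fd.
apply: kdiff_congr Ao _ (IH _ (fD v)) => x Ax.
by rewrite derive_entry//; apply: differentiable_derivable; exact: fd.
Qed.

(** In coordinates the chain rule writes ['D_v (g \o f)] as a sum of products of an entry of
    ['D_v f] with ['D_'e_i g \o f]; these have one order of differentiability less, and sums and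
    products preserve it. *)
Lemma kdiff_comp n k (A : set V) (B : set 'rV[R]_n) (f : V -> 'rV[R]_n)
    (g : 'rV[R]_n -> R) : open A -> (forall x, A x -> B (f x)) ->
  kdiff k A f -> kdiff k B g -> kdiff k A (g \o f).
Proof.
move=> Ao AB; elim: k g => [//|k IH] g fk [gd gD]; case: (fk) => [fd fD].
split=> [x Ax|v].
  by apply: differentiable_comp; [exact: fd|exact/gd/AB].
pose h i x := 'D_v f x 0 i * ('D_'e_i g \o f) x.
apply: (@kdiff_congr _ _ _ (fun x => \sum_i h i x)) => //; last first.
  apply: kdiff_sum => // i; apply: kdiffM => //.
    exact: (kdiff_entry i Ao (fD v)).
  exact: IH (kdiffS fk) (gD _).
move=> x Ax; have fx := fd _ Ax; have gfx := gd _ (AB _ Ax).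
rewrite deriveE; last exact: differentiable_comp.
rewrite diff_comp//= -deriveE// -[in RHS]deriveE// /h.
by rewrite (derive_rV idfun _ gfx).
Qed.

End Kdiff.

(** * Symmetry of second derivatives *)

Section SecondOrder.
Context {R : realType} {V : normedModType R}.
Implicit Types (f : V -> R) (A : set V) (C d e t : R).

Lemma differentiable_lip f x : differentiable f x ->
  exists C d : R, [/\ 0 <= C, 0 < d &
    forall y, `|y - x| < d -> `|f y - f x| <= C * `|y - x|].
Proof.
move=> fx.
have [k k0 kP] := linear_lipschitz (@diff_continuous _ _ _ (nbhs x) f fx).
have [d d0 dP] := differentiable_eps fx ltr01.
exists (1 + k), d; split=> [|//|y yx]; first by rewrite addr_ge0 ?ltW.
rewrite -(subrK ('D_(y - x) f x) (f y - f x)) mulrDl.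
apply: le_trans (ler_normD _ _) _; rewrite lerD ?dP//.
by rewrite deriveE//; exact: kP.
Qed.

(** Mean value inequality for the increment [f (y + t *: u) - f y] along [t *: v], combined with the
    first-order expansion of ['D_v f] at [z]. As the expansion is used at [z] only,
    differentiability of the first derivatives replaces continuity of the second ones. *)
Lemma second_difference f A z u v e : open A -> kdiff 2 A f -> A z -> 0 < e ->
  exists2 d : R, 0 < d & forall t : R, 0 < t < d ->
    `|f (z + t *: u + t *: v) - f (z + t *: u) - f (z + t *: v) + f z
      - t ^+ 2 * 'D_u ('D_v f) z| <= e * t ^+ 2.
Proof.
move=> Ao [fd fD] Az e0.
have [d1 d10 dA] := (nbhs_distP z A).1 (open_nbhs_nbhs (conj Ao Az)).
pose N := 1 + `|u| + `|v|.
have N0 : 0 < N by rewrite /N; have := normr_ge0 u; have := normr_ge0 v; lra.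
(* All points used lie within [t * N] of [z], so each of the two first-order errors is at most
   [e * t / 2]; the factor [t] of the direction [t *: v] then gives [e * t ^+ 2]. *)
have ge2N : 0 < e / (2 * N) by rewrite divr_gt0// mulr_gt0.
have Dvz : differentiable ('D_v f) z by have [+ _] := fD v; apply.
have [d2 d20 dD] := differentiable_eps Dvz ge2N.
exists (Num.min d1 d2 / N); first by rewrite divr_gt0// lt_min d10.
move=> t /andP[t0]; rewrite ltr_pdivlMr// lt_min => /andP[tN1 tN2].
have small (s r : R) : 0 <= s <= t -> 0 <= r <= t ->
    `|z + s *: u + r *: v - z| <= t * N.
  move=> /andP[s0 st] /andP[r0 rt].
  have -> : z + s *: u + r *: v - z = s *: u + r *: v.
    by rewrite addrAC (addrAC z) subrr add0r.
  apply: le_trans (ler_normD _ _) _; rewrite !normrZ !ger0_norm// /N.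
  rewrite !mulrDr mulr1; apply: lerD; last exact: ler_wpM2r.
  by rewrite -[leLHS]add0r; apply: lerD; [exact: ltW|exact: ler_wpM2r].
have AA (s r : R) : 0 <= s <= t -> 0 <= r <= t -> A (z + s *: u + r *: v).
  by move=> st rt; apply: dA; apply: le_lt_trans (small _ _ st rt) _.
pose g y := f (y + t *: u) - f y.
have t01 : 0 <= (0 : R) <= t by apply/andP; split=> //; exact: ltW.
have t11 : 0 <= t <= t by apply/andP; split=> //; exact: ltW.
have := @mvt_line _ _ g z (t *: v) (t ^+ 2 * 'D_u ('D_v f) z) (e * t ^+ 2).
rewrite /g (addrAC z (t *: v)) opprB addrA => H.
rewrite (_ : _ - _ - _ + _ = f (z + t *: u + t *: v) - f (z + t *: v) +
   f z - f (z + t *: u)); last by ring.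
apply: H => s /andP[s0 s1].
have st : 0 <= s * t <= t.
  by apply/andP; split; [exact: mulr_ge0 (ltW t0)|rewrite ler_piMl// ltW].
have d2' : differentiable f (z + s *: (t *: v)).
  apply: fd; have := AA 0 (s * t) t01 st.
  by rewrite scale0r addr0 scalerA.
have d1' : differentiable f (z + s *: (t *: v) + t *: u).
  by apply: fd; have := AA t (s * t) t11 st; rewrite scalerA addrAC.
have dsh : differentiable (fun y => f (y + t *: u)) (z + s *: (t *: v)).
  by apply: (@differentiable_comp _ _ _ _ (fun y => y + t *: u) f).
split; first by apply: differentiable_derivable; exact: differentiableB.
rewrite deriveB; [|exact: differentiable_derivable..].
rewrite !deriveZv//.
have -> : 'D_v (fun y => f (y + t *: u)) (z + s *: (t *: v)) =
    'D_v f (z + s *: (t *: v) + t *: u).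
  rewrite /derive; set F1 := fun h => _; set F2 := fun h => _ *: (f _ - f _).
  suff -> : F1 = F2 by [].
  by apply/funext => h; rewrite /F1 /F2 /= !addrA.
have t2 : z + s *: (t *: v) + t *: u = z + t *: u + (s * t) *: v.
  by rewrite scalerA addrAC.
have t3 : z + s *: (t *: v) = z + 0 *: u + (s * t) *: v.
  by rewrite scalerA scale0r addr0.
have S1 := small _ _ t11 st; have S2 := small _ _ t01 st.
have := dD _ (le_lt_trans S1 tN2); have := dD _ (le_lt_trans S2 tN2).
rewrite t2 t3 => H1 H2.
have E1 : 'D_(z + t *: u + (s * t) *: v - z) ('D_v f) z =
    t * 'D_u ('D_v f) z + s * t * 'D_v ('D_v f) z.
  rewrite addrAC (addrAC z) subrr add0r deriveDv// !deriveZv//.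
have E2 : 'D_(z + 0 *: u + (s * t) *: v - z) ('D_v f) z =
    s * t * 'D_v ('D_v f) z.
  by rewrite scale0r addr0 addrAC subrr add0r deriveZv.
rewrite E1 in H2; rewrite E2 in H1.
have B1 := le_trans H1 (ler_wpM2l (ltW ge2N) S2).
have B2 := le_trans H2 (ler_wpM2l (ltW ge2N) S1).
have K : e / (2 * N) * (t * N) = e * t / 2 by field; rewrite gt_eqF.
rewrite K in B1; rewrite K in B2.
rewrite /GRing.scale /=.
set a := 'D_v f _ in B2 *; set b := 'D_v f _ in B1 *.
have -> : t * a - t * b - t ^+ 2 * 'D_u ('D_v f) z =
   t * (a - 'D_v f z - (t * 'D_u ('D_v f) z + s * t * 'D_v ('D_v f) z)
        - (b - 'D_v f z - s * t * 'D_v ('D_v f) z)).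
  by move: ('D_v f z) ('D_u _ z) ('D_v _ z) => ? ? ?; ring.
rewrite normrM gtr0_norm// (_ : e * _ = t * (e * t / 2 + e * t / 2));
  last first.
  by field.
apply: ler_wpM2l; first exact: ltW.
by apply: le_trans (ler_normB _ _) _; exact: lerD.
Qed.

(** The second difference is symmetric in [u] and [v], and divided by [t ^+ 2] it approximates both
    mixed derivatives. *)
Lemma schwarz_derive f A z u v : open A -> kdiff 2 A f -> A z ->
  'D_u ('D_v f) z = 'D_v ('D_u f) z.
Proof.
move=> Ao fk Az; apply/eqP; rewrite -subr_eq0 -normr_le0.
apply/ler_addgt0Pr => e e0; rewrite add0r.
have e20 : 0 < e / 2 by rewrite divr_gt0.
have [d d0 dP] := second_difference u v Ao fk Az e20.
have [d' d'0 dP'] := second_difference v u Ao fk Az e20.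
pose t := Num.min d d' / 2.
have t0 : 0 < t by rewrite divr_gt0// lt_min d0.
have td : t < Num.min d d' by rewrite ltr_pdivrMr// ltr_pMr ?lt_min ?d0// ltr1n.
move: td; rewrite lt_min => /andP[td td'].
have := dP t; have := dP' t; rewrite t0 td td' => /(_ isT) H1 /(_ isT) H2.
have t20 : 0 < t ^+ 2 by rewrite exprn_gt0.
rewrite -(ler_pM2l t20) -[X in X * `|_|](gtr0_norm t20) -normrM.
rewrite (addrAC z (t *: v)) in H1.
set a := f _ in H1 H2 *.
set b := f (z + _) in H1 H2 *; set c := f (z + _) in H1 H2 *.
have -> : t ^+ 2 * ('D_u ('D_v f) z - 'D_v ('D_u f) z) =
  (a - b - c + f z - t ^+ 2 * 'D_v ('D_u f) z) -
  (a - b - c + f z - t ^+ 2 * 'D_u ('D_v f) z).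
  by move: ('D_u _ z) ('D_v _ z) => ? ?; ring.
have -> : t ^+ 2 * e = e / 2 * t ^+ 2 + e / 2 * t ^+ 2 by field.
apply: le_trans (ler_normB _ _) _; apply: lerD.
  exact: H1.
by rewrite (addrAC a) in H2; exact: H2.
Qed.

End SecondOrder.

Lemma is_derive_lincomb (R : realType) (V : normedModType R) n
    (a : 'I_n -> R) (h : 'I_n -> V -> R) z y :
  (forall i, derivable (h i) z y) ->
  is_derive z y (fun x => \sum_i a i * h i x) (\sum_i a i * 'D_y (h i) z).
Proof.
move=> hd; have -> : (fun x => \sum_i a i * h i x) = \sum_i (a i \*: h i).
  by apply/funext => x; rewrite fct_sumE.
split; first by apply: derivable_sum => i; exact: derivableZ.
rewrite derive_sum => [|i]; last exact: derivableZ.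
by apply: eq_bigr => i _; rewrite deriveZ.
Qed.

(** * Expansions of second derivatives in a linear family of directions *)

Section Directions.
Context {R : realType} {V : normedModType R} {n : nat}.
(** Taking [L] to be the identity gives derivatives on a tangent space, and taking it to be [vert]
    gives partial derivatives along the fibres of the bundle chart. *)
Variable L : {linear 'rV[R]_n -> V}.
Hypothesis L_le : forall v, `|L v| <= `|v|.
Variables (A : set V) (f : V -> R).
Hypothesis Ao : open A.

Let nearA z : A z -> nbhs z A.
Proof. by move=> Az; exact: open_nbhs_nbhs. Qed.

Lemma derive2_rV z y w : kdiff 2 A f -> A z ->
  'D_y ('D_(L w) f) z = \sum_j w 0 j * 'D_y ('D_(L 'e_j) f) z.
Proof.
move=> [fd fD] Az.
have dj j : derivable ('D_(L 'e_j) f) z y.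
  by apply: differentiable_derivable; have [+ _] := fD (L 'e_j); apply.
rewrite -(derive_val (is_derive := is_derive_lincomb (w 0) dj)).
apply: near_eq_derive; apply: filterS (nearA Az) => x Ax.
exact: derive_rV (fd x Ax).
Qed.

Lemma derive2_rV2 z v w : kdiff 2 A f -> A z ->
  'D_(L v) ('D_(L w) f) z =
  \sum_i v 0 i * \sum_j w 0 j * 'D_(L 'e_i) ('D_(L 'e_j) f) z.
Proof.
move=> f2 Az; rewrite derive2_rV//.
under [RHS]eq_bigr do rewrite mulr_sumr.
rewrite exchange_big /=; apply: eq_bigr => j _.
have [_ fD] := f2; have [fj _] := fD (L 'e_j).
rewrite (derive_rV L _ (fj _ Az)) mulr_sumr; apply: eq_bigr => i _.
by rewrite mulrCA.
Qed.

Lemma derive3_rV2 z y v w : kdiff 3 A f -> A z ->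
  'D_y ('D_(L v) ('D_(L w) f)) z =
  \sum_i v 0 i * \sum_j w 0 j * 'D_y ('D_(L 'e_i) ('D_(L 'e_j) f)) z.
Proof.
move=> f3 Az; have f2 := kdiffS f3; have [_ fD] := f3.
have Dd j i : differentiable ('D_(L 'e_i) ('D_(L 'e_j) f)) z.
  by have [_ /(_ (L 'e_i))[+ _]] := fD (L 'e_j); apply.
have dj i := is_derive_lincomb (w 0) (fun j => differentiable_derivable (v :=
  y) (Dd j i)).
have dij i : derivable
    (fun x => \sum_j w 0 j * 'D_(L 'e_i) ('D_(L 'e_j) f) x) z y.
  by case: (dj i).
rewrite (_ : \sum_i _ = \sum_i v 0 i * 'D_y
    (fun x => \sum_j w 0 j * 'D_(L 'e_i) ('D_(L 'e_j) f) x) z); last first.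
  by apply: eq_bigr => i _; congr (_ * _); case: (dj i).
case: (is_derive_lincomb (v 0) dij) => _ <-.
apply: near_eq_derive; apply: filterS (nearA Az) => x Ax.
exact: derive2_rV2.
Qed.

(** A Lipschitz bound between [z] and the fixed point [z0] is all that differentiability at [z0]
    yields. It is uniform in [v] and [w] because finitely many entries determine the bilinear
    form. *)
Lemma derive2_lip z0 : kdiff 3 A f -> A z0 ->
  exists C d : R, [/\ 0 <= C, 0 < d & forall z, `|z - z0| < d ->
    A z /\ forall v w,
    `|'D_(L v) ('D_(L w) f) z - 'D_(L v) ('D_(L w) f) z0| <=
      C * `|z - z0| * `|v| * `|w|].
Proof.
move=> f3 Az; have f2 := kdiffS f3; have [_ fD] := f3.
pose g (i j : 'I_n) := 'D_(L 'e_i) ('D_(L 'e_j) f).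
have gd i j : differentiable (g i j) z0.
  by have [_ /(_ (L 'e_i))[+ _]] := fD (L 'e_j); apply.
have /choice[c cP] (i : 'I_n * 'I_n) : exists C : R, 0 <= C /\
    \forall z \near z0, `|g i.1 i.2 z - g i.1 i.2 z0| <= C * `|z - z0|.
  have [C [d [C0 d0 Cd]]] := differentiable_lip (gd i.1 i.2).
  by exists C; split=> //; apply/nbhs_distP; exists d.
pose C := \sum_i c i.
have C0 : 0 <= C by apply: sumr_ge0 => i _; exact: (cP i).1.
have cC i : c i <= C.
  by rewrite /C (bigD1 i)//= lerDl sumr_ge0// => j _; exact: (cP j).1.
have [d d0 dP] : exists2 d : R, 0 < d & forall z, `|z - z0| < d ->
    A z /\ forall i, `|g i.1 i.2 z - g i.1 i.2 z0| <= c i * `|z - z0|.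
  apply/nbhs_distP; apply: filterI; first exact: nearA.
  by apply: filter_forall => i; exact: (cP i).2.
exists (n%:R ^+ 2 * C), d; split=> [|//|z /dP[Az' gP]].
  by rewrite mulr_ge0// exprn_ge0.
split=> // v w; rewrite !derive2_rV2// -sumrB.
under eq_bigr do rewrite -mulrBr -sumrB.
under eq_bigr do under eq_bigr do rewrite -mulrBr.
rewrite -(mulrA _ C); apply: norm_sum2_le => i j.
by apply: le_trans (gP (i, j)) _; rewrite ler_wpM2r.
Qed.

Lemma derive2_eps z0 e : kdiff 3 A f -> A z0 -> 0 < e ->
  exists2 d : R, 0 < d & forall z, `|z - z0| < d ->
    A z /\ forall v w,
    `|'D_(L v) ('D_(L w) f) z - 'D_(L v) ('D_(L w) f) z0
       - 'D_(z - z0) ('D_(L v) ('D_(L w) f)) z0| <=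
      e * `|z - z0| * `|v| * `|w|.
Proof.
move=> f3 Az e0; have f2 := kdiffS f3; have [_ fD] := f3.
pose g (i j : 'I_n) := 'D_(L 'e_i) ('D_(L 'e_j) f).
have gd i j : differentiable (g i j) z0.
  by have [_ /(_ (L 'e_i))[+ _]] := fD (L 'e_j); apply.
(* The error [e] is shared among [n ^ 2] entries; the [+ 1] keeps the denominator positive when
   [n = 0]. *)
pose k := e / (n%:R ^+ 2 + 1).
have N0 : 0 < n%:R ^+ 2 + 1 :> R by rewrite ltr_wpDl// exprn_ge0.
have k0 : 0 < k by rewrite divr_gt0.
have [d d0 dP] : exists2 d : R, 0 < d & forall z, `|z - z0| < d ->
    A z /\ forall i, `|g i.1 i.2 z - g i.1 i.2 z0 - 'D_(z - z0) (g i.1 i.2) z0|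
      <= k * `|z - z0|.
  apply/nbhs_distP; apply: filterI; first exact: nearA.
  apply: filter_forall => i; apply/nbhs_distP.
  exact: differentiable_eps.
exists d => // z /dP[Az' gP]; split=> // v w.
rewrite derive3_rV2// !derive2_rV2// -!sumrB.
under eq_bigr do rewrite -!mulrBr -!sumrB.
under eq_bigr do under eq_bigr do rewrite -!mulrBr.
apply: le_trans (norm_sum2_le v w (C := k * `|z - z0|) _) _.
  by move=> i j; exact: gP (i, j).
do 2 apply: ler_wpM2r => //; rewrite mulrA; apply: ler_wpM2r => //.
rewrite /k mulrCA; apply: ler_piMr; first exact: ltW.
by rewrite ler_pdivrMr// mul1r lerDl.
Qed.

(** The bound of [derive2_lip] is integrated twice by mean value inequalities: first for
    ['D_(L v) f] on the segment from [z0] to [z0 + t *: L v], then for [f] itself. This gives a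
    cubic remainder without continuous third derivatives. *)
Lemma taylor2 z0 : kdiff 3 A f -> A z0 ->
  exists C d : R, [/\ 0 <= C, 0 < d & forall v, `|v| < d ->
    `|f (z0 + L v) - f z0 - 'D_(L v) f z0 - 'D_(L v) ('D_(L v) f) z0 / 2|
      <= C * `|v| ^+ 3].
Proof.
move=> f3 Az; have [C [d [C0 d0 dP]]] := derive2_lip f3 Az.
have [fd fD] := f3.
exists C, d; split=> // v vd.
have step (t : R) : 0 <= t <= 1 -> `|t *: L v| <= `|v|.
  move=> /andP[t0 t1]; rewrite normrZ ger0_norm//.
  by apply: le_trans (L_le v); rewrite ler_piMl.
have near (t : R) : 0 <= t <= 1 -> `|z0 + t *: L v - z0| < d.
  by move=> t01; rewrite addrAC subrr add0r (le_lt_trans (step t t01)).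
have inA (t : R) : 0 <= t <= 1 -> A (z0 + t *: L v).
  by move=> /near/dP[].
have := @mvt_line2 _ _ f z0 (L v) ('D_(L v) f z0)
  ('D_(L v) ('D_(L v) f) z0) (C * `|v| ^+ 3).
apply=> t t01; split.
  by apply: differentiable_derivable; apply: fd; exact: inA.
have [fDv fDDv] := fD (L v).
have := @mvt_line _ _ ('D_(L v) f) z0 (t *: L v)
  (t * 'D_(L v) ('D_(L v) f) z0) (C * `|v| ^+ 3).
apply=> s /andP[s0 s1].
have st01 : 0 <= s * t <= 1.
  have /andP[t0 t1] := t01; apply/andP; split; first exact: mulr_ge0.
  by rewrite -[1]mulr1 ler_pM.
have dd : differentiable ('D_(L v) f) (z0 + s *: (t *: L v)).
  by apply: fDv; rewrite scalerA; exact: inA.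
split; first exact: differentiable_derivable.
rewrite deriveZv// scalerA -[_ *: 'D_(_) _ _]/(_ * _) -mulrBr normrM.
have [_ H] := dP _ (near _ st01).
have /andP[t0 t1] := t01.
rewrite ger0_norm//; apply: le_trans (_ : 1 * _ <= _).
  by apply: ler_wpM2r.
rewrite mul1r; apply: le_trans (H v v) _.
rewrite addrAC subrr add0r (_ : C * `|v| ^+ 3 = C * `|v| * `|v| * `|v|);
  last by ring.
do 2 apply: ler_wpM2r => //; apply: ler_wpM2l => //; exact: step.
Qed.

(* The derivatives of the second-order term in the direction [z - z0] at the two
   points cancel, so that only its derivative along [L v] remains; no symmetry
   of third derivatives is needed. *)
Lemma second_order_increment z0 e : kdiff 3 A f -> A z0 -> 0 < e ->
  exists2 d : R, 0 < d & forall z v w, `|z - z0| < d -> `|v| < d ->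
    `|'D_(L w) f (z + L v) - 'D_(L w) f z - 'D_(L v) ('D_(L w) f) z
      - 'D_(L v) ('D_(L v) ('D_(L w) f)) z0 / 2|
      <= e * (`|z - z0| + `|v|) * `|v| * `|w|.
Proof.
move=> f3 Az e0.
have e20 : 0 < e / 2 by rewrite divr_gt0.
have [d d0 dP] := derive2_eps f3 Az e20.
have [fd fD] := f3.
exists (d / 2); first by rewrite divr_gt0.
move=> z v w zd vd.
have step (t : R) : 0 <= t <= 1 ->
    `|z + t *: L v - z0| <= `|z - z0| + `|v|.
  move=> /andP[t0 t1]; rewrite addrAC; apply: le_trans (ler_normD _ _) _.
  rewrite lerD2l normrZ ger0_norm//.
  by apply: le_trans (L_le v); rewrite ler_piMl.
have near (t : R) : 0 <= t <= 1 -> `|z + t *: L v - z0| < d.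
  move=> t01; apply: le_lt_trans (step t t01) _; lra.
have zd' : `|z - z0| < d by lra.
have [fDw fDDw] := fD (L w).
have DDz : differentiable ('D_(L v) ('D_(L w) f)) z0.
  by have [+ _] := fDDw (L v); apply.
pose K := e * (`|z - z0| + `|v|) * `|v| * `|w|.
have := @mvt_line2 _ _ ('D_(L w) f) z (L v) ('D_(L v) ('D_(L w) f) z)
  ('D_(L v) ('D_(L v) ('D_(L w) f)) z0) K.
apply=> t t01; have [At HtP] := dP _ (near t t01).
split; first by apply: differentiable_derivable; exact: fDw.
have [_ HzP] := dP _ zd'.
have := HtP v w; have := HzP v w; move: DDz.
set g := 'D_(L v) ('D_(L w) f) => DDz Hz Ht.
have E : 'D_(z + t *: L v - z0) g z0 =
    'D_(z - z0) g z0 + t * 'D_(L v) g z0.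
  by rewrite addrAC deriveDv// deriveZv.
rewrite E in Ht.
have -> : g (z + t *: L v) - g z - t * 'D_(L v) g z0 =
  (g (z + t *: L v) - g z0 - ('D_(z - z0) g z0 + t * 'D_(L v) g z0)) -
  (g z - g z0 - 'D_(z - z0) g z0).
  by move: (g _) (g _) (g _) ('D_(L v) g z0) ('D_(z - z0) g z0) => ? ? ? ? ?;
    ring.
apply: le_trans (ler_normB _ _) _.
have S := step t t01.
have Q : K =
  e / 2 * (`|z - z0| + `|v|) * `|v| * `|w| +
  e / 2 * (`|z - z0| + `|v|) * `|v| * `|w| by rewrite /K; field.
rewrite Q; apply: lerD.
  apply: le_trans Ht _; do 2 apply: ler_wpM2r => //.
  by apply: ler_wpM2l => //; exact: ltW.
apply: le_trans Hz _; do 2 apply: ler_wpM2r => //.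
by apply: ler_wpM2l; [exact: ltW|rewrite lerDl].
Qed.

End Directions.

(** * Charts and the metric in coordinates *)

Lemma derive_chain (R : realType) (U V W : normedModType R) (f : U -> V)
    (g : V -> W) x v : differentiable f x -> differentiable g (f x) ->
  'D_v (g \o f) x = 'D_('D_v f x) g (f x).
Proof.
move=> fx gx; rewrite (deriveE v fx) (deriveE _ gx) deriveE.
  by rewrite diff_comp.
exact: differentiable_comp.
Qed.

Section Charts.
Context {R : realType} {n : nat} {M : smoothManifold R n}.
Implicit Types (p q s : M) (x v : 'rV[R]_n) (c : R -> M).

Definition chart_codom p : set 'rV[R]_n := chart p @` dom p.

Lemma paramK p x : chart_codom p x -> chart p (param p x) = x.
Proof. by move=> [q pq <-]; rewrite chartK. Qed.

Lemma dom_param p x : chart_codom p x -> dom p (param p x).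
Proof. by move=> [q pq <-]; rewrite chartK. Qed.

Lemma codom_chart p q : dom p q -> chart_codom p (chart p q).
Proof. by move=> pq; exists q. Qed.

Lemma dom_nbhs p q : dom p q -> nbhs q (dom p).
Proof. by move=> pq; apply: open_nbhs_nbhs; split=> //; exact: dom_open. Qed.

Lemma codom_nbhs p x : chart_codom p x -> nbhs x (chart_codom p).
Proof. by move=> px; apply: open_nbhs_nbhs; split=> //; exact: codom_open. Qed.

Lemma param_nbhs p x (B : set M) : chart_codom p x -> nbhs (param p x) B ->
  \forall y \near x, B (param p y).
Proof. by move=> px; exact: (param_continuous px). Qed.

Lemma overlap_open p q : open (chart p @` (dom p `&` dom q)).
Proof.
rewrite openE => _ [s [ps qs] <-]; rewrite /interior.
have xs := codom_chart ps.
have := param_nbhs (B := dom q) xs; rewrite chartK// => /(_ (dom_nbhs qs)).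
apply: filterS2 (codom_nbhs xs) => y py qy.
by exists (param p y); [split=> //; exact: dom_param|exact: paramK].
Qed.

Lemma transition_kdiff k p q :
  kdiff k (chart p @` (dom p `&` dom q)) (chart q \o param p).
Proof. exact: (@chart_compatible _ _ M p q k). Qed.

Lemma transition_differentiable p q s : dom p s -> dom q s ->
  differentiable (chart q \o param p) (chart p s).
Proof. by move=> ps qs; apply: (transition_kdiff 1 p q).1; exists s. Qed.

Lemma transitionK p q s v : dom p s -> dom q s ->
  'D_('D_v (chart q \o param p) (chart p s)) (chart p \o param q) (chart q s) =
  v.
Proof.
move=> ps qs; have d1 := transition_differentiable ps qs.
have d2 := transition_differentiable qs ps.
have E : chart q s = (chart q \o param p) (chart p s) by rewrite /= chartK.
have H := @derive_chain _ _ _ _ (chart q \o param p) (chart p \o param q) _ v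
  d1.
rewrite -E in H; rewrite -(H d2).
rewrite -[RHS](derive_id (chart p s)); apply: near_eq_derive.
have xs := codom_chart ps.
have := param_nbhs (B := dom q) xs; rewrite chartK// => /(_ (dom_nbhs qs)).
apply: filterS2 (codom_nbhs xs) => y py qy.
by rewrite /= chartK// paramK.
Qed.

Lemma transition_id p s v : dom p s ->
  'D_v (chart p \o param p) (chart p s) = v.
Proof.
move=> ps; rewrite -[RHS](derive_id (chart p s)); apply: near_eq_derive.
by apply: filterS (codom_nbhs (codom_chart ps)) => y py; rewrite /= paramK.
Qed.

Lemma tframeE p s v : dom p s ->
  tframe p (chart p s) v = 'D_v (chart s \o param p) (chart p s).
Proof.
move=> ps; rewrite deriveE;
  last exact: transition_differentiable (dom_center s).
by rewrite /tframe chartK.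
Qed.

Lemma tframe_center p v : tframe p (chart p p) v = v :> 'rV[R]_n.
Proof.
by rewrite tframeE; [exact: transition_id (dom_center p)|exact: dom_center].
Qed.

Lemma curve_transition p q c t : {for t, continuous c} ->
  dom p (c t) -> dom q (c t) -> derivable (chart p \o c) t 1 ->
  is_derive t 1 (chart q \o c)
    ('D_('D_1 (chart p \o c) t) (chart q \o param p) (chart p (c t))).
Proof.
move=> ct pt qt /derivable1_diffP dp.
have d2 := transition_differentiable pt qt.
have dc : differentiable ((chart q \o param p) \o (chart p \o c)) t.
  exact: differentiable_comp.
apply: (@near_eq_is_derive _ _ _ ((chart q \o param p) \o (chart p \o c))).
  have : \forall s \near t, dom p (c s) by exact: (ct _ (dom_nbhs pt)).
  by apply: filterS => s ps; rewrite /= chartK.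
split; first exact: differentiable_derivable.
exact: derive_chain.
Qed.

End Charts.

Arguments chart_codom {R n M}.

Section Bilinear.
Context {R : realType} {n : nat}.
Implicit Types u v w : 'rV[R]_n.

Lemma linear_expand (b : 'rV[R]_n -> R) u :
  (forall a u v, b (a *: u + v) = a * b u + b v) ->
  b u = \sum_i u 0 i * b 'e_i.
Proof.
move=> bl; have b0 : b 0 = 0.
  by have := bl 1 0 0; rewrite scale1r addr0 mul1r -[LHS]addr0 => /addrI.
rewrite [in LHS](row_sum_delta u).
apply: (big_rec2 (fun x y => b x = y)) => // i y x _ <-.
by rewrite bl.
Qed.

Lemma bilinear_expand (b : 'rV[R]_n -> 'rV[R]_n -> R) u v :
  (forall a u v w, b (a *: u + v) w = a * b u w + b v w) ->
  (forall a u v w, b w (a *: u + v) = a * b w u + b w v) ->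
  b u v = \sum_i u 0 i * \sum_j v 0 j * b 'e_i 'e_j.
Proof.
move=> bl br; rewrite (linear_expand (b := b^~ v)) => [|a u' v'];
  last exact: bl.
apply: eq_bigr => i _; congr (_ * _).
by rewrite (linear_expand (b := b 'e_i)) => [//|a u' v']; exact: br.
Qed.

End Bilinear.

(** * The inner product on a tangent space *)

Section InnerProduct.
Context {R : realType} {n : nat} {M : riemannianManifold R n} {p : M}.
Implicit Types (u v w : 'rV[R]_n) (a : R).
Local Notation ip := (inner (p := p)).
Local Notation tn := (tnorm (p := p)).

Lemma innerC u v : ip u v = ip v u.
Proof.
rewrite /inner -[RHS]/((v *m metric p *m u^T) 0 0).
have -> : v *m metric p *m u^T = (u *m metric p *m v^T)^T.
  by rewrite !trmx_mul trmxK Defs.metric_sym mulmxA.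
by rewrite [RHS]mxE.
Qed.

Lemma inner_linearl a u v w : ip (a *: u + v) w = a * ip u w + ip v w.
Proof. by rewrite /inner !mulmxDl -!scalemxAl !mxE. Qed.

Lemma inner_linearr a u v w : ip w (a *: u + v) = a * ip w u + ip w v.
Proof. by rewrite innerC inner_linearl !(innerC w). Qed.

Lemma innerDl u v w : ip (u + v) w = ip u w + ip v w.
Proof. by rewrite -[u]scale1r inner_linearl mul1r scale1r. Qed.

Lemma innerDr u v w : ip w (u + v) = ip w u + ip w v.
Proof. by rewrite innerC innerDl !(innerC w). Qed.

Lemma inner0l v : ip 0 v = 0.
Proof. by rewrite /inner !mul0mx mxE. Qed.

Lemma innerZl a u v : ip (a *: u) v = a * ip u v.
Proof. by rewrite -[a *: u]addr0 inner_linearl inner0l addr0. Qed.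

Lemma innerZr a u v : ip v (a *: u) = a * ip v u.
Proof. by rewrite innerC innerZl innerC. Qed.

Lemma innerNl u v : ip (- u) v = - ip u v.
Proof. by rewrite -scaleN1r innerZl mulN1r. Qed.

Lemma innerNr u v : ip v (- u) = - ip v u.
Proof. by rewrite innerC innerNl innerC. Qed.

Lemma inner_gt0 v : v != 0 -> 0 < ip v v.
Proof. exact: Defs.metric_pos. Qed.

Lemma inner_ge0 v : 0 <= ip v v.
Proof. by have [->|/inner_gt0/ltW//] := eqVneq v 0; rewrite inner0l. Qed.

Lemma inner_eq0 v : (forall w, ip w v = 0) -> v = 0.
Proof.
by move=> v0; apply/eqP; apply: contraTT isT => /inner_gt0; rewrite v0 ltxx.
Qed.

Lemma tnorm_ge0 v : 0 <= tn v. Proof. exact: sqrtr_ge0. Qed.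

Lemma sqr_tnorm v : tn v ^+ 2 = ip v v.
Proof. by rewrite sqr_sqrtr// inner_ge0. Qed.

Lemma tnorm0 : tn 0 = 0. Proof. by rewrite /tnorm inner0l sqrtr0. Qed.

Lemma tnorm_gt0 v : v != 0 -> 0 < tn v.
Proof. by move=> v0; rewrite sqrtr_gt0 inner_gt0. Qed.

Lemma tnormZ a v : tn (a *: v) = `|a| * tn v.
Proof.
by rewrite /tnorm innerZl innerZr mulrA -expr2 sqrtrM ?sqr_ge0// sqrtr_sqr.
Qed.

Lemma inner_cauchy u v : `|ip u v| <= tn u * tn v.
Proof.
have [->|u0] := eqVneq u 0; first by rewrite inner0l normr0 tnorm0 mul0r.
rewrite -ler_sqr ?nnegrE ?mulr_ge0 ?tnorm_ge0// real_normK ?num_real//.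
rewrite exprMn !sqr_tnorm.
have := inner_ge0 (ip u u *: v + (- ip u v) *: u).
rewrite inner_linearl inner_linearr innerZl innerDr !innerZr.
rewrite (innerC v u) => H.
have : 0 <= ip u u * (ip u u * ip v v - ip u v ^+ 2).
  by move: H; congr (_ <= _); ring.
by rewrite pmulr_rge0 ?inner_gt0// subr_ge0.
Qed.

Lemma tnormD u v : tn (u + v) <= tn u + tn v.
Proof.
rewrite -ler_sqr ?nnegrE ?addr_ge0 ?tnorm_ge0// sqrrD !sqr_tnorm.
rewrite innerDl !innerDr (innerC v u).
have := le_trans (ler_norm _) (inner_cauchy u v).
rewrite mulr2n; lra.
Qed.

Lemma tnormN v : tn (- v) = tn v.
Proof. by rewrite -scaleN1r tnormZ normrN normr1 mul1r. Qed.

Lemma metric_unit : metric p \in unitmx.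
Proof.
rewrite -row_free_unit -kermx_eq0; apply/eqP/row_matrixP => i; rewrite row0.
apply/eqP; apply: contraTT isT => v0; have := Defs.metric_pos p v0.
by rewrite -row_mul mulmx_ker row0 mul0mx mxE ltxx.
Qed.

(** Riesz representation: the inverse Gram matrix turns the coefficients of a linear form into the
    vector that represents it. *)
Lemma inner_inv v w : ip v (w *m invmx (metric p)) = (v *m w^T) 0 0.
Proof.
rewrite /inner trmx_mul trmx_inv Defs.metric_sym.
by rewrite mulmxA mulmxK// metric_unit.
Qed.

(** Each coordinate is the inner product with a fixed dual vector, so the Cauchy-Schwarz inequality
    bounds [|v|] by [tnorm v] and no compactness of the sphere enters. The other bound expands the
    inner product on the basis. *)
Lemma tnorm_equiv : exists k : R, [/\ 0 < k,
  forall v, `|v| <= k * tn v & forall v, tn v <= k * `|v|].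
Proof.
pose a i := tn ('e_i *m invmx (metric p)).
pose A := \sum_i a i.
have A0 : 0 <= A by apply: sumr_ge0 => i _; exact: tnorm_ge0.
pose C := \sum_(i : 'I_n * 'I_n) `|ip 'e_(i.1) 'e_(i.2)|.
have C0 : 0 <= C by exact: sumr_ge0.
exists (1 + A + Num.sqrt (n%:R ^+ 2 * C)); split.
- by rewrite -addrA ltr_pwDl// addr_ge0// sqrtr_ge0.
- move=> v; apply: rV_norm_le.
    by rewrite mulr_ge0 ?tnorm_ge0// !addr_ge0// sqrtr_ge0.
  move=> i; have -> : v 0 i = ip v ('e_i *m invmx (metric p)).
    rewrite inner_inv mxE (bigD1 i)//= big1 => [|j ji].
      by rewrite !mxE !eqxx mulr1 addr0.
    by rewrite !mxE (negPf ji) andbF mulr0.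
  apply: le_trans (inner_cauchy _ _) _; rewrite mulrC ler_wpM2r ?tnorm_ge0//.
  apply: le_trans (_ : A <= _).
    rewrite /A (bigD1 i)//= lerDl; apply: sumr_ge0 => j _; exact: tnorm_ge0.
  by rewrite addrAC lerDr addr_ge0// sqrtr_ge0.
- move=> v; apply: (@le_trans _ _ (Num.sqrt (n%:R ^+ 2 * C) * `|v|)).
    rewrite -[`|v|]ger0_norm// -sqrtr_sqr -sqrtrM ?mulr_ge0 ?exprn_ge0//.
    rewrite ler_wsqrtr//.
    have -> : ip v v = _ := bilinear_expand v v inner_linearl inner_linearr.
    apply: le_trans (ler_norm _) _; rewrite expr2 mulrA.
    apply: norm_sum2_le => i j; rewrite /C (bigD1 (i, j))//= lerDl.
    exact: sumr_ge0.
  by rewrite ler_wpM2r// lerDr addr_ge0.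
Qed.

End InnerProduct.

(** * The metric in coordinates *)

Section MetricInChart.
Context {R : realType} {n : nat} {M : riemannianManifold R n}.
Implicit Types (p q : M) (u v w x : 'rV[R]_n) (a : R) (c : R -> M).

Lemma tframe_linear p x a u v :
  tframe p x (a *: u + v) = a *: (tframe p x u : 'rV[R]_n) + tframe p x v.
Proof. by rewrite /tframe linearP. Qed.

Lemma metric_in_linearl p x a u v w :
  metric_in p (a *: u + v) w x = a * metric_in p u w x + metric_in p v w x.
Proof. by rewrite /metric_in tframe_linear inner_linearl. Qed.

Lemma metric_in_linearr p x a u v w :
  metric_in p w (a *: u + v) x = a * metric_in p w u x + metric_in p w v x.
Proof. by rewrite /metric_in tframe_linear inner_linearr. Qed.

Lemma metric_in_expand p u v x : metric_in p u v x =
  \sum_i u 0 i * \sum_j v 0 j * metric_in p 'e_i 'e_j x.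
Proof.
by apply: (bilinear_expand (b := fun u v => metric_in p u v x)) => *;
  rewrite (metric_in_linearl, metric_in_linearr).
Qed.

Lemma metric_in_center p u v : metric_in p u v (chart p p) = inner (p := p) u v.
Proof.
rewrite /metric_in !tframe_center /inner.
by rewrite (chartK (dom_center p)).
Qed.

Lemma metric_in_kdiff k p u v : kdiff k (chart_codom p) (metric_in p u v).
Proof. exact: (@Defs.metric_smooth _ _ M p u v k). Qed.

Lemma metric_in_differentiable p u v x : chart_codom p x ->
  differentiable (metric_in p u v) x.
Proof. exact: (metric_in_kdiff 1 p u v).1. Qed.

Lemma metric_near p e : 0 < e -> exists2 r : R, 0 < r &
  forall x, `|x - chart p p| < r -> chart_codom p x /\
  forall u v, `|metric_in p u v x - inner (p := p) u v| <= e * `|u| * `|v|.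
Proof.
move=> e0; have xp := codom_chart (dom_center p).
pose k := e / (n%:R ^+ 2 + 1).
have N0 : 0 < n%:R ^+ 2 + 1 :> R by rewrite ltr_wpDl// exprn_ge0.
have k0 : 0 < k by rewrite divr_gt0.
pose b (i : 'I_n * 'I_n) := metric_in p 'e_(i.1) 'e_(i.2).
have [r r0 rP] : exists2 r : R, 0 < r & forall x, `|x - chart p p| < r ->
   chart_codom p x /\ forall i, `|b i x - b i (chart p p)| <= k.
  apply/nbhs_distP; apply: filterI; first exact: codom_nbhs.
  apply: (@filter_forall _ _ _ _ (nbhs_filter (chart p p : 'rV[R]_n))) => i.
  have bc : {for chart p p, continuous (b i)}.
    by apply: differentiable_continuous; exact: metric_in_differentiable.
  move: bc => /cvgrPdist_le /(_ k k0); apply: filterS => x H.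
  by rewrite distrC; exact: H.
exists r => // x /rP[px xP]; split=> // u v.
have E1 := metric_in_expand p u v x.
have E2 := metric_in_expand p u v (chart p p).
rewrite [LHS]metric_in_center in E2.
rewrite [X in X - _]E1 [X in _ - X]E2 -sumrB.
under eq_bigr do rewrite -mulrBr -sumrB.
under eq_bigr do under eq_bigr do rewrite -mulrBr.
apply: le_trans (norm_sum2_le u v (C := k) _) _.
  by move=> i j; exact: xP (i, j).
do 2 apply: ler_wpM2r => //; rewrite /k mulrCA; apply: ler_piMr;
  first exact: ltW.
by rewrite ler_pdivrMr// mul1r lerDl.
Qed.

Lemma metric_near_equiv p : exists2 r : R, 0 < r &
  forall x, `|x - chart p p| < r -> chart_codom p x /\
  forall v, tnorm (p := p) v <= 2 * Num.sqrt (metric_in p v v x) /\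
    Num.sqrt (metric_in p v v x) <= 2 * tnorm (p := p) v.
Proof.
have [k [k0 k1 k2]] := tnorm_equiv (p := p).
(* This tolerance makes the error at most half of [tnorm v ^+ 2], so the factor 2 in the statement
   is the same for all manifolds. *)
have e0 : 0 < 1 / (2 * k ^+ 2) by rewrite divr_gt0// mulr_gt0// exprn_gt0.
have [r r0 rP] := metric_near p e0.
exists r => // x /rP[px xP]; split=> // v.
have := xP v v; rewrite -sqr_tnorm; set t := tnorm v;
  set m := metric_in _ _ _ _.
move=> mt.
have t0 : 0 <= t := tnorm_ge0 v.
have {}mt : `|m - t ^+ 2| <= t ^+ 2 / 2.
  apply: le_trans mt _.
  have -> : t ^+ 2 / 2 = 1 / (2 * k ^+ 2) * (k * t) * (k * t).
    by field; rewrite gt_eqF.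
  apply: ler_pM => //; first by rewrite mulr_ge0// ltW.
  by rewrite ler_wpM2l// ltW.
have t20 : 0 <= t ^+ 2 by rewrite exprn_ge0.
move: mt; rewrite ler_norml => /andP[m1 m2].
clearbody t m; have m0 : 0 <= m by lra.
have s0 : 0 <= Num.sqrt m := sqrtr_ge0 m.
split; rewrite -ler_sqr ?nnegrE ?mulr_ge0// exprMn sqr_sqrtr//; lra.
Qed.

Lemma inner_velocity p c t : {for t, continuous c} -> dom p (c t) ->
  derivable (chart p \o c) t 1 ->
  inner (velocity c t) (velocity c t) =
    metric_in p ('D_1 (chart p \o c) t) ('D_1 (chart p \o c) t) (chart p (c t)).
Proof.
move=> ct pt dp; have [_ E] := curve_transition ct pt (dom_center (c t)) dp.
have F := tframeE ('D_1 (chart p \o c) t) pt.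
by rewrite /metric_in F /velocity derive1E E /inner (chartK pt).
Qed.

End MetricInChart.

(** * The geodesic distance in a chart *)

Section IncrementIntegral.
Context {R : realType}.
Local Notation mu := (@lebesgue_measure R).

Lemma within_continuous (f : R -> R) a b :
  (forall t, a <= t <= b -> {for t, continuous f}) ->
  {within `[a, b], continuous f}.
Proof.
move=> fc; apply: continuous_in_subspaceT => t; rewrite inE /= in_itv /=.
exact: fc.
Qed.

(** Nothing is known about the integrability of [derive1 phi]. The fundamental theorem is applied to
    the continuous majorant [f] instead: its primitive minus [phi] has a nonnegative derivative. *)
Lemma increment_le_integral (phi f : R -> R) a b : a < b ->
  (forall t, a <= t <= b -> {for t, continuous f} /\ derivable phi t 1 /\
     derive1 phi t <= f t) ->
  ((phi b - phi a)%:E <= \int[mu]_(t in `[a, b]) (f t)%:E)%E.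
Proof.
move=> ab H.
have fc : {within `[a, b], continuous f}.
  by apply: within_continuous => t /H[].
have fi : mu.-integrable `[a, b] (EFin \o f).
  by apply: continuous_compact_integrable fc; exact: segment_compact.
pose F x := \int[mu]_(t in `[a, x]) f t.
have Fc : {within `[a, b], continuous F}.
  exact: (parameterized_integral_continuous (ltW ab) fi).
have dF t : t \in `]a, b[ -> derivable F t 1 /\ derive1 F t = f t.
  rewrite in_itv /= => /andP[at_ tb].
  apply: (continuous_FTC1_closed tb fi at_).
  by have [|//] := H t; rewrite !ltW.
have dphi t : t \in `]a, b[ -> derivable phi t 1 /\ derive1 phi t <= f t.
  rewrite in_itv /= => /andP[at_ tb].
  by have [|_ //] := H t; rewrite !ltW.
pose g := F - phi.
have dg t : t \in `]a, b[ -> is_derive t 1 g (f t - derive1 phi t).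
  move=> tab; have [F1 F2] := dF t tab; have [p1 _] := dphi t tab.
  apply: (is_derive_eq (is_deriveB (derivableP F1) (derivableP p1))).
  by rewrite -!derive1E F2.
have gc : {within `[a, b], continuous g}.
  have pc : {within `[a, b], continuous phi}.
    apply: within_continuous => t /H[_ [/derivable1_diffP pd _]].
    exact: differentiable_continuous.
  by move=> x; apply: cvgB; [exact: Fc|exact: pc].
have aI : a \in `[a, b] by rewrite in_itv /= lexx ltW.
have bI : b \in `[a, b] by rewrite in_itv /= lexx ltW.
have := ger0_derive1_le_cc (f := g) (a := a) (b := b).
move=> /(_ (fun t tab => ex_derive (is_derive :=
  dg t tab))) /(_ _ gc a b aI bI).
move=> mono.
have {mono} : g a <= g b.
  apply: mono (ltW ab) => t tab;
    rewrite derive1E (derive_val (is_derive := dg t tab)).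
  by rewrite subr_ge0; case: (dphi t tab).
rewrite /g !fctE /F set_itv1 Rintegral_set1 => ineq.
have <- : (F b)%:E = (\int[mu]_(t in `[a, b]) (f t)%:E)%E.
  by rewrite fineK// integrable_fin_num.
by rewrite lee_fin /F; lra.
Qed.

Lemma within_measurable (f : R -> R) a b :
  (forall t, a <= t <= b -> {for t, continuous f}) ->
  measurable_fun `[a, b] f.
Proof.
move=> fc; apply: subspace_continuous_measurable_fun;
  first exact: measurable_itv.
exact: within_continuous.
Qed.

(** Here [f] will be the speed of a piecewise curve and [g i] that of its extension beyond the piece
    [i]. They agree on the open piece only, since the speed at a break point is arbitrary; single
    points do not affect the integral. *)
Lemma sum_increments_le_integral (phi f : R -> R) (g : nat -> R -> R)
    (tau : nat -> R) k :
  (forall t, 0 <= f t) ->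
  (forall i, (i < k)%N -> [/\ tau i < tau i.+1,
     measurable_fun `[tau i, tau i.+1] (g i),
     (forall t, tau i < t < tau i.+1 -> f t = g i t) &
     ((phi (tau i.+1) - phi (tau i))%:E <=
       \int[mu]_(t in `[tau i, tau i.+1]) (g i t)%:E)%E]) ->
  ((phi (tau k) - phi (tau 0%N))%:E <=
    \int[mu]_(t in `[tau 0%N, tau k]) (f t)%:E)%E.
Proof.
(* Splitting the integral at [tau k] requires measurability of [f], which is therefore carried
   through the induction. *)
move=> f0 H; suff : [/\ tau 0%N <= tau k, measurable_fun `[tau 0%N, tau k] f &
  ((phi (tau k) - phi (tau 0%N))%:E <=
    \int[mu]_(t in `[tau 0%N, tau k]) (f t)%:E)%E] by case.
elim: k H => [|k IH] H.
  split; rewrite ?subrr// ?set_itv1 ?integral_set1//.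
  exact: measurable_fun_set1.
have [|tk mk ik] := IH; first by move=> i ik; apply: H; exact: ltnW.
have [tkS mg fg ig] := H k (ltnSn k).
have ltb : (BRight (tau k) <= BRight (tau k.+1))%O by rewrite bnd_simp ltW.
have -> : `[tau 0%N, tau k.+1]%classic =
    `[tau 0%N, tau k] `|` `]tau k, tau k.+1].
  by apply: itv_bndbnd_setU => //; rewrite bnd_simp.
have sub : `]tau k, tau k.+1[ `<=` `[tau k, tau k.+1].
  exact: subset_itv_oo_cc.
have mgo : measurable_fun `]tau k, tau k.+1[ (g k).
  by apply: measurable_funS mg => //; exact: measurable_itv.
have mfo : measurable_fun `]tau k, tau k.+1[ f.
  apply: eq_measurable_fun mgo => t; rewrite inE /= in_itv /= => tk'.
  by rewrite fg.
have mfoc : measurable_fun `]tau k, tau k.+1] f.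
  have -> : `]tau k, tau k.+1]%classic = `]tau k, tau k.+1[ `|` [set tau k.+1].
    by rewrite setUitv1// bnd_simp.
  by apply/measurable_funU => //; split=> //; exact: measurable_fun_set1.
have mU : measurable_fun (`[tau 0%N, tau k] `|` `]tau k, tau k.+1]) f.
  by apply/measurable_funU => //; split.
split=> //; first exact: le_trans tk (ltW tkS).
rewrite ge0_integral_setU//=.
- rewrite (_ : phi _ - _ = (phi (tau k) - phi (tau 0%N)) +
    (phi (tau k.+1) - phi (tau k))); last by ring.
  rewrite EFinD leeD//; apply: le_trans ig _.
  rewrite -integral_itv_bndo_bndc; last first.
    apply/measurable_EFinP; apply: measurable_funS mg => //.
    exact: subset_itv_co_cc.
  rewrite -integral_itv_bndo_bndc; last exact/measurable_EFinP.
  rewrite -integral_itv_obnd_cbnd; last exact/measurable_EFinP.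
  rewrite le_eqVlt; apply/orP; left; apply/eqP.
  by apply: eq_integral => t; rewrite inE /= in_itv /= => /fg ->.
- exact/measurable_EFinP.
- by move=> t _; rewrite lee_fin.
- apply/disj_setPS => t [] /=; rewrite !in_itv /= => /andP[_ t1] /andP[t2 _].
  by have := lt_le_trans t2 t1; rewrite ltxx.
Qed.

End IncrementIntegral.

(** * Speed of curves *)

Section Curves.
Context {R : realType} {n : nat} {M : riemannianManifold R n}.
Implicit Types (p q : M) (u v w x : 'rV[R]_n) (c : R -> M) (t : R).

Definition speed c t : R := tnorm (velocity c t).

(** [C1_at] gives continuity of [c] at [t] alone. At nearby times it follows because [c] is
    recovered through [param] from its derivable coordinate expression. *)
Lemma C1_at_near c t : C1_at c t -> \forall s \near t,
  [/\ {for s, continuous c}, dom (c t) (c s) &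
      derivable (chart (c t) \o c) s 1].
Proof.
move=> [ct dc _].
have nd : \forall s \near t, dom (c t) (c s).
  exact: (ct _ (dom_nbhs (dom_center (c t)))).
have nnd := near_join nd.
near=> s; have sd : dom (c t) (c s) by near: s.
have ds : derivable (chart (c t) \o c) s 1 by near: s.
split=> //; have /derivable1_diffP/differentiable_continuous xs := ds.
have pc : {for chart (c t) (c s), continuous (param (c t))}.
  exact/param_continuous/codom_chart.
have : {for s, continuous (param (c t) \o (chart (c t) \o c))}.
  exact: continuous_comp.
have E : \forall r \near s, (param (c t) \o (chart (c t) \o c)) r = c r.
  have : \forall r \near s, dom (c t) (c r) by near: s.
  by apply: filterS => r; exact: chartK.
move=> H; have : c r @[r --> s] --> (param (c t) \o (chart (c t) \o c)) s.
  exact: (cvg_trans (near_eq_cvg E) H).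
by rewrite /= chartK.
Unshelve. all: by end_near. Qed.

Lemma metric_in_continuous p (x y : R -> 'rV[R]_n) t :
  chart_codom p (x t) -> {for t, continuous x} -> {for t, continuous y} ->
  {for t, continuous (fun s => metric_in p (y s) (y s) (x s))}.
Proof.
move=> xt xc yc.
have -> : (fun s => metric_in p (y s) (y s) (x s)) = fun s =>
    \sum_i y s 0 i * \sum_j y s 0 j * metric_in p 'e_i 'e_j (x s).
  by apply/funext => s; exact: metric_in_expand.
have yi i : y s 0 i @[s --> t] --> y t 0 i.
  exact: (continuous_comp yc (@coord_continuous _ _ _ 0 i (y t))).
have gij i j : metric_in p 'e_i 'e_j (x s) @[s --> t] -->
    metric_in p 'e_i 'e_j (x t).
  apply: (continuous_comp xc); apply: differentiable_continuous.
  exact: metric_in_differentiable.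
apply: (cvg_big add_continuous) => i _; apply: cvgM; first exact: yi.
apply: (cvg_big add_continuous) => j _; apply: cvgM; first exact: yi.
exact: gij.
Qed.

Lemma speedE p c t : {for t, continuous c} -> dom p (c t) ->
  derivable (chart p \o c) t 1 ->
  speed c t = Num.sqrt
    (metric_in p ('D_1 (chart p \o c) t) ('D_1 (chart p \o c) t) (chart p (c
      t))).
Proof. by move=> ct pt dp; rewrite /speed /tnorm (inner_velocity ct pt dp). Qed.

(** [velocity] is expressed in a chart that varies with the point of the curve, so the speed is
    first rewritten near [t] in the fixed chart at [c t]. *)
Lemma speed_continuous c t : C1_at c t -> {for t, continuous (speed c)}.
Proof.
move=> C1; have [ct dc d1c] := C1.
have near_t := C1_at_near C1.
have [_ tt td] := nbhs_singleton near_t.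
set p := c t in d1c near_t tt td.
have xc : {for t, continuous (chart p \o c)}.
  by move/derivable1_diffP : td; exact: differentiable_continuous.
have H := metric_in_continuous (codom_chart tt) xc d1c.
have H2 := continuous_comp H (@sqrt_continuous R _).
have E : \forall s \near t, Num.sqrt
    (metric_in p (derive1 (chart p \o c) s) (derive1 (chart p \o c) s)
      ((chart p \o c) s)) = speed c s.
  by apply: filterS near_t => s [cs ps ds]; rewrite (speedE cs ps ds) derive1E.
have : speed c s @[s --> t] --> Num.sqrt
    (metric_in p (derive1 (chart p \o c) t) (derive1 (chart p \o c) t)
      ((chart p \o c) t)).
  exact: (cvg_trans (near_eq_cvg E) H2).
by rewrite (nbhs_singleton E).
Qed.

Lemma speed_ge0 c t : 0 <= speed c t. Proof. exact: tnorm_ge0. Qed.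

Lemma near_eq_speed c c' t : {near t, c =1 c'} -> speed c t = speed c' t.
Proof.
move=> E; have E0 := nbhs_singleton E.
rewrite /speed /velocity; move: E0; move: (c t) => q ->.
congr (tnorm _); rewrite !derive1E; apply: near_eq_derive.
by apply: filterS E => s /= ->.
Qed.

End Curves.

(** * Test functions supported in a chart *)

Section ChartExtend.
Context {R : realType} {n : nat} {M : riemannianManifold R n} (p : M).
Implicit Types (q : M) (u v w x : 'rV[R]_n) (c : R -> M) (t : R).
Local Notation xp := (chart p p).

(* Comparing a curve with functions defined on all of [M] bounds its length from
   below also when it leaves the chart, without any first exit time. *)
Definition chart_extend (Psi : 'rV[R]_n -> R) q : R :=
  if `[< dom p q >] then Psi (chart p q) else 0.

Lemma chart_extendE Psi q : dom p q -> chart_extend Psi q = Psi (chart p q).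
Proof. by move=> pq; rewrite /chart_extend; case: asboolP. Qed.

(** Compact in a Hausdorff space, the coordinate ball is closed in all of [M] and not merely in the
    chart domain. Its complement is thus open, also at points outside the chart. *)
Lemma closed_param_ball r : 0 < r ->
  (forall x, `|x - xp| <= r -> chart_codom p x) ->
  closed (param p @` [set x | `|x - xp| <= r]).
Proof.
move=> r0 sub; apply: compact_closed; first exact: carrier_hausdorff.
have -> : [set x | `|x - xp| <= r] = closed_ball xp r.
  by rewrite closed_ballE//; apply/seteqP; split=> x /=; rewrite distrC.
apply: continuous_compact.
  apply: continuous_in_subspaceT => x; rewrite inE closed_ballE//= => xr.
  by apply: param_continuous; apply: sub; rewrite distrC.
apply: bounded_closed_compact; last exact: closed_ball_closed.
exists (`|xp| + r); split; first exact: num_real.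
move=> N rN x; rewrite closed_ballE//= => xr.
rewrite -[x](subrK xp) (le_trans (ler_normD _ _))// (le_trans _ (ltW rN))//.
by rewrite addrC lerD2l distrC.
Qed.

Variables (r0 : R).
Hypothesis r0P : forall x, `|x - xp| < r0 -> chart_codom p x /\
  forall v, tnorm (p := p) v <= 2 * Num.sqrt (metric_in p v v x) /\
    Num.sqrt (metric_in p v v x) <= 2 * tnorm (p := p) v.


(** Either [c t] lies in the closed coordinate ball and the chain rule applies in the chart, or the
    curve avoids the ball near [t] and the extension vanishes there. The factor 2 compares the
    metric at [c t] with the one at [p]. *)
Lemma derive_chart_extend Psi r L c t : 0 < r -> r < r0 ->
  (forall x, differentiable Psi x) ->
  (forall x v, `|x - xp| <= r -> `|'D_v Psi x| <= L * tnorm (p := p) v) ->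
  (forall x, r < `|x - xp| -> Psi x = 0) -> 0 <= L -> C1_at c t ->
  derivable (chart_extend Psi \o c) t 1 /\
  `|derive1 (chart_extend Psi \o c) t| <= 2 * L * speed c t.
Proof.
move=> rgt0 rr0 dPsi bPsi Psi0 L0 C1.
have [ct _ ct_der] := nbhs_singleton (C1_at_near C1).
have sub x : `|x - xp| <= r -> chart_codom p x.
  by move=> xr; have [] := r0P (le_lt_trans xr rr0).
have Kc := closed_param_ball rgt0 sub.
have [[x xr xct]|nK] := pselect ((param p @` [set x | `|x - xp| <= r]) (c t)).
  have pt : dom p (c t) by rewrite -xct; apply: dom_param; exact: sub.
  have xE : chart p (c t) = x by rewrite -xct paramK//; exact: sub.
  have [dx _] := curve_transition ct (dom_center (c t)) pt ct_der.
  have /derivable1_diffP dx' := dx.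
  have E : \forall s \near t, (Psi \o (chart p \o c)) s =
      (chart_extend Psi \o c) s.
    have : \forall s \near t, dom p (c s) by exact: (ct _ (dom_nbhs pt)).
    by apply: filterS => s ps /=; rewrite chart_extendE.
  have D := @derive_chain _ _ _ _ (chart p \o c) Psi t 1 dx' (dPsi _).
  have dc : derivable (Psi \o (chart p \o c)) t 1.
    apply: differentiable_derivable; exact: differentiable_comp.
  split; first exact: near_eq_derivable E dc.
  rewrite derive1E -(near_eq_derive _ E) D (speedE ct pt dx).
  have xr' : `|chart p (c t) - xp| <= r by rewrite xE.
  apply: le_trans (bPsi _ _ xr') _.
  have [_ /(_ ('D_1 (chart p \o c) t))[H _]] := r0P (le_lt_trans xr' rr0).
  by rewrite (mulrC 2) -mulrA ler_wpM2l.
have E : \forall s \near t, (cst 0 : R -> R) s = (chart_extend Psi \o c) s.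
  have : \forall s \near t, ~ (param p @` [set x | `|x - xp| <= r]) (c s).
    have Kn : nbhs (c t) (~` (param p @` [set x | `|x - xp| <= r])).
      by apply: open_nbhs_nbhs; split=> //; exact: closed_openC.
    exact: (ct _ Kn).
  apply: filterS => s ns /=; rewrite /chart_extend; case: asboolP => // ps.
  rewrite Psi0// ltNge; apply/negP => xr; apply: ns.
  by exists (chart p (c s)); [exact: xr|exact: chartK].
split; first by apply: near_eq_derivable E _; exact: derivable_cst.
rewrite derive1E -(near_eq_derive _ E) derive_cst normr0.
by rewrite !mulr_ge0// speed_ge0.
Qed.

Lemma chart_extend_le_length Psi r L c : 0 < r -> r < r0 ->
  (forall x, differentiable Psi x) ->
  (forall x v, `|x - xp| <= r -> `|'D_v Psi x| <= L * tnorm (p := p) v) ->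
  (forall x, r < `|x - xp| -> Psi x = 0) -> 0 < L -> piecewise_C1 c ->
  (((chart_extend Psi (c 1) - chart_extend Psi (c 0)) / (2 * L))%:E
     <= curve_length c)%E.
Proof.
move=> rgt0 rr0 dPsi bPsi Psi0 L0 [k [tau [tau0 tauk tauP]]].
have L20 : 0 < 2 * L by rewrite mulr_gt0.
have /choice[c' c'P] i : exists c' : R -> M, (i < k)%N -> forall t,
    tau i <= t <= tau i.+1 -> C1_at c' t /\ c t = c' t.
  case: (boolP (i < k)%N) => [/tauP[_ [c' c'P]]|nik]; first by exists c'.
  by exists c.
pose phi t := (2 * L)^-1 * chart_extend Psi (c t).
rewrite mulrBl !(mulrC _ (2 * L)^-1) -/(phi 1) -/(phi 0).
rewrite /curve_length -tau0 -tauk.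
have := @sum_increments_le_integral _ phi (speed c) (fun i => speed (c' i))
  tau k
  (speed_ge0 c).
apply=> i ik; have [tt _] := tauP i ik; have c'i := c'P i ik.
have sc t : tau i <= t <= tau i.+1 -> {for t, continuous (speed (c' i))}.
  by move=> /c'i[C1 _]; exact: speed_continuous.
split.
- exact: tt.
- exact: within_measurable sc.
- move=> t /andP[t1 t2]; apply: near_eq_speed.
  have n1 : \forall s \near t, tau i < s by exact: lt_nbhsr.
  have n2 : \forall s \near t, s < tau i.+1 by exact: lt_nbhsl.
  apply: filterS2 n1 n2 => s s1 s2.
  by have [|_ ->] := c'i s; rewrite ?(ltW s1) ?(ltW s2).
- pose phi' := (2 * L)^-1 \*: (chart_extend Psi \o c' i).
  have -> : phi (tau i.+1) - phi (tau i) = phi' (tau i.+1) - phi' (tau i).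
    rewrite /phi /phi' /=; congr (_ * chart_extend _ _ - _ * chart_extend _ _).
      by apply: (c'i _ _).2; rewrite lexx ltW.
    by apply: (c'i _ _).2; rewrite lexx ltW.
  apply: increment_le_integral => // t tt'; have [C1 _] := c'i t tt'.
  have [dext bext] := derive_chart_extend rgt0 rr0 dPsi bPsi Psi0 (ltW L0) C1.
  split; first exact: sc.
  split; first exact: derivableZ.
  rewrite derive1E deriveZ// -derive1E -[_ *: _]/(_ * _) ler_pdivrMl//.
  exact: le_trans (ler_norm _) bext.
Qed.

Lemma chart_extend_le_dist Psi r L q q' : 0 < r -> r < r0 ->
  (forall x, differentiable Psi x) ->
  (forall x v, `|x - xp| <= r -> `|'D_v Psi x| <= L * tnorm (p := p) v) ->
  (forall x, r < `|x - xp| -> Psi x = 0) -> 0 < L ->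
  (((chart_extend Psi q' - chart_extend Psi q) / (2 * L))%:E <= dist q q')%E.
Proof.
move=> rgt0 rr0 dPsi bPsi Psi0 L0; apply/ereal_infP => _ [c [cC <- <-] <-].
exact: chart_extend_le_length rgt0 rr0 dPsi bPsi Psi0 L0 cC.
Qed.

End ChartExtend.

(** Linear forms, the squared norm and the squared positive part all have increments with an
    explicit quadratic error, so this criterion differentiates each of them by algebra. *)
Lemma is_derive_quadratic (R : realType) (V : normedModType R) (f : V -> R)
    (x v : V) (b C : R) :
  (forall t, `|f (x + t *: v) - f x - t * b| <= C * t ^+ 2) ->
  is_derive x v f b.
Proof.
move=> H; have C0 : 0 <= C by have := le_trans (normr_ge0 _) (H 1);
  rewrite expr1n mulr1.
suff L : (fun h : R => h^-1 *: (f (h *: v + x) - f x)) @ 0^' --> b.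
  by split; [apply/cvg_ex; exists b|exact: cvg_lim].
apply/cvgrPdist_le => e e0.
have C1 : 0 < C + 1 by rewrite ltr_wpDl.
have eC : 0 < e / (C + 1) by rewrite divr_gt0.
have n1 : \forall h \near (0 : R)^', h != 0 by exact: nbhs_dnbhs_neq.
have n2 : \forall h \near (0 : R)^', `|h| < e / (C + 1) by exact: dnbhs0_lt.
apply: filterS2 n1 n2 => h hn0 he.
rewrite distrC -[_ *: _]/(_ * _).
have -> : h^-1 * (f (h *: v + x) - f x) - b =
    h^-1 * (f (x + h *: v) - f x - h * b).
  by rewrite [RHS]mulrBr mulKf// [_ + x]addrC.
rewrite normrM normfV ler_pdivrMl ?normr_gt0//; apply: le_trans (H h) _.
rewrite -real_normK ?num_real// expr2 mulrCA ler_wpM2l//.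
apply: le_trans (_ : (C + 1) * `|h| <= _); first by rewrite ler_wpM2r// lerDl.
by rewrite mulrC -ler_pdivlMr// ltW.
Qed.

(** * A cutoff function with controlled gradient *)

Section SquaredPositivePart.
Context {R : realType}.

(** The square makes the positive part differentiable at 0. Length estimates involve one derivative
    of the test function, so this cutoff is regular enough. *)
Definition sqr_pos (s : R) : R := Num.max 0 s ^+ 2.

Lemma is_derive_sqr_pos s : is_derive s (1 : R) sqr_pos (2 * Num.max 0 s).
Proof.
apply: (is_derive_quadratic (C := 1)) => t.
rewrite mul1r -[_ *: _]/(_ * _) mulr1 ler_norml /sqr_pos.
by case: (leP 0 s) => s0; case: (leP 0 (s + t)) => st0; apply/andP; split; nra.
Qed.

End SquaredPositivePart.

Section Bump.
Context {R : realType} {n : nat} {M : riemannianManifold R n} (p : M).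
Implicit Types (q : M) (u v w x : 'rV[R]_n).
Local Notation xp := (chart p p).
Local Notation ip := (inner (p := p)).
Local Notation tn := (tnorm (p := p)).

(* For [al = 0] the gradient of the bump is bounded by [2 * tn xi] whatever
   [rho] is: this keeps the final constant independent of [M]. *)
Definition bump (rho al : R) (xi x : 'rV[R]_n) : R :=
  (al + ip xi (x - xp)) * sqr_pos (1 - tn (x - xp) ^+ 2 / rho ^+ 2).

Lemma is_derive_inner xi x v :
  is_derive x v (fun y => ip xi (y - xp)) (ip xi v).
Proof.
apply: (is_derive_quadratic (C := 0)) => t.
rewrite mul0r [x + _ - _]addrAC innerDr innerZr.
by rewrite (addrAC (ip xi (x - xp))) subrr add0r subrr normr0.
Qed.

Lemma is_derive_sqr_tnorm x v :
  is_derive x v (fun y => tn (y - xp) ^+ 2) (2 * ip (x - xp) v).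
Proof.
apply: (is_derive_quadratic (C := ip v v)) => t.
rewrite !sqr_tnorm [x + _ - _]addrAC; move: (x - xp) => y.
rewrite innerDl !innerDr !innerZl !innerZr (innerC v y).
rewrite (_ : _ - _ - _ = ip v v * t ^+ 2); last by ring.
by rewrite ger0_norm// mulr_ge0 ?inner_ge0// sqr_ge0.
Qed.

Lemma inner_kdiff1 w : kdiff 1 [set: 'rV[R]_n] (fun y => ip w (y - xp)).
Proof.
have oT : open [set: 'rV[R]_n] by exact: openT.
have kid : kdiff 1 [set: 'rV[R]_n] (fun y => y - xp).
  by split=> // y _; exact: differentiableB.
apply: (@kdiff_congr _ _ _ _ _ (fun y => \sum_i (y - xp) 0 i * ip w 'e_i)) =>
  //.
  by move=> y _; rewrite -linear_expand// => *; exact: inner_linearr.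
by apply: kdiff_sum => // i; apply: kdiffM => //; exact: kdiff_entry.
Qed.

Lemma differentiable_bump_arg rho x :
  differentiable (fun y => 1 - tn (y - xp) ^+ 2 / rho ^+ 2) x.
Proof.
have oT : open [set: 'rV[R]_n] by exact: openT.
have kid : kdiff 1 [set: 'rV[R]_n] (fun y => y - xp).
  by split=> // y _; exact: differentiableB.
have ktn : kdiff 1 [set: 'rV[R]_n] (fun y => tn (y - xp) ^+ 2).
  apply: (@kdiff_congr _ _ _ _ _
    (fun y => \sum_i (y - xp) 0 i * ip 'e_i (y - xp))) => //.
    move=> y _; rewrite sqr_tnorm.
    by rewrite -(linear_expand (b := fun z => ip z (y - xp)))// => *;
      exact: inner_linearl.
  apply: kdiff_sum => // i; apply: kdiffM => //; first exact: kdiff_entry.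
  exact: inner_kdiff1.
apply: differentiableB => //; apply: differentiableM => //.
exact: ktn.1.
Qed.

Lemma differentiable_bump rho al xi x : differentiable (bump rho al xi) x.
Proof.
apply: differentiableM.
  by apply: differentiableD => //; apply: (inner_kdiff1 xi).1.
have d1 : differentiable sqr_pos (1 - tn (x - xp) ^+ 2 / rho ^+ 2).
  by apply/derivable1_diffP;
    case: (is_derive_sqr_pos (1 - tn (x - xp) ^+ 2 / rho ^+ 2)).
apply: (differentiable_comp (f :=
  fun y => 1 - tn (y - xp) ^+ 2 / rho ^+ 2)) => //.
exact: differentiable_bump_arg.
Qed.

Lemma derive_bump rho al xi x v : 'D_v (bump rho al xi) x =
  (al + ip xi (x - xp)) * (2 * Num.max 0 (1 - tn (x - xp) ^+ 2 / rho ^+ 2)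
    * (- (2 * ip (x - xp) v / rho ^+ 2))) +
  sqr_pos (1 - tn (x - xp) ^+ 2 / rho ^+ 2) * ip xi v.
Proof.
pose s y := 1 - tn (y - xp) ^+ 2 / rho ^+ 2.
have d1 : is_derive x v (fun y => al + ip xi (y - xp)) (ip xi v).
  have := is_deriveD (is_derive_cst al x v) (is_derive_inner xi x v).
  by rewrite add0r.
have d2 : is_derive x v s (- (2 * ip (x - xp) v / rho ^+ 2)).
  have := is_deriveB (is_derive_cst (1 : R) x v)
    (is_deriveZ (rho ^+ 2)^-1 (is_derive_sqr_tnorm x v)).
  rewrite sub0r => D.
  have -> : s = cst (1 : R) - ((rho ^+ 2)^-1 \*: (fun y => tn (y - xp) ^+ 2)).
    by apply/funext => y; rewrite /s !fctE mulrC.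
  by apply: (is_derive_eq D); rewrite -[_ *: _]/(_ * _) mulrC.
have ds : differentiable s x := differentiable_bump_arg rho x.
have dq : differentiable sqr_pos (s x).
  by apply/derivable1_diffP; case: (is_derive_sqr_pos (s x)).
have d3 : is_derive x v (sqr_pos \o s) (- (2 * ip (x - xp) v / rho ^+ 2) *
    (2 * Num.max 0 (s x))).
  split; first by apply: differentiable_derivable; exact: differentiable_comp.
  rewrite derive_chain// (derive_val (is_derive := d2)).
  rewrite -[X in 'D_X _ _]mulr1 -[X in 'D_X _ _]/(_ *: (1 : R)) deriveZv//.
  by rewrite (derive_val (is_derive := is_derive_sqr_pos (s x))).
rewrite (derive_val (is_derive := is_deriveM d1 d3)).
by rewrite -[X in X + _ = _]/(_ * _) (mulrC (- _)).
Qed.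

(** In the rescaled radius [z] the linear factor contributes [rho * z] and the gradient of the
    cutoff [4 * m * z / rho]. Hence [rho] cancels in the part coming from [xi]. *)
Lemma derive_bump_le rho al xi x v : 0 < rho ->
  `|'D_v (bump rho al xi) x| <= (2 * tn xi + 4 * `|al| / rho) * tn v.
Proof.
move=> rho0; rewrite derive_bump /sqr_pos.
pose z := tn (x - xp) / rho.
have z0 : 0 <= z by rewrite divr_ge0 ?tnorm_ge0// ltW.
have yE : tn (x - xp) = rho * z by rewrite /z mulrC divfK// gt_eqF.
rewrite -expr_div_n -/z; set m := Num.max _ _.
have [m0 mz mz2] : [/\ 0 <= m, m * z <= 1 & 4 * m * z ^+ 2 + m ^+ 2 <= 2].
  rewrite /m; case: (leP 0 (1 - z ^+ 2)) => h;
    last by rewrite mulr0 !mul0r expr0n addr0.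
  have z1 : z <= 1 by rewrite -(ler_pXn2r (n := 2)) ?nnegrE// expr1n -subr_ge0.
  split=> //.
    by rewrite mulr_ile1// gerBl sqr_ge0.
  (* With [s = z ^+ 2] the expression is [1 + 2 * s - 3 * s ^+ 2], whose maximum [4 / 3] is attained
     at [s = 1 / 3]. *)
  have := sqr_ge0 (z ^+ 2 - 3^-1); lra.
have X0 : 0 <= tn xi := tnorm_ge0 xi.
have V0 : 0 <= tn v := tnorm_ge0 v.
have b1 : `|al + ip xi (x - xp)| <= `|al| + tn xi * (rho * z).
  apply: le_trans (ler_normD _ _) _; rewrite lerD2l -yE; exact: inner_cauchy.
have b2 : `|ip (x - xp) v| <= rho * z * tn v by rewrite -yE;
  exact: inner_cauchy.
have b3 : `|ip xi v| <= tn xi * tn v by exact: inner_cauchy.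
have b4 : `|2 * m * - (2 * ip (x - xp) v / rho ^+ 2)| <= 4 * m * z * tn v / rho.
  rewrite mulrN normrN normrM (ger0_norm (x := 2 * m)) ?mulr_ge0//.
  rewrite !normrM normfV (ger0_norm (x := 2))// (ger0_norm (x :=
    rho ^+ 2)) ?sqr_ge0//.
  rewrite (_ : 4 * m * z * tn v / rho =
    2 * m * (2 * (rho * z * tn v) / rho ^+ 2)).
    apply: ler_wpM2l; first by rewrite mulr_ge0.
    by rewrite ler_wpM2r ?invr_ge0 ?sqr_ge0// ler_wpM2l.
  by move: (tn v) => tv; field; rewrite gt_eqF.
apply: le_trans (ler_normD _ _) _.
apply: le_trans (_ : (`|al| + tn xi * (rho * z)) * (4 * m * z * tn v / rho) +
    m ^+ 2 * (tn xi * tn v) <= _).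
  apply: lerD; first by rewrite normrM; exact: ler_pM.
  by rewrite normrM ger0_norm ?sqr_ge0// ler_wpM2l ?sqr_ge0.
move: (tn xi) (tn v) X0 V0 {b1 b2 b3 b4} => X V X0 V0.
have -> : (`|al| + X * (rho * z)) * (4 * m * z * V / rho) + m ^+ 2 * (X * V) =
  4 * `|al| / rho * V * (m * z) + X * V * (4 * m * z ^+ 2 + m ^+ 2).
  by field; rewrite gt_eqF.
have -> : (2 * X + 4 * `|al| / rho) * V = 4 * `|al| / rho * V * 1 + X * V * 2.
  by ring.
apply: lerD; apply: ler_wpM2l => //; last exact: mulr_ge0.
by rewrite mulr_ge0// divr_ge0 ?mulr_ge0// ltW.
Qed.

Lemma bump_eq0 rho al xi x : 0 < rho -> rho <= tn (x - xp) ->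
  bump rho al xi x = 0.
Proof.
move=> rho0 h; rewrite /bump /sqr_pos max_l ?expr0n ?mulr0//.
rewrite subr_le0 ler_pdivlMr ?exprn_gt0// mul1r ler_sqr ?nnegrE ?tnorm_ge0//.
exact: ltW.
Qed.

End Bump.

(** * Lower bounds for the geodesic distance *)

Section DistLower.
Context {R : realType} {n : nat} {M : riemannianManifold R n} (p : M).
Implicit Types (q : M) (u v w x : 'rV[R]_n).
Local Notation xp := (chart p p).
Local Notation ip := (inner (p := p)).
Local Notation tn := (tnorm (p := p)).

(** The choice [al = 1], [xi = 0] separates [p] from other points, and [al = 0] with a unit vector
    [xi] measures coordinate differences. The radius [r / k] keeps the support of the bump inside
    the coordinate ball of radius [r]. *)
Lemma bump_le_dist : exists2 rho : R, 0 < rho &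
  forall al xi q q', 0 < 2 * tn xi + 4 * `|al| / rho ->
  (((chart_extend p (bump p rho al xi) q' - chart_extend p (bump p rho al xi) q)
     / (2 * (2 * tn xi + 4 * `|al| / rho)))%:E <= dist q q')%E.
Proof.
have [r0 r00 r0P] := metric_near_equiv p.
have [k [k0 k1 _]] := tnorm_equiv (p := p).
pose r := r0 / 2; have rgt0 : 0 < r by rewrite divr_gt0.
have rho0 : 0 < r / k by rewrite divr_gt0.
exists (r / k) => // al xi q q' L0.
apply: (@chart_extend_le_dist _ _ _ p r0 r0P _ r) => //.
- by rewrite /r ltr_pdivrMr// ltr_pMr// ltr1n.
- by move=> x; exact: differentiable_bump.
- by move=> x v _; exact: derive_bump_le.
- move=> x rx; apply: bump_eq0 => //; rewrite ler_pdivrMr// mulrC.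
  exact: le_trans (ltW rx) (k1 _).
Qed.

(** The bump with [al = 1] and [xi = 0] attains its maximum 1 at [p] only, also among points outside
    the chart; distance 0 forces its value at [q] to be at least 1. *)
Lemma dist_le_0 q : (dist q p <= 0)%E -> q = p.
Proof.
have [rho rho0 H] := bump_le_dist; move=> d0.
have tn00 : tn 0 = 0 := tnorm0.
have L0 : 0 < 2 * tn 0 + 4 * `|1 : R| / rho.
  by rewrite tn00 mulr0 add0r normr1 mulr1 divr_gt0.
have := le_trans (H 1 0 q p L0) d0; rewrite lee_fin pmulr_lle0; last first.
  by rewrite invr_gt0 mulr_gt0.
rewrite (chart_extendE _ (dom_center p)) /bump subrr tn00 inner0l addr0 mul1r.
rewrite /sqr_pos expr0n /= mul0r subr0 max_r// expr1n subr_le0.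
rewrite /chart_extend; case: asboolP => [pq|_]; last by rewrite ler10.
rewrite inner0l addr0 mul1r => h.
have [/eqP E|E] := eqVneq (chart p q - xp) 0.
  apply: etrans (esym (chartK pq)) _; move: E; rewrite subr_eq0 => /eqP ->.
  exact: chartK (dom_center p).
have t0 : 0 < tn (chart p q - xp) := tnorm_gt0 E.
have s0 : 0 < tn (chart p q - xp) ^+ 2 / rho ^+ 2.
  by rewrite divr_gt0// exprn_gt0.
exfalso; move: s0 h; set s := _ / _; case: (leP 0 (1 - s)) => sh s0; nra.
Qed.

(** The test function is the bump with [al = 0] and [xi] the unit vector along the coordinate
    difference. Its cutoff differs from 1 by at most [2 * tn w ^+ 2 / rho ^+ 2], so replacing it by
    the linear form [ip xi] costs a cubic error. The 4 is the factor 2 of the metric comparison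
    times the gradient bound 2. *)
Lemma chart_dist_le : exists2 rho : R, 0 < rho & forall q q' (e : R),
  dom p q -> dom p q' -> 0 <= e -> (dist q q' <= e%:E)%E ->
  tn (chart p q - xp) <= rho -> tn (chart p q' - xp) <= rho ->
  tn (chart p q' - chart p q) <= 4 * e + 2 / rho ^+ 2 *
    (tn (chart p q - xp) ^+ 3 + tn (chart p q' - xp) ^+ 3).
Proof.
have [rho rho0 H] := bump_le_dist; exists rho => // q q' e pq pq' e0 qe ur u'r.
set u := chart p q - xp in ur *; set u' := chart p q' - xp in u'r *.
have -> : chart p q' - chart p q = u' - u.
  by rewrite /u /u' opprB addrA subrK.
have [E|dn0] := eqVneq (u' - u) 0.
  rewrite E (tnorm0 (p := p)); apply: addr_ge0; first by rewrite mulr_ge0.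
  apply: mulr_ge0; first by rewrite divr_ge0 ?sqr_ge0.
  by rewrite addr_ge0 ?exprn_ge0 ?tnorm_ge0.
have td := tnorm_gt0 dn0; pose xi := (tn (u' - u))^-1 *: (u' - u).
have xi1 : tn xi = 1.
  by rewrite tnormZ ger0_norm ?invr_ge0 ?ltW// mulVf// gt_eqF.
have L0 : 0 < 2 * tn xi + 4 * `|0 : R| / rho.
  by rewrite xi1 normr0 mulr0 mul0r addr0 mulr1.
have := le_trans (H 0 xi q q' L0) qe; rewrite lee_fin ler_pdivrMr; last first.
  by rewrite mulr_gt0.
rewrite !chart_extendE// /bump -/u -/u' !add0r xi1 normr0 mulr0 mul0r addr0 =>
  h.
have app w : tn w <= rho ->
  `|ip xi w - ip xi w * sqr_pos (1 - tn w ^+ 2 / rho ^+ 2)|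
    <= 2 / rho ^+ 2 * tn w ^+ 3.
  move=> wr; have w0 : 0 <= tn w := tnorm_ge0 w.
  pose s := tn w ^+ 2 / rho ^+ 2.
  have s0 : 0 <= s by rewrite divr_ge0 ?sqr_ge0.
  have s1 : s <= 1.
    by rewrite ler_pdivrMr ?exprn_gt0// mul1r ler_sqr ?nnegrE// ltW.
  have -> : 2 / rho ^+ 2 * tn w ^+ 3 = tn w * (2 * s).
    by rewrite /s; move: (tn w) => tw; field; rewrite gt_eqF.
  rewrite -/s -{1}[ip xi w]mulr1 -mulrBr normrM; apply: ler_pM => //.
    by apply: le_trans (inner_cauchy _ _) _; rewrite xi1 mul1r.
  rewrite /sqr_pos max_r ?subr_ge0// ler_norml; apply/andP; split; nra.
have h1 := app _ ur; have h2 := app _ u'r.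
have -> : tn (u' - u) = ip xi u' - ip xi u.
  rewrite -innerNr -innerDr /xi innerZl -sqr_tnorm expr2 mulKf// gt_eqF//.
move: h h1 h2; rewrite !ler_norml => h /andP[h1 h1'] /andP[h2 h2'].
rewrite mulrDr; lra.
Qed.

Lemma chart_dist_center_le : exists2 rho : R, 0 < rho & forall q (e : R),
  dom p q -> 0 <= e -> (dist q p <= e%:E)%E -> tn (chart p q - xp) <= rho ->
  tn (chart p q - xp) <= 8 * e.
Proof.
have [rho rho0 H] := chart_dist_le; exists (rho / 2); first by rewrite divr_gt0.
move=> q e pq e0 qe ur.
have := H q p e pq (dom_center p) e0 qe.
rewrite subrr (tnorm0 (p :=
  p)) expr0n /= addr0 -(opprB (chart p q)) tnormN => h.
have ur' : tn (chart p q - xp) <= rho by apply: le_trans ur _; lra.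
have := h ur' (ltW rho0); set t := tn _ in ur ur' *.
have t0 : 0 <= t := tnorm_ge0 _.
(* For [t <= rho / 2] the cubic error is at most half of [t], and absorbing it doubles the constant
   4. *)
suff : 2 / rho ^+ 2 * t ^+ 3 <= t / 2 by lra.
have -> : t / 2 = 2 / rho ^+ 2 * (t * (rho / 2) ^+ 2).
  by field; rewrite gt_eqF.
rewrite ler_wpM2l ?divr_ge0 ?sqr_ge0// exprS ler_wpM2l// ler_sqr ?nnegrE//.
by rewrite divr_ge0// ltW.
Qed.

End DistLower.


(** * Upper bound for the geodesic distance *)

Section DistUpper.
Context {R : realType} {n : nat} {M : riemannianManifold R n} (p : M).
Implicit Types (q : M) (a b u v w x : 'rV[R]_n) (t : R).
Local Notation xp := (chart p p).
Local Notation tn := (tnorm (p := p)).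

Lemma is_derive_affine (V : normedModType R) (a b : V) t :
  is_derive t 1 (fun s : R => a + s *: b) b.
Proof.
have D : derivable (id : V -> V) (a + t *: b) b by exact: derivable_id.
have := is_derive_line D; rewrite derive_id.
by apply.
Qed.

(** In the chart at [c t] the velocity is a directional derivative of a transition map; its
    continuity comes from the second order of differentiability of that map. *)
Lemma C1_at_line a b t : chart_codom p (a + t *: b) ->
  C1_at (fun s => param p (a + s *: b)) t.
Proof.
move=> yt; pose y (s : R) := a + s *: b; rewrite -/(y t) in yt.
pose c s := param p (y s); rewrite -[X in C1_at X]/c.
have yd (s : R) : is_derive s (1 : R) y b := is_derive_affine a b s.
have ycont s : {for s, continuous y}.
  by apply: differentiable_continuous; apply/derivable1_diffP; case: (yd s).
have ct : {for t, continuous c}.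
  by apply: (continuous_comp (ycont t)); exact: param_continuous.
pose q := c t; have pq : dom p q by exact: dom_param.
have E : (chart p @` (dom p `&` dom q)) (y t).
  by exists q; [split=> //; exact: dom_center|rewrite /q /c paramK].
have [td tD] := transition_kdiff 2 p q.
have tr : \forall s \near t, (chart p @` (dom p `&` dom q)) (y s).
  apply: (ycont t); apply: open_nbhs_nbhs; split=> //; exact: overlap_open.
have dc : \forall s \near t,
    is_derive s (1 : R) (chart q \o c) ('D_b (chart q \o param p) (y s)).
  apply: filterS tr => s ys.
  have [dy <-] := yd s; have dT := td _ ys.
  have /derivable1_diffP dy' := dy.
  split; first exact: (differentiable_derivable (differentiable_comp dy' dT)).
  by rewrite -(derive_chain _ dy' dT).
split=> //.
  by apply: filterS dc => s [].
have cD : {for y t, continuous ('D_b (chart q \o param p))}.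
  by apply: differentiable_continuous; apply: (tD b).1.
have H := continuous_comp (ycont t) cD.
have E2 : \forall s \near t, ('D_b (chart q \o param p) \o y) s =
    derive1 (chart q \o c) s.
  by apply: filterS dc => s [_ Ds]; rewrite derive1E Ds.
have L : derive1 (chart q \o c) s @[s --> t] --> ('D_b (chart q \o param p) \o
  y) t.
  exact: cvg_trans (near_eq_cvg E2) H.
by rewrite (nbhs_singleton E2) in L.
Qed.

Lemma dist_center_le : exists2 rho : R, 0 < rho & forall q, dom p q ->
  tn (chart p q - xp) <= rho ->
  (dist q p <= (2 * tn (chart p q - xp))%:E)%E.
Proof.
have [r0 r00 r0P] := metric_near_equiv p.
have [k [k0 k1 _]] := tnorm_equiv (p := p).
exists (r0 / 2 / k); first by rewrite !divr_gt0.
move=> q pq; set u := chart p q - xp => ur.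
have ur0 : `|u| < r0.
  apply: le_lt_trans (k1 u) _; apply: le_lt_trans (_ : r0 / 2 < _).
    by rewrite mulrC -ler_pdivlMr.
  by rewrite ltr_pdivrMr// ltr_pMr// ltr1n.
pose y (t : R) := chart p q + t *: (- u).
have ball t : 0 <= t <= 1 -> `|y t - xp| < r0.
  move=> /andP[t0 t1]; rewrite /y addrAC -/u -[X in X + _]scale1r scalerN
    -scalerBl.
  rewrite normrZ; apply: le_lt_trans ur0; rewrite ler_piMl// ler_norml.
  by apply/andP; split; lra.
pose c t := param p (y t).
have C1 t : 0 <= t <= 1 -> C1_at c t.
  by move=> /ball yt; apply: C1_at_line; exact: (r0P _ yt).1.
have sp t : 0 <= t <= 1 -> speed c t <= 2 * tn u.
  move=> t01; have [ct _ _] := C1 t t01; have [yt yb] := r0P _ (ball t t01).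
  have dy : is_derive t (1 : R) y (- u) := is_derive_affine (chart p q) (- u) t.
  have dc : is_derive t (1 : R) (chart p \o c) (- u).
    apply: near_eq_is_derive dy.
    have : \forall s \near t, chart_codom p (y s).
      have /differentiable_continuous yc : differentiable y t.
        by apply/derivable1_diffP; case: (is_derive_affine (chart p q) (- u) t).
      exact: (yc _ (codom_nbhs yt)).
    by apply: filterS => s ys; rewrite /= paramK.
  have pct : dom p (c t) by exact: dom_param.
  rewrite (speedE ct pct (ex_derive (is_derive := dc))).
  rewrite (derive_val (is_derive := dc)) /c paramK// -(tnormN u).
  by have [] := yb (- u).
have c0 : c 0 = q by rewrite /c /y scale0r addr0 chartK.
have c1 : c 1 = p.
  rewrite /c /y scale1r /u opprB addrC subrK chartK//; exact: dom_center.
have pc : piecewise_C1 c.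
  exists 1%N, (fun i => i%:R); split=> // -[|//] _; split; first exact: ltr01.
  by exists c => t t01; split=> //; exact: C1.
apply: le_trans (_ : curve_length c <= _)%E.
  by apply: ereal_inf_lbound; exists c.
have sm : measurable_fun `[(0 : R), 1] (speed c).
  by apply: within_measurable => t t01; apply: speed_continuous; exact: C1.
apply: (@le_trans _ _ (\int[lebesgue_measure]_(t in `[0%R, 1%R]) (cst (2 * tn
  u)%:E t))%E).
  apply: ge0_le_integral => //.
  - by move=> t _; rewrite lee_fin speed_ge0.
  - exact/measurable_EFinP.
rewrite integral_cst//= lebesgue_measure_itv /= lte_fin ltr01.
by rewrite -EFinB subr0 mule1.
Qed.

End DistUpper.

(** * Geodesics and retractions *)

Section Geodesics.
Context {R : realType} {n : nat} {M : riemannianManifold R n} (p : M).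
Implicit Types (q : M) (u v w x : 'rV[R]_n) (t s : R).
Local Notation xp := (chart p p).
Local Notation tn := (tnorm (p := p)).

Lemma derive_metric_in_expand x u v w : chart_codom p x ->
  'D_u (metric_in p v w) x =
  \sum_i u 0 i * \sum_j v 0 j * \sum_k w 0 k *
     'D_'e_i (metric_in p 'e_j 'e_k) x.
Proof.
move=> px; have md v' w' := metric_in_differentiable v' w' px.
have := derive_rV idfun u (md v w); rewrite /= => ->.
apply: eq_bigr => i _; congr (_ * _).
have dk j := is_derive_lincomb (w 0)
  (fun k => differentiable_derivable (v := 'e_i) (md 'e_j 'e_k)).
have dj := is_derive_lincomb (v 0) (fun j => ex_derive (is_derive := dk j)).
have -> : metric_in p v w =
    fun y => \sum_j v 0 j * \sum_k w 0 k * metric_in p 'e_j 'e_k y.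
  by apply/funext => y; exact: metric_in_expand.
rewrite (derive_val (is_derive := dj)); apply: eq_bigr => j _.
by rewrite (derive_val (is_derive := dk j)).
Qed.

Lemma christoffel1_near : exists r C : R, [/\ 0 < r, 0 <= C & forall x,
  `|x - xp| < r -> chart_codom p x /\
  forall u w, `|christoffel1 p x u u w| <= C * `|u| ^+ 2 * `|w|].
Proof.
have px := codom_chart (dom_center p).
pose g (i : 'I_n * ('I_n * 'I_n)) :=
  'D_('e_(i.1)) (metric_in p 'e_(i.2.1) 'e_(i.2.2)).
pose C := \sum_i (`|g i xp| + 1).
have C0 : 0 <= C by apply: sumr_ge0 => i _; rewrite addr_ge0.
have gc i : {for xp, continuous (g i)}.
  apply: differentiable_continuous.
  by have [_ /(_ 'e_(i.1)) [+ _]] :=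
    metric_in_kdiff 2 p 'e_(i.2.1) 'e_(i.2.2); apply.
have [r r0 rP] : exists2 r : R, 0 < r & forall x, `|x - xp| < r ->
    chart_codom p x /\ forall i, `|g i x| <= C.
  apply/nbhs_distP; apply: filterI; first exact: codom_nbhs.
  apply: (@filter_forall _ _ _ _ (nbhs_filter (xp : 'rV[R]_n))) => i.
  move: (gc i) => /cvgrPdist_le /(_ 1 ltr01); apply: filterS => x H.
  apply: le_trans (_ : `|g i xp| + 1 <= _).
    rewrite -[g i x](subrK (g i xp)) addrC; apply: le_trans (ler_normD _ _) _.
    by rewrite lerD2l distrC; exact: H.
  rewrite /C (bigD1 i)//= lerDl; apply: sumr_ge0 => j _.
  by rewrite addr_ge0.
(* Three derivatives of the metric, each a sum of [n ^ 3] entries bounded by [C], are added and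
   halved. *)
exists r, (3 / 2 * (n%:R ^+ 3 * C)); split=> //.
  by rewrite !mulr_ge0// exprn_ge0.
move=> x /rP[cx gx]; split=> // u w.
have B a b c : `|'D_a (metric_in p b c) x| <=
  n%:R ^+ 3 * C * `|a| * `|b| * `|c|.
  rewrite derive_metric_in_expand//.
  apply: le_trans (norm_sum_le a (C := n%:R ^+ 2 * C * `|b| * `|c|) _) _.
    by move=> i; apply: norm_sum2_le => j k; exact: gx (i, (j, k)).
  rewrite le_eqVlt; apply/orP; left; apply/eqP.
  by move: `|a| `|b| `|c| => *; ring.
rewrite /christoffel1.
have := B u u w; have := B w u u.
move: ('D_u (metric_in p u w) x) ('D_w (metric_in p u u) x).
move: `|u| `|w| => a b X Y hY hX.
rewrite normrM (ger0_norm (x := 2^-1)) ?invr_ge0// ler_pdivrMr//.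
apply: le_trans (ler_normB _ _) _;
  apply: le_trans (lerD (ler_normD _ _) (lexx _)) _.
have -> : 3 / 2 * (n%:R ^+ 3 * C) * a ^+ 2 * b * 2 =
  n%:R ^+ 3 * C * a * a * b + n%:R ^+ 3 * C * a * a * b + n%:R ^+ 3 * C * b *
    a * a.
  by field.
by rewrite !lerD.
Qed.

(** Testing the lowered equation against the acceleration [a] itself gives
    [metric_in p a a = - christoffel1], which is linear in [a] on the right. Positivity of the
    metric then bounds [a] without inverting the Gram matrix. *)
Lemma geodesic_acceleration_le : exists r C : R, [/\ 0 < r, 0 <= C &
  forall c t, geodesic_at c t -> dom p (c t) -> `|chart p (c t) - xp| < r ->
  `|derive1 (derive1 (chart p \o c)) t| <=
    C * `|derive1 (chart p \o c) t| ^+ 2].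
Proof.
have [r [C [r0 C0 rC]]] := christoffel1_near.
have [r' r'0 r'P] := metric_near_equiv p.
have [k [k0 k1 _]] := tnorm_equiv (p := p).
exists (Num.min r r'), (4 * k ^+ 2 * C); split.
- by rewrite lt_min r0.
- by apply: mulr_ge0 => //; apply: mulr_ge0 => //; exact: sqr_ge0.
move=> c t [_ geo] pt; rewrite lt_min => /andP[xr xr'].
have [_ _ eqn] := geo p pt.
set a := derive1 (derive1 (chart p \o c)) t in eqn *.
set x' := derive1 (chart p \o c) t in eqn *.
have [-> |a0] := eqVneq a 0.
  rewrite normr0; apply: mulr_ge0; last exact: sqr_ge0.
  by apply: mulr_ge0 => //; apply: mulr_ge0 => //; exact: sqr_ge0.
have [_ cB] := rC _ xr; have [_ mB] := r'P _ xr'.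
have := eqn a; have := cB x' a; have [+ _] := mB a.
rewrite /= -/(chart p (c t)); set m := metric_in _ _ _ _;
  set g := christoffel1 _ _ _ _ _.
move=> h1 h2 h3.
have m0 : 0 <= m by exact: inner_ge0.
have ta := tnorm_ge0 (p := p) a.
have h4 : `|a| ^+ 2 <= 4 * k ^+ 2 * m.
  apply: le_trans (_ : (k * (2 * Num.sqrt m)) ^+ 2 <= _).
    rewrite ler_sqr ?nnegrE ?mulr_ge0 ?sqrtr_ge0// ?(ltW k0)//.
    by apply: le_trans (k1 a) _; rewrite ler_wpM2l// ltW.
  by rewrite !exprMn sqr_sqrtr// mulrA (mulrC (k ^+ 2)) -natrX.
have h5 : m <= C * `|x'| ^+ 2 * `|a|.
  have -> : m = - g by apply/eqP; rewrite -addr_eq0; apply/eqP.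
  by apply: le_trans h2; rewrite -normrN; exact: ler_norm.
have apos : 0 < `|a| by rewrite normr_gt0.
rewrite -(ler_pM2r apos) -expr2; apply: le_trans h4 _.
rewrite -!mulrA; do 3 (apply: ler_wpM2l; first by rewrite // ltW);
  rewrite !mulrA.
by rewrite expr2 mulrA in h5.
Qed.

End Geodesics.

(** * A priori bound for short geodesics *)

Section GeodesicBound.
Context {R : realType} {n : nat} {M : riemannianManifold R n} (p : M).
Implicit Types (q : M) (u v w x : 'rV[R]_n) (t s : R).
Local Notation xp := (chart p p).

(** The norm of a row vector is its largest absolute entry, so the scalar inequality applied to each
    entry loses no constant. *)
Lemma mvt_rV (x : R -> 'rV[R]_n) v a b C : a <= b -> 0 <= C ->
  (forall t, a <= t <= b -> derivable x t 1 /\ `|derive1 x t - v| <= C) ->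
  `|x b - x a - (b - a) *: v| <= C * (b - a).
Proof.
move=> ab C0 xd; apply: rV_norm_le; first by rewrite mulr_ge0// subr_ge0.
move=> i; pose y t := x t 0 i - v 0 i * t.
have yd t : a <= t <= b -> is_derive t 1 y (derive1 x t 0 i - v 0 i).
  move=> /xd[dx _]; have dxi := (derivable_mxP x t 1).1 dx 0 i.
  have D := is_deriveB (derivableP dxi) (is_deriveZ (v 0 i) (is_derive_id t (1
    : R))).
  apply: (is_derive_eq D); rewrite derive1E (derive_mx dx) mxE.
  by rewrite -[_ *: _]/(_ * _) mulr1.
have := @mvt_bound _ y a b C ab; rewrite /y !mxE => H.
rewrite (_ : _ - _ - _ = x b 0 i - v 0 i * b - (x a 0 i - v 0 i * a));
  last by ring.
apply: H => t /[dup] tab /yd D; split;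
  first exact: (ex_derive (is_derive := D)).
rewrite derive1E (derive_val (is_derive := D)); have [_] := xd t tab.
by apply: le_trans; have := coord_le_norm (derive1 x t - v) i; rewrite !mxE.
Qed.

Lemma near_left t (P : set R) : 0 < t -> (\forall s \near t, P s) ->
  exists s, 0 <= s < t /\ P s.
Proof.
move=> t0 /nbhs_distP[d d0 dP].
pose s := Num.max 0 (t - d / 2); exists s; split.
  by rewrite le_max lexx /= gt_max t0 /= gtrBl divr_gt0.
apply: dP; rewrite distrC ger0_norm /s; case: (leP 0 (t - d / 2)) => h; lra.
Qed.

(* A continuity argument replaces the uniqueness of geodesics: as long as
   [`|x - xp| < r] and [`|x'| < 2 * d], the geodesic equation gives
   [`|x''| <= G * d ^+ 2], which in turn improves these two bounds, so there is
   no first time at which they fail. *)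
Lemma geodesic_bound : exists d0 G : R, [/\ 0 < d0, 0 <= G &
  forall (c : R -> M) (d : R), 0 < d -> d < d0 -> (forall t, 0 <= t <= 1 ->
    geodesic_at c t) ->
    c 0 = p -> `|derive1 (chart p \o c) 0| <= d ->
    dom p (c 1) /\
    `|chart p (c 1) - xp - derive1 (chart p \o c) 0| <= G * d ^+ 2].
Proof.
have [r1 [C [r10 C0 accel]]] := geodesic_acceleration_le p.
have [r2 r20 r2P] := metric_near_equiv p.
pose r := Num.min r1 r2; pose G := 4 * C.
have r0 : 0 < r by rewrite lt_min r10.
have G0 : 0 <= G by rewrite mulr_ge0.
have G1 : 0 < G + 1 by rewrite ltr_wpDl.
(* A speed below [2 * d] gives acceleration at most [4 * C * d ^+ 2 = G * d ^+ 2]. Then [d < r / 4]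
   keeps the curve within [r / 2] of [xp], and [G * d < 1] makes the improved speed bound
   [d + G * d ^+ 2] strictly less than [2 * d]. *)
exists (Num.min (r / 4) (G + 1)^-1), G; split=> //.
  by rewrite lt_min divr_gt0// invr_gt0.
move=> c d d0; rewrite lt_min => /andP[dr dG] geo c0.
have [x xE] : exists x : R ->
  'rV[R]_n, chart p \o c = x by exists (chart p \o c).
have [x' x'E] : exists x' : R -> 'rV[R]_n, derive1 x = x' by exists (derive1 x).
have xt_E t : chart p (c t) = x t by rewrite -xE.
have accel_x t : geodesic_at c t -> dom p (c t) -> `|x t - xp| < r1 ->
    `|derive1 x' t| <= C * `|x' t| ^+ 2.
  by move=> gt pt xr; have := accel c t gt pt; rewrite xE x'E xt_E; apply.
rewrite xE x'E xt_E; have [v vE] : exists v, x' 0 = v by exists (x' 0).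
rewrite vE => vd; clear accel.
have Gd : G * d < 1.
  have : (G + 1) * d < 1 by rewrite -ltr_pdivlMl// mulr1.
  nra.
pose good t := [/\ dom p (c t), `|x t - xp| < r & `|x' t| < 2 * d].
have x0 : x 0 = xp by rewrite -xt_E c0.
have good0 : good 0.
  split; first by rewrite c0; exact: dom_center.
    by rewrite x0 subrr normr0.
  by rewrite vE; apply: le_lt_trans vd _; lra.
have xd t : 0 <= t <= 1 -> dom p (c t) ->
    derivable x t 1 /\ derivable x' t 1.
  move=> /geo[_ H] /H /=; rewrite xE x'E => -[H1 H2 _].
  by split; [exact: nbhs_singleton H1|exact: H2].
have estimate t : 0 <= t <= 1 -> (forall s, 0 <= s <= t -> good s) ->
    [/\ `|x' t - v| <= G * d ^+ 2, `|x t - xp| <= r / 2 &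
        `|x t - xp - t *: v| <= G * d ^+ 2].
  move=> /andP[t0 t1] gt.
  have s01 s : 0 <= s <= t -> 0 <= s <= 1.
    by move=> /andP[-> st]; exact: le_trans st t1.
  have acc s : 0 <= s <= t -> `|derive1 x' s| <= G * d ^+ 2.
    move=> st; have [ps xs x's] := gt s st.
    have xs1 : `|x s - xp| < r1.
      by apply: lt_le_trans xs _; rewrite ge_min lexx.
    apply: le_trans (accel_x s (geo s (s01 s st)) ps xs1) _.
    rewrite /G (mulrC 4) -mulrA ler_wpM2l//.
    rewrite (_ : 4 * d ^+ 2 = (2 * d) ^+ 2); last by ring.
    by rewrite ler_sqr ?nnegrE ?mulr_ge0 ?(ltW d0)// ltW.
  have Gd0 : 0 <= G * d ^+ 2 by rewrite mulr_ge0// sqr_ge0.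
  have est1 s : 0 <= s <= t -> `|x' s - v| <= G * d ^+ 2.
    move=> /andP[s0 st].
    have := @mvt_rV x' 0 0 s (G * d ^+ 2) s0 Gd0.
    rewrite vE scaler0 !subr0 => H; apply: le_trans (H _) _.
      move=> s' /andP[s'0 s's].
      have st' : 0 <= s' <= t by rewrite s'0 (le_trans s's).
      rewrite subr0; split; last exact: acc.
      by have [ps' _ _] := gt s' st'; have [] := xd s' (s01 _ st') ps'.
    by rewrite ler_piMr// (le_trans st).
  split.
  - by apply: est1; rewrite t0 lexx.
  - have := @mvt_rV x 0 0 t (2 * d) t0 (mulr_ge0 _ (ltW d0)).
    rewrite scaler0 !subr0 x0 => H; apply: le_trans (H _ _) _ => //.
      move=> s st; have [ps _ x's] := gt s st; rewrite subr0; split.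
        by have [] := xd s (s01 _ st) ps.
      by rewrite x'E; exact: ltW.
    have : 2 * d * t <= 2 * d * 1 by rewrite ler_wpM2l// mulr_ge0// ltW.
    lra.
  - have := @mvt_rV x v 0 t (G * d ^+ 2) t0 Gd0.
    rewrite subr0 x0 => H; apply: le_trans (H _) _.
      move=> s st; have [ps _ _] := gt s st; split; last by rewrite x'E;
        exact: est1.
      by have [] := xd s (s01 _ st) ps.
    by rewrite ler_piMr.
have close t : 0 < t <= 1 -> (forall s, 0 <= s < t -> good s) -> good t.
  move=> /andP[t0 t1] gt.
  have t01 : 0 <= t <= 1 by rewrite ltW.
  have est s : 0 <= s < t -> [/\ `|x' s - v| <= G * d ^+ 2,
      `|x s - xp| <= r / 2 & good s].
    move=> /andP[s0 st].
    have [||h1 h2 _] := estimate s.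
    - by rewrite s0 (le_trans (ltW st)).
    - by move=> s' /andP[s'0 s's]; apply: gt; rewrite s'0 (le_lt_trans s's).
    split; [exact: h1|exact: h2|apply: gt].
    by rewrite s0.
  have [ct _] := geo t t01.
  have r20' : 0 < r / 2 by rewrite divr_gt0.
  have sub y : `|y - xp| <= r / 2 -> chart_codom p y.
    move=> yr; have [|//] := r2P y; apply: le_lt_trans yr _.
    apply: lt_le_trans (_ : r <= _); last by rewrite ge_min lexx orbT.
    by rewrite ltr_pdivrMr// ltr_pMr// ltr1n.
  have Kc := closed_param_ball r20' sub.
  (* It is not yet known that [c t] lies in the chart. As a limit of points of the closed coordinate
     ball it belongs to that ball. *)
  have [y yr yct] : (param p @` [set y | `|y - xp| <= r / 2]) (c t).
    apply: contrapT => nK.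
    have Kn : nbhs (c t) (~` (param p @` [set y | `|y - xp| <= r / 2])).
      by apply: open_nbhs_nbhs; split=> //; exact: closed_openC.
    have [s [st ns]] := near_left t0 (ct _ Kn).
    have [_ xs [ps _ _]] := est s st.
    by apply: ns; exists (x s); [exact: xs|rewrite -xt_E; exact: chartK].
  have pt : dom p (c t) by rewrite -yct; apply: dom_param; exact: sub.
  have xt : x t = y by rewrite -xt_E -yct paramK//; exact: sub.
  have [_ x'd] := xd t t01 pt.
  split; [exact: pt| |].
    rewrite xt; apply: le_lt_trans yr _.
    by rewrite ltr_pdivrMr// ltr_pMr// ltr1n.
  have /differentiable_continuous x'c : differentiable x' t.
    by apply/derivable1_diffP; exact: x'd.
  have e0 : 0 < (d - G * d ^+ 2) / 2.
    by rewrite divr_gt0// subr_gt0 expr2 mulrA gtr_pMl.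
  move: x'c => /cvgrPdist_lt /(_ _ e0) H.
  have [s [st hs]] := near_left t0 H; have [h1 _ _] := est s st.
  have -> : x' t = (x' t - x' s) + (x' s - v) + v.
    by rewrite addrA subrK subrK.
  apply: le_lt_trans (ler_normD _ _) _.
  have := ler_normD (x' t - x' s) (x' s - v).
  have aux (a b e g m : R) : b <= g -> a < (d - g) / 2 -> e <= d ->
      0 < (d - g) / 2 -> m <= a + b -> m + e < 2 * d.
    by clear; lra.
  by move=> tri; exact: aux h1 hs vd e0 tri.
have opn t : 0 <= t <= 1 -> good t -> \forall s \near t, good s.
  move=> t01 [pt xt x't]; have [xd1 xd2] := xd t t01 pt;
    have [ct _] := geo t t01.
  have n1 : \forall s \near t, dom p (c s) by exact: (ct _ (dom_nbhs pt)).
  have n2 : \forall s \near t, `|x s - xp| < r.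
    have /differentiable_continuous xc : differentiable x t.
      by apply/derivable1_diffP; exact: xd1.
    have e0 : 0 < r - `|x t - xp| by rewrite subr_gt0.
    move: xc => /cvgrPdist_lt /(_ _ e0); apply: filterS => s.
    rewrite distrC => h; rewrite -[x s](subrK (x t)) -addrA.
    by apply: le_lt_trans (ler_normD _ _) _; rewrite -ltrBrDr.
  have n3 : \forall s \near t, `|x' s| < 2 * d.
    have /differentiable_continuous xc : differentiable x' t.
      by apply/derivable1_diffP; exact: xd2.
    have e0 : 0 < 2 * d - `|x' t| by rewrite subr_gt0.
    move: xc => /cvgrPdist_lt /(_ _ e0); apply: filterS => s.
    rewrite distrC => h; rewrite -[x' s](subrK (x' t)).
    by apply: le_lt_trans (ler_normD _ _) _; rewrite -ltrBrDr.
  by apply: filterS3 n1 n2 n3 => s h1 h2 h3; split;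
    [exact: h1|exact: h2|exact: h3].
have all_good t : 0 <= t <= 1 -> good t.
  move=> t01; apply: contrapT => bt.
  pose B := [set s | 0 <= s <= 1 /\ ~ good s].
  have hB : has_inf B.
    by split; [exists t|exists 0 => s [/andP[]]].
  pose T := inf B.
  have Ble s : B s -> T <= s by move=> Bs; apply: ge_inf => //; case: hB.
  have T0 : 0 <= T by apply: lb_le_inf; [case: hB|move=> s [/andP[]]].
  have T1 : T <= 1 by apply: le_trans (Ble t _) _ => //; case/andP: t01.
  have below s : 0 <= s < T -> good s.
    move=> /andP[s0 sT]; apply: contrapT => bs.
    have /Ble : B s by split=> //; rewrite s0 (le_trans (ltW sT)).
    by rewrite leNgt sT.
  have gT : good T.
    have [T0'|T0'] := eqVneq T 0; first by rewrite T0'.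
    by apply: close => //; rewrite lt_neqAle eq_sym T0' T0.
  have T01 : 0 <= T <= 1 by rewrite T0.
  have /nbhs_distP[e e0 eP] := opn T T01 gT.
  have [b Bb bT] := inf_adherent e0 hB.
  have [_ nb] := Bb; apply: nb; apply: eP.
  by rewrite ger0_norm ?subr_ge0 ?Ble// ltrBlDl.
have one : 0 <= (1 : R) <= 1 by rewrite ler01 lexx.
have [//|s /andP[s0 s1]|_ _] := estimate 1; first by apply: all_good;
  rewrite s0.
by rewrite scale1r => E; split; [case: (all_good 1 one)|exact: E].
Qed.

End GeodesicBound.

(** * Value and differential of a retraction at the origin *)

Section RetractionCenter.
Context {R : realType} {n : nat} {M : riemannianManifold R n} (p : M).
Implicit Types (q : M) (u v w x : 'rV[R]_n).
Local Notation xp := (chart p p).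
Local Notation tn := (tnorm (p := p)).

(** The bound uses any [d] with [|v| <= d] instead of [|v|] itself, so that it covers [v = 0] with
    [d] arbitrarily small. *)
Lemma exp_bound : exists d0 G : R, [/\ 0 < d0, 0 <= G &
  forall v q (d : R), 0 < d -> d < d0 -> `|v| <= d -> is_exp (p := p) v q ->
    dom p q /\ `|chart p q - xp - v| <= G * d ^+ 2].
Proof.
have [d0 [G [d00 G0 H]]] := geodesic_bound p.
exists d0, G; split=> // v q d dgt0 dd0 vd [c [e [e0 geo c0 dc <-]]].
rewrite -dc; apply: (H c d) => //; last by rewrite dc.
by move=> t /andP[t0 t1]; apply: geo; apply/andP; split; lra.
Qed.

Variable f : tangent p -> M.
Hypothesis fret : retraction 1 f.
Let g : 'rV[R]_n -> M := f.

(** For [v = 0] the order-one condition provides a point [q] with [is_exp 0 q] at distance 0 from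
    [f 0]. That [q] is [p] follows by letting [d] tend to 0 in [exp_bound]. *)
Lemma retraction0 : g 0 = p.
Proof.
have [_ [C [d [C0 d0 H]]]] := fret.
have [d1 [G [d10 G0 expP]]] := exp_bound.
have [|q expq qd] := H (0 : 'rV[R]_n); first by rewrite tnorm0.
have pq : dom p q.
  have d2 : 0 < d1 / 2 by rewrite divr_gt0.
  have d3 : d1 / 2 < d1 by rewrite ltr_pdivrMr// ltr_pMr// ltr1n.
  have d4 : `|0 : 'rV[R]_n| <= d1 / 2 by rewrite normr0 ltW.
  by have [] := expP 0 q _ d2 d3 d4 expq.
have E : chart p q = xp.
  apply/eqP; rewrite -subr_eq0 -normr_le0; apply/ler_addgt0Pr => e e0.
  rewrite add0r.
  pose s := Num.min (d1 / 2) (Num.min 1 (e / (G + 1))).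
  have G1 : 0 < G + 1 by rewrite ltr_wpDl.
  have s0 : 0 < s by rewrite !lt_min !divr_gt0// ltr01.
  have [s1 s2 s3] : [/\ s <= d1 / 2, s <= 1 & s <= e / (G + 1)].
    have : s <= s by []. rewrite {2}/s !le_min => /andP[-> /andP[-> ->]]. by [].
  have sd : s < d1 by apply: le_lt_trans s1 _;
    rewrite ltr_pdivrMr// ltr_pMr// ltr1n.
  have s4 : `|0 : 'rV[R]_n| <= s by rewrite normr0 ltW.
  have [_] := expP 0 q s s0 sd s4 expq; rewrite subr0 => h;
    apply: le_trans h _; apply: le_trans (_ : G * (e / (G + 1)) <= _).
    by rewrite ler_wpM2l// expr2; apply: le_trans s3; rewrite ler_piMl// ltW.
  by rewrite mulrCA ler_piMr ?ltW// ltr_pdivrMr// mul1r ltrDl.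
have qp : q = p by rewrite -(chartK pq) E chartK//; exact: dom_center.
apply: dist_le_0; move: qd; rewrite qp tnorm0 expr0n /= mulr0. by [].
Qed.

Let phi := chart p \o g.

Lemma retraction_differentiable : differentiable phi 0.
Proof.
have [[_ /(_ p 1%N)[+ _]] _] := fret; apply.
by rewrite /= -/(g 0) retraction0; exact: dom_center.
Qed.

Lemma near0_mul_lt (c e : R) : 0 < e -> \forall t \near (0 : R)^'+, t * c < e.
Proof.
move=> e0; have c1 : 0 < `|c| + 1 by rewrite ltr_wpDl.
have n1 : \forall t \near (0 : R)^'+, 0 < t by exact: nbhs_right_gt.
have n2 : \forall t \near (0 : R)^'+, t < e / (`|c| + 1).
  by apply: nbhs_right_lt; rewrite divr_gt0.
apply: filterS2 n1 n2 => t t0; rewrite ltr_pdivlMr//; apply: le_lt_trans.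
rewrite ler_wpM2l ?(ltW t0)//; apply: le_trans (ler_norm _) _.
by rewrite lerDl.
Qed.

(** Along [t *: v] the retraction and the exponential point are at distance of order [t ^+ 2], so by
    [chart_dist_le] their coordinates differ by the same order. The coordinates of the first are
    [t *: D] up to a small multiple of [t], those of the second [t *: v] up to order [t ^+ 2]. *)
Lemma retraction_derive v : 'D_v phi 0 = v.
Proof.
have [[fc _] [C [d [C0 d0 H]]]] := fret.
have [d1 [G [d10 G0 expP]]] := exp_bound.
have [k [k0 k1 k2]] := tnorm_equiv (p := p).
have [rho rho0 dlow] := chart_dist_le p.
have dphi := retraction_differentiable.
have phi0 : phi 0 = xp by rewrite /phi /= retraction0.
have [->|v0] := eqVneq v 0; first by rewrite derive0.
have vpos : 0 < `|v| by rewrite normr_gt0.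
pose V := `|v|.
have [D DE] : exists D, 'D_v phi 0 = D by exists ('D_v phi 0).
rewrite DE; apply/eqP; rewrite -subr_eq0 -normr_le0; apply/ler_addgt0Pr => e e0.
rewrite add0r.
pose e1 := e / (2 * (V + 1)).
have V0 : 0 <= V by exact: normr_ge0.
have V1 : 0 < V + 1 by rewrite ltr_wpDl.
have e10 : 0 < e1 by rewrite divr_gt0// mulr_gt0.
have [d2 d20 dP] := differentiable_eps dphi e10.
have {}dP t : 0 < t -> t * V < d2 ->
  `|phi (t *: v) - xp - t *: D| <= e1 * (t * V).
  move=> t0 tV; have := dP (t *: v).
  by rewrite subr0 normrZ gtr0_norm// => /(_ tV); rewrite phi0 deriveZv// DE.
(* [t * a] and [t * b] bound the coordinates of the retracted and of the exponential point. [K]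
   collects all coefficients of [t ^+ 2] in the final estimate, so [t * K] is what remains after
   division by [t]. *)
pose a := k * (e1 * V + `|D|).
pose b := k * (G * V ^+ 2 + V).
pose K := k * (4 * (C * tn v ^+ 2) + 2 / rho ^+ 2 * (a ^+ 3 + b ^+ 3)) + G * V
  ^+ 2.
have pdom : \forall t \near (0 : R)^'+, dom p (g (t *: v)).
  have gc : {for 0 *: v, continuous g} by exact: fc.
  have sc : {for (0 : R), continuous (fun t : R => t *: v)} by exact:
    scalel_continuous.
  have := continuous_comp sc gc.
  have p0 : nbhs ((g \o (fun t : R => t *: v)) 0) (dom p).
    by rewrite /= scale0r retraction0; apply: dom_nbhs; exact: dom_center.
  by move=> /(_ _ p0) /=; exact: cvg_at_right_filter.
have e20 : 0 < e / 2 by rewrite divr_gt0.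
near (0 : R)^'+ => t.
have t0 : 0 < t by near: t; exact: nbhs_right_gt.
have t1 : t < 1 by near: t; exact: nbhs_right_lt.
have tV1 : t * V < d1 by near: t; exact: near0_mul_lt.
have tV2 : t * V < d2 by near: t; exact: near0_mul_lt.
have tV3 : t * tn v < d by near: t; exact: near0_mul_lt.
have ta : t * a < rho by near: t; exact: near0_mul_lt.
have tb : t * b < rho by near: t; exact: near0_mul_lt.
have tK : t * K < e / 2 by near: t; exact: near0_mul_lt.
have pt : dom p (g (t *: v)) by near: t.
have tnw : tn (t *: v) = t * tn v by rewrite tnormZ gtr0_norm.
have [|q expq qd] := H (t *: v : 'rV[R]_n); first by rewrite tnw.
have nw : `|t *: v| = t * V by rewrite normrZ gtr0_norm.
have nwle : `|t *: v| <= t * V by rewrite nw.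
have [pq qE] := expP (t *: v) q (t * V) (mulr_gt0 t0 vpos) tV1 nwle expq.
have e2E : 0 <= C * tn (t *: v) ^+ 2 by rewrite mulr_ge0 ?(ltW C0)// sqr_ge0.
have h1 := dP t t0 tV2.
have tale : tn (chart p (g (t *: v)) - xp) <= t * a.
  apply: le_trans (k2 _) _; rewrite /a mulrCA ler_wpM2l ?(ltW k0)//.
  rewrite -[chart p (g (t *: v)) - xp](subrK (t *: D)).
  apply: le_trans (ler_normD _ _) _; rewrite mulrDr lerD//.
    by apply: le_trans h1 _; rewrite mulrCA.
  by rewrite normrZ gtr0_norm.
have tble : tn (chart p q - xp) <= t * b.
  apply: le_trans (k2 _) _; rewrite /b mulrCA ler_wpM2l ?(ltW k0)//.
  rewrite -[chart p q - xp](subrK (t *: v)).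
  apply: le_trans (ler_normD _ _) _; rewrite nw mulrDr lerD//.
  apply: le_trans qE _; rewrite exprMn mulrCA ler_wpM2r//.
    by rewrite mulr_ge0// sqr_ge0.
  by rewrite expr2 ler_piMl// ltW.
have h2 := dlow _ _ _ pt pq e2E qd (le_trans tale (ltW ta)) (le_trans tble
  (ltW tb)).
have h3 : tn (chart p q - chart p (g (t *: v))) <= t ^+ 2 *
    (4 * (C * tn v ^+ 2) + 2 / rho ^+ 2 * (a ^+ 3 + b ^+ 3)).
  apply: le_trans h2 _; rewrite tnw.
  have cube z y : 0 <= z -> z <= t * y -> z ^+ 3 <= t ^+ 2 * y ^+ 3.
    move=> z0 zy; apply: le_trans (_ : (t * y) ^+ 3 <= _).
      by rewrite ler_pXn2r// nnegrE// (le_trans z0).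
    have y0 : 0 <= y by rewrite -(pmulr_rge0 _ t0) (le_trans z0).
    rewrite exprMn ler_wpM2r ?exprn_ge0// exprS ler_piMl ?sqr_ge0// ltW//.
  have c1 := cube _ _ (tnorm_ge0 _) tale;
    have c2 := cube _ _ (tnorm_ge0 _) tble.
  rewrite [leRHS]mulrDr; apply: lerD.
    by rewrite exprMn; move: (tn v) => tv; rewrite le_eqVlt; apply/orP; left;
      apply/eqP; ring.
  by rewrite mulrCA ler_wpM2l ?divr_ge0 ?sqr_ge0// [leRHS]mulrDr lerD.
have telescope (A B X Y Z : 'rV[R]_n) :
    Y - Z = - (A - X - Y) - (B - A) + (B - X - Z).
  by apply/rowP => i; rewrite !mxE; ring.
have fin : t * `|D - v| <= e1 * (t * V) + k * (t ^+ 2 *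
    (4 * (C * tn v ^+ 2) + 2 / rho ^+ 2 * (a ^+ 3 + b ^+ 3))) + G * (t * V) ^+
      2.
  rewrite -{1}(gtr0_norm t0) -normrZ.
  have -> : t *: (D - v) = - (chart p (g (t *: v)) - xp - t *: D) -
      (chart p q - chart p (g (t *: v))) + (chart p q - xp - t *: v).
    by rewrite scalerBr; exact: telescope.
  apply: le_trans (ler_normD _ _) _; apply: lerD => //.
  apply: le_trans (ler_normB _ _) _; rewrite normrN; apply: lerD => //.
  by apply: le_trans (k1 _) _; rewrite ler_wpM2l// ltW.
have {}fin : t * `|D - v| <= t * (e1 * V + t * K).
  apply: le_trans fin _; rewrite le_eqVlt; apply/orP; left; apply/eqP.
  by rewrite /K; move: (4 * _ + _) => Q; ring.
rewrite ler_pM2l// in fin; apply: le_trans fin _.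
rewrite [leRHS](splitr e) lerD//; last exact: ltW.
rewrite /e1 invfM mulrA -mulrA ler_piMr ?ltW//.
by rewrite mulrC ltr_pdivrMr// mul1r ltrDl.
Unshelve. all: by end_near. Qed.

End RetractionCenter.

(** * Gradient and Hessian *)

(** Dividing by [t], then by [t ^+ 2], and letting [t] tend to 0 isolates the two coefficients.
    Applied along rays, this gives uniqueness of gradient and Hessian. *)
Lemma cubic_bound_eq0 (R : realType) (al be C d : R) : 0 < d ->
  (forall t, 0 < t < d -> `|t * al + t ^+ 2 * be| <= C * t ^+ 3) ->
  al = 0 /\ be = 0.
Proof.
move=> d0 H.
have small (a B : R) : 0 <= B -> (forall t, 0 < t < Num.min d 1 ->
  `|a| <= t * B) -> a = 0.
  move=> B0 aB; apply/eqP; rewrite -normr_le0; apply/ler_addgt0Pr => e e0.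
  rewrite add0r; pose t := Num.min (Num.min d 1 / 2) (e / (B + 1)).
  have B1 : 0 < B + 1 by rewrite ltr_wpDl.
  have m0 : 0 < Num.min d 1 by rewrite lt_min d0 ltr01.
  have t0 : 0 < t by rewrite lt_min !divr_gt0.
  have tm : t < Num.min d 1.
    apply: (@le_lt_trans _ _ (Num.min d 1 / 2)); first by rewrite ge_min lexx.
    by rewrite ltr_pdivrMr// ltr_pMr// ltr1n.
  have te : t <= e / (B + 1) by rewrite ge_min lexx orbT.
  have := aB t; rewrite t0 tm => /(_ isT) h; apply: le_trans h _.
  apply: le_trans (_ : e / (B + 1) * B <= _); first by rewrite ler_wpM2r.
  by rewrite mulrAC ler_pdivrMr// ler_wpM2l ?ltW// ltrDl.
have al0 : al = 0.
  apply: (small _ (`|be| + `|C|)); first by rewrite addr_ge0.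
  move=> t /andP[t0]; rewrite lt_min => /andP[td t1].
  have := H t; rewrite t0 td => /(_ isT) h.
  rewrite -(ler_pM2l t0) -{1}(gtr0_norm t0) -normrM.
  have -> : t * al = (t * al + t ^+ 2 * be) - t ^+ 2 * be by rewrite addrK.
  apply: le_trans (ler_normB _ _) _.
  rewrite normrM (ger0_norm (x := t ^+ 2)) ?sqr_ge0//.
  have hC : C * t ^+ 3 <= `|C| * t ^+ 2.
    apply: le_trans (_ : `|C| * t ^+ 3 <= _).
      by rewrite ler_wpM2r ?exprn_ge0 ?(ltW t0)// ler_norm.
    by rewrite ler_wpM2l// exprS ler_piMl ?sqr_ge0// ltW.
  have -> : t * (t * (`|be| + `|C|)) = `|C| * t ^+ 2 + t ^+ 2 * `|be| by ring.
  by rewrite lerD2r (le_trans h).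
split=> //; apply: (small _ `|C|) => // t /andP[t0].
rewrite lt_min => /andP[td t1].
have := H t; rewrite t0 td => /(_ isT); rewrite al0 mulr0 add0r normrM => h.
have t20 : 0 < t ^+ 2 by rewrite exprn_gt0.
rewrite -(ler_pM2l t20) -{1}(gtr0_norm t20); apply: le_trans h _.
rewrite (_ : t ^+ 2 * (t * `|C|) = `|C| * t ^+ 3); last by ring.
by rewrite ler_wpM2r ?exprn_ge0 ?(ltW t0)// ler_norm.
Qed.

Section GradHess.
Context {R : realType} {n : nat} {M : riemannianManifold R n} (p : M).
Implicit Types (q : M) (u v w x : 'rV[R]_n).
Local Notation xp := (chart p p).
Local Notation ip := (inner (p := p)).
Local Notation tn := (tnorm (p := p)).

Variables (f : tangent p -> M) (J : M -> R).
Hypothesis fret : retraction 1 f.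
Hypothesis J3 : times_differentiable 3 J.
Let g : 'rV[R]_n -> M := f.
Let m : 'rV[R]_n -> R := J \o g.

Definition pullback_dom : set 'rV[R]_n := [set v | dom p (g v)].

Lemma pullback_dom_open : open pullback_dom.
Proof.
have [[fc _] _] := fret; rewrite openE => v /= pv.
by apply: (fc v); exact: dom_nbhs.
Qed.

Lemma pullback_dom0 : pullback_dom 0.
Proof. by rewrite /pullback_dom /= /g (retraction0 fret);
  exact: dom_center. Qed.

Lemma pullback_kdiff : kdiff 3 pullback_dom m.
Proof.
have [[_ fs] _] := fret.
have K := @kdiff_comp _ _ _ 3 pullback_dom (chart_codom p) (chart p \o g)
  (J \o param p) pullback_dom_open.
have {}K := K (fun v pv => codom_chart pv) (fs p 3) (J3 p).
apply: kdiff_congr pullback_dom_open _ K => v pv.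
by rewrite /= chartK.
Qed.

(** [g0] and [H0] represent the first and second derivatives of [m] with respect to the inner
    product. Matrices act on row vectors from the right, hence the transpose in [H0]. *)
Let b : 'rV[R]_n := \row_i 'D_'e_i m 0.
Let B : 'M[R]_n := \matrix_(i, j) 'D_'e_i ('D_'e_j m) 0.
Let g0 : 'rV[R]_n := b *m invmx (Defs.metric p).
Let H0 : 'M[R]_n := B^T *m invmx (Defs.metric p).

Let ip_g0 v : ip v g0 = 'D_v m 0.
Proof.
rewrite /g0 inner_inv mxE; have [md _] := pullback_kdiff.
rewrite (derive_rV idfun v (md 0 pullback_dom0)).
by apply: eq_bigr => i _; rewrite !mxE.
Qed.

Let ip_H0 u v : ip u (v *m H0) = 'D_u ('D_v m) 0.
Proof.
rewrite /H0 mulmxA inner_inv trmx_mul trmxK mulmxA mxE.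
have := @derive2_rV2 R _ n idfun pullback_dom m pullback_dom_open 0 u v
  (kdiffS pullback_kdiff) pullback_dom0; rewrite /= => ->.
under eq_bigr do rewrite mxE mulr_suml.
rewrite exchange_big /=; apply: eq_bigr => i _; rewrite mulr_sumr.
by apply: eq_bigr => j _; rewrite !mxE -mulrA (mulrC (v 0 j)).
Qed.

Let self_adj : self_adjoint p H0.
Proof.
move=> u v; rewrite -[LHS]innerC -!/(ip _ _) !ip_H0.
exact: (schwarz_derive _ _ pullback_dom_open (kdiffS pullback_kdiff)
  pullback_dom0).
Qed.

Let expansion : second_order_expansion J f g0 H0.
Proof.
have idle v : `|idfun v| <= `|v| by [].
have [C [d [C0 d0 H]]] :=
  taylor2 idle pullback_dom_open pullback_kdiff pullback_dom0.
have [k [k0 k1 _]] := tnorm_equiv (p := p).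
exists (C * k ^+ 3), (d / k); split; first by rewrite divr_gt0.
move=> v vd; have vd' : `|(v : 'rV[R]_n)| < d.
  by apply: le_lt_trans (k1 v) _; rewrite mulrC -ltr_pdivlMr.
have := H v vd'; rewrite add0r /=.
have -> : m 0 = J p by rewrite /m /= /g (retraction0 fret).
rewrite -ip_g0 -ip_H0 => h.
have -> : J (f v) - (J p + ip v g0 + ip v (v *m H0) / 2) =
  m v - J p - ip v g0 - ip v (v *m H0) / 2.
  by rewrite !opprD !addrA.
apply: le_trans h _; rewrite -mulrA -exprMn ler_wpM2l//.
by rewrite ler_pXn2r ?nnegrE// mulr_ge0 ?tnorm_ge0// ltW.
Qed.

(** The difference of two expansions along a ray is cubic, so the linear and quadratic parts agree.
    Polarisation together with self-adjointness turns equality of the quadratic forms into equality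
    of the operators. *)
Lemma grad_hessE : grad_hess J f = (g0, H0).
Proof.
apply: xget_unique; first by split; [exact: self_adj|exact: expansion].
move=> [g' H'] [/= sa' [C' [d' [d'0 h']]]].
have [C [d [d0 h]]] := expansion.
have key v : ip v (g0 - g') = 0 /\ ip v (v *m (H0 - H')) = 0.
  have [->|v0] := eqVneq v 0; first by rewrite !inner0l.
  have tv := tnorm_gt0 (p := p) v0.
  have [||e1 e2] := @cubic_bound_eq0 R (ip v (g0 - g')) (ip v (v *m (H0 - H'))
    / 2)
    ((C + C') * tn v ^+ 3) (Num.min d d' / tn v).
  - by rewrite divr_gt0// lt_min d0.
  - move=> t /andP[t0]; rewrite ltr_pdivlMr// lt_min => /andP[td td'].
    have tE : tn (t *: v) = t * tn v by rewrite tnormZ gtr0_norm.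
    have := h (t *: v); rewrite -/(tn _) tE => /(_ td).
    have := h' (t *: v); rewrite -/(tn _) tE => /(_ td').
    rewrite -!/(ip _ _) -!scalemxAl !innerZl !innerZr.
    rewrite mulmxBr !innerDr !innerNr.
    set a := ip v g0; set a' := ip v g'; set c := ip v (v *m H0).
    set c' := ip v (v *m H'); set Jf := J _; set T := tn v.
    move=> h1 h2.
    have -> : t * (a - a') + t ^+ 2 * ((c - c') / 2) =
      (Jf - (J p + t * a' + t * (t * c') / 2)) -
      (Jf - (J p + t * a + t * (t * c) / 2)) by field.
    apply: le_trans (ler_normB _ _) _; apply: le_trans (lerD h1 h2) _.
    by rewrite le_eqVlt; apply/orP; left; apply/eqP; ring.
  by split=> //; move/eqP: e2; rewrite mulf_eq0 invr_eq0 pnatr_eq0 orbF => /eqP.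
have gE : g' = g0.
  apply/eqP; rewrite eq_sym -subr_eq0; apply/eqP.
  by apply: (inner_eq0 (p := p)) => w; case: (key w).
have HE : H' = H0.
  apply/eqP; rewrite eq_sym -subr_eq0; apply/eqP; set D := H0 - H' in key *.
  have Dsa u v : ip (u *m D) v = ip u (v *m D).
    rewrite /D !mulmxBr innerDl innerDr innerNl innerNr.
    by rewrite -/(ip _ _) (self_adj u v) (sa' u v).
  have polar u v : ip u (v *m D) = 0.
    have [_] := key (u + v); rewrite mulmxDl innerDl !innerDr.
    have [_ ->] := key u; have [_ ->] := key v.
    rewrite addr0 add0r -(Dsa v u) (innerC (v *m D)) => /eqP.
    by rewrite -mulr2n mulrn_eq0 /= => /eqP.
  apply/row_matrixP => i; rewrite row0 rowE.
  by apply: (inner_eq0 (p := p)) => w; exact: polar.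
by rewrite gE HE.
Qed.

Lemma inner_grad v : ip v (grad J f) = 'D_v m 0.
Proof. by rewrite /grad grad_hessE ip_g0. Qed.

Lemma inner_hess u v : ip u (v *m hess J f) = 'D_u ('D_v m) 0.
Proof. by rewrite /hess grad_hessE ip_H0. Qed.

Lemma hess_self_adjoint u v : ip (u *m hess J f) v = ip u (v *m hess J f).
Proof. by rewrite /hess grad_hessE; exact: self_adj. Qed.

End GradHess.

(** * The Newton iteration *)

Section VerticalInclusion.
Context {R : realType} {n : nat}.

Definition vert (v : 'rV[R]_n) : 'rV[R]_n * 'rV[R]_n := (0, v).

Lemma vert_is_linear : linear vert.
Proof.
by move=> a u v; congr pair; rewrite /= ?scaler0 ?addr0.
Qed.

HB.instance Definition _ := GRing.isLinear.Build R 'rV[R]_n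
  ('rV[R]_n * 'rV[R]_n)%type _ vert vert_is_linear.

Definition vert_lin :
  {linear 'rV[R]_n -> (('rV[R]_n * 'rV[R]_n)%type : normedModType R)} := vert.

Lemma norm_vert v : `|vert v| <= `|v|.
Proof. by rewrite prod_normE /= normr0 ge_max lexx normr_ge0. Qed.

Lemma norm_pairB (x y v : 'rV[R]_n) (d : R) : `|x - y| < d -> `|v| < d ->
  `|(x, v) - (y, 0)| < d.
Proof.
by move=> xy vd; rewrite prod_normE /= gt_max xy subr0.
Qed.

(** The two difference quotients coincide term by term, so the identity can be iterated to higher
    derivatives without any differentiability assumption. *)
Lemma derive_vert (U : normedModType R) (K : 'rV[R]_n * 'rV[R]_n -> U)
    (m : 'rV[R]_n -> U) (T : 'rV[R]_n -> 'rV[R]_n) x v w : linear T ->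
  (forall v, K (x, v) = m (T v)) -> 'D_(vert w) K (x, v) = 'D_(T w) m (T v).
Proof.
move=> Tl KE; rewrite /derive; set f1 := fun h => _.
set f2 := fun h => _ *: (m _ - m _).
suff -> : f1 = f2 by [].
apply/funext => h; rewrite /f1 /f2.
have E : (K \o shift (x, v)) (h *: vert w) = m (T (h *: w + v)).
  by rewrite -KE; congr K; congr pair; rewrite /= scaler0 add0r.
by rewrite E KE Tl.
Qed.

End VerticalInclusion.

(** * The Newton step in coordinates *)

Section NewtonCore.
Context {R : realType} {n : nat} {M : riemannianManifold R n} (p : M).
Implicit Types (u v w x y : 'rV[R]_n).
Local Notation xp := (chart p p).
Local Notation ip := (inner (p := p)).
Local Notation tn := (tnorm (p := p)).
Local Notation V := ('rV[R]_n * 'rV[R]_n)%type.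

Lemma derive1_eps (j : 'rV[R]_n -> R) (B : set 'rV[R]_n) y0 (e : R) : open B ->
  kdiff 2 B j -> B y0 -> 0 < e ->
    exists2 d : R, 0 < d & forall y, `|y - y0| < d ->
    B y /\ forall w, `|'D_w j y - 'D_w j y0 - 'D_(y - y0) ('D_w j) y0|
      <= e * `|y - y0| * `|w|.
Proof.
move=> Bo [jd jD] By e0; pose k := e / (n%:R + 1).
have N0 : 0 < n%:R + 1 :> R by rewrite ltr_wpDl.
have k0 : 0 < k by rewrite divr_gt0.
have nk : n%:R * k <= e.
  rewrite /k mulrCA; apply: ler_piMr; first exact: ltW.
  by rewrite ler_pdivrMr// mul1r lerDl.
clearbody k.
pose g (i : 'I_n) := 'D_'e_i j.
have gd i : differentiable (g i) y0 by apply: (jD 'e_i).1.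
have [d d0 dP] : exists2 d : R, 0 < d & forall y, `|y - y0| < d ->
    B y /\ forall i, `|g i y - g i y0 - 'D_(y - y0) (g i) y0| <= k * `|y - y0|.
  apply/nbhs_distP; apply: filterI; first exact: open_nbhs_nbhs.
  apply: (@filter_forall _ _ _ _ (nbhs_filter (y0 : 'rV[R]_n))) => i.
  by apply/nbhs_distP; exact: differentiable_eps.
exists d => // y /dP[By' gP]; split=> // w.
have E z : B z -> 'D_w j z = \sum_i w 0 i * g i z.
  by move=> Bz; rewrite (derive_rV idfun w (jd z Bz)).
have E2 : 'D_(y - y0) ('D_w j) y0 = \sum_i w 0 i * 'D_(y - y0) (g i) y0.
  exact: (@derive2_rV _ _ _ idfun B j Bo y0 (y - y0) w (conj jd jD) By).
rewrite (E _ By) (E _ By') E2 -!sumrB.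
under eq_bigr do rewrite -!mulrBr.
apply: le_trans (norm_sum_le w gP) _.
rewrite (mulrC `|w|) !mulrA; apply: ler_wpM2r => //; exact: ler_wpM2r.
Qed.

Lemma vertical_derivative_near (Phi : V -> 'rV[R]_n) (W : set V) z0 (e : R) :
  open W -> kdiff 2 W Phi -> W z0 ->
  (forall w, 'D_(vert w) Phi z0 = w) -> 0 < e ->
  exists2 d : R, 0 < d & forall z, `|z - z0| < d ->
    W z /\ forall w, `|'D_(vert w) Phi z - w| <= e * `|w|.
Proof.
move=> Wo [Pd PD] Wz DP e0; pose k := e / (n%:R + 1).
have N0 : 0 < n%:R + 1 :> R by rewrite ltr_wpDl.
have k0 : 0 < k by rewrite divr_gt0.
have nk : n%:R * k <= e.
  rewrite /k mulrCA; apply: ler_piMr; first exact: ltW.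
  by rewrite ler_pdivrMr// mul1r lerDl.
clearbody k.
pose g (i : 'I_n) := 'D_(vert 'e_i) Phi.
have gc i : {for z0, continuous (g i)}.
  by apply: differentiable_continuous; apply: (PD (vert 'e_i)).1.
have [d d0 dP] : exists2 d : R, 0 < d & forall z, `|z - z0| < d ->
    W z /\ forall i, `|g i z - g i z0| <= k.
  apply/nbhs_distP; apply: filterI; first exact: open_nbhs_nbhs.
  apply: (@filter_forall _ _ _ _ (nbhs_filter (z0 : V))) => i.
  move: (gc i) => /cvgrPdist_le /(_ k k0); apply: filterS => z H.
  by rewrite distrC; exact: H.
exists d => // z /dP[Wz' gP]; split=> // w.
have E z' : W z' -> 'D_(vert w) Phi z' = \sum_i w 0 i *: g i z'.
  by move=> Wz2; exact: (derive_rV vert_lin w (Pd z' Wz2)).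
rewrite -[X in _ - X]DP (E _ Wz) (E _ Wz') -sumrB.
under eq_bigr do rewrite -scalerBr.
apply: rV_norm_le => [|c]; first by rewrite mulr_ge0 ?(ltW e0).
rewrite summxE; under eq_bigr do rewrite mxE.
apply: le_trans (norm_sum_le w (C := k) _) _.
  by move=> i; apply: le_trans (coord_le_norm _ _) (gP i).
rewrite (mulrC `|w|) mulrA; exact: ler_wpM2r.
Qed.

Variables (j : 'rV[R]_n -> R) (B : set 'rV[R]_n).
Variables (Phi : V -> 'rV[R]_n) (W : set V) (k : V -> R).
Hypotheses (Bo : open B) (Wo : open W) (j3 : kdiff 3 B j) (P2 : kdiff 2 W Phi).
Hypotheses (k3 : kdiff 3 W k) (WB : forall z, W z -> B (Phi z)).
Hypothesis kE : forall z, W z -> k z = j (Phi z).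
Let z0 : V := (xp, 0).
Hypotheses (Wz0 : W z0) (Pz0 : Phi z0 = xp).
Hypothesis DPhi : forall x, W (x, 0) ->
  Phi (x, 0) = x /\ forall w, 'D_(vert w) Phi (x, 0) = w.
Hypothesis crit : forall w, 'D_w j xp = 0.

Lemma derive_k z w : W z -> 'D_(vert w) k z = 'D_('D_(vert w) Phi z) j (Phi z).
Proof.
move=> Wz; rewrite -(derive_chain _ (P2.1 _ Wz) (j3.1 _ (WB Wz))).
apply: near_eq_derive; apply: filterS (open_nbhs_nbhs (conj Wo Wz)) => z' Wz'.
exact: kE.
Qed.

(* As [xp] is critical, the second derivatives of [Phi] do not contribute. *)
Lemma derive2_k u w :
  'D_(vert u) ('D_(vert w) k) z0 = 'D_u ('D_w j) xp.
Proof.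
have [Pd PD] := P2; have [jd jD] := j3; have Bxp : B xp by rewrite -Pz0;
  exact: WB.
pose a (i : 'I_n) z : R := 'D_(vert w) Phi z 0 i.
pose b (i : 'I_n) z : R := 'D_'e_i j (Phi z).
have E : \forall z \near z0, \sum_i a i z * b i z = 'D_(vert w) k z.
  apply: filterS (open_nbhs_nbhs (conj Wo Wz0)) => z Wz.
  by rewrite derive_k// (derive_rV idfun _ (jd _ (WB Wz))).
have aD i : derivable (a i) z0 (vert u).
  apply: differentiable_derivable; apply: differentiable_entry.
  by apply: (PD (vert w)).1.
have jDd i : differentiable ('D_'e_i j) (Phi z0) by apply: (jD 'e_i).1;
  rewrite Pz0.
have bD i : derivable (b i) z0 (vert u).
  apply: differentiable_derivable.
  exact: (differentiable_comp (Pd _ Wz0) (jDd i)).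
have bE i : 'D_(vert u) (b i) z0 = 'D_u ('D_'e_i j) xp.
  have := derive_chain (vert u) (Pd _ Wz0) (jDd i).
  by rewrite (DPhi Wz0).2 Pz0.
rewrite -(near_eq_derive _ E).
have D i : is_derive z0 (vert u) (fun z => a i z * b i z)
    (w 0 i * 'D_u ('D_'e_i j) xp).
  apply: (is_derive_eq (is_deriveM (derivableP (aD i)) (derivableP (bD i)))).
  by rewrite bE /a /b (DPhi Wz0).2 Pz0 crit scale0r addr0.
have -> : (fun z => \sum_i a i z * b i z) = \sum_i (fun z => a i z * b i z).
  by apply/funext => z; rewrite fct_sumE.
rewrite derive_sum; last by move=> i; exact: (ex_derive (is_derive := D i)).
rewrite (@derive2_rV _ _ _ idfun B j Bo xp u w (kdiffS j3) Bxp).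
by apply: eq_bigr => i _; exact: (derive_val (is_derive := D i)).
Qed.

End NewtonCore.

Lemma absorb_quarter (R : realFieldType) (s t r : R) :
  t <= s + r -> s <= 1 / 4 * (t + r) -> 0 <= r -> t <= 2 * r.
Proof. by move=> *; lra. Qed.

(** The quarter of [e] on the right is absorbed, leaving [8 / 3 * A + U / 3], which is rounded up.
    This is the origin of [4 * a * b + 2] in the chart estimate. *)
Lemma absorb_final (R : realFieldType) (A U e q1 q2 : R) :
  0 <= e -> 0 <= U -> 0 <= A -> q1 <= 1 / 4 * U -> q2 <= 1 / 4 * e ->
  e <= 2 * A + q1 + q2 -> e <= 4 * A + 2 * U.
Proof. by move=> *; lra. Qed.

Section NewtonEstimate.
Context {R : realType} {n : nat} {M : riemannianManifold R n} (p : M).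
Implicit Types (u v w x y : 'rV[R]_n).
Local Notation xp := (chart p p).
Local Notation ip := (inner (p := p)).
Local Notation tn := (tnorm (p := p)).
Local Notation V := ('rV[R]_n * 'rV[R]_n)%type.
Variables (j : 'rV[R]_n -> R) (B : set 'rV[R]_n).
Variables (Phi : V -> 'rV[R]_n) (W : set V) (k : V -> R).
Hypotheses (Bo : open B) (Wo : open W) (j3 : kdiff 3 B j) (P2 : kdiff 2 W Phi).
Hypotheses (k3 : kdiff 3 W k) (WB : forall z, W z -> B (Phi z)).
Hypothesis kE : forall z, W z -> k z = j (Phi z).
Let z0 : V := (xp, 0).
Hypotheses (Wz0 : W z0) (Pz0 : Phi z0 = xp).
Hypothesis DPhi : forall x, W (x, 0) ->
  Phi (x, 0) = x /\ forall w, 'D_(vert w) Phi (x, 0) = w.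
Hypothesis crit : forall w, 'D_w j xp = 0.
Variables (H : 'M[R]_n) (a b c : R).
Hypotheses (a0 : 0 <= a) (b0 : 0 <= b) (c0 : 0 <= c) (Hunit : H \in unitmx).
Hypothesis HE : forall u w, ip u (w *m H) = 'D_u ('D_w j) xp.
Hypothesis Hsa : forall u w, ip (u *m H) w = ip u (w *m H).
Hypothesis Hb : forall v, tn (v *m invmx H) <= b * tn v.
Hypothesis Hc : forall v, tn (v *m H) <= c * tn v.
Hypothesis Ha : forall v w,
  `|'D_(vert v) ('D_(vert v) ('D_(vert w) k)) z0| <= a * tn v ^+ 2 * tn w.

(** Test with [w = v *m H]: by self-adjointness the left-hand side becomes [tn (v *m H) ^+ 2], so
    [tn (v *m H) <= Q], and the bound [b] on the inverse applies. *)
Lemma hess_coercive v (Q : R) : 0 <= Q ->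
  (forall w, `|ip v (w *m H)| <= Q * tn w) -> tn v <= b * Q.
Proof.
move=> Q0 vQ; rewrite -[v in tn v](mulmxK Hunit); apply: le_trans (Hb _) _.
rewrite ler_wpM2l//; have [->|vH0] := eqVneq (v *m H) 0;
  first by rewrite tnorm0.
have t0 := tnorm_gt0 (p := p) vH0.
have := vQ (v *m H); rewrite -Hsa -sqr_tnorm ger0_norm ?sqr_ge0// expr2.
by rewrite ler_pM2r.
Qed.

(* [k (x, v)] is [J (F q v)] and [Phi (x, v)] is [F q v] in the chart at [p],
   where [q] has coordinates [x]; the last two items say that the Hessian at [q]
   is invertible, and that the Newton step [v] has a quadratically small
   error. *)
Theorem newton_estimate : exists2 d : R, 0 < d & forall x, `|x - xp| < d ->
  [/\ W (x, 0),
      forall v, (forall w, 'D_(vert w) ('D_(vert v) k) (x, 0) = 0) -> v = 0 &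
      forall v, (forall w, 'D_(vert w) k (x, 0) +
                   'D_(vert v) ('D_(vert w) k) (x, 0) = 0) ->
        W (x, v) /\ tn (Phi (x, v) - xp) <= (4 * a * b + 2) * tn (x - xp) ^+ 2].
Proof.
have [kap [kap0 k1 k2]] := tnorm_equiv (p := p).
have Bxp : B xp by rewrite -Pz0; exact: WB.
(* A single tolerance for all small errors. It remains at most [1 / 4] after the amplification [b]
   of the inverse Hessian, also when multiplied by the factor [c + 2] that the error at the new
   point produces. *)
pose eta := (4 * (b + 1) * (c + 2))^-1.
have b1 : 0 < b + 1 by rewrite ltr_wpDl.
have c2 : 0 < c + 2 by rewrite ltr_wpDl.
have eta0 : 0 < eta by rewrite invr_gt0 !mulr_gt0.
have etaE : 4 * (b + 1) * (c + 2) * eta =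
  1 by rewrite mulfV// gt_eqF// !mulr_gt0.
clearbody eta.
have p1 : 0 <= b * eta by rewrite mulr_ge0// ltW.
have p2 : 0 <= b * eta * c by rewrite mulr_ge0.
have p3 : 0 <= eta * c by rewrite mulr_ge0// ltW.
have eta_b : b * eta <= 1 / 4 by lra.
have eta_bc : b * eta * (c + 2) <= 1 / 4 by lra.
have eta1 : eta <= 1 by lra.
have kap2 : 0 < kap ^+ 2 by rewrite exprn_gt0.
have [C1 [d1 [C10 d10 S1]]] := derive2_lip vert_lin Wo k3 Wz0.
have e20 : 0 < eta / kap ^+ 2 by rewrite divr_gt0.
have [d2 d20 S2] := derive1_eps Bo (kdiffS j3) Bxp e20.
(* In terms of [tn u] the sum [|u| + |v|] will be at most [3 * kap * tn u] and [|v|] at most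
   [2 * kap * tn u], hence the 6; the third [kap] comes from [w]. *)
have e30 : 0 < eta / (6 * kap ^+ 3) by rewrite divr_gt0// mulr_gt0// exprn_gt0.
have [d3 d30 S3] := second_order_increment (L :=
  vert_lin) norm_vert Wo k3 Wz0 e30.
have [d4 d40 S4] := vertical_derivative_near Wo P2 Wz0 (DPhi Wz0).2 e20.
have [d5 d50 S5] : exists2 d : R, 0 < d & forall z, `|z - z0| < d ->
  `|Phi z - xp| < d2.
  have /cvgrPdist_lt /(_ _ d20) := differentiable_continuous (P2.1 _ Wz0).
  move=> /nbhs_distP[d d0 dP]; exists d => // z /dP;
    rewrite Pz0 distrC. by apply.
(* Within this radius the fibre Hessian at [(x, 0)] differs from the one at [z0] by at most [eta],
   measured in [tnorm]. *)
pose d6 := eta / (C1 * kap ^+ 2 + 1).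
have C11 : 0 < C1 * kap ^+ 2 + 1 by rewrite ltr_wpDl// mulr_ge0// ltW.
have d60 : 0 < d6 by rewrite divr_gt0.
pose dm := Num.min (Num.min d1 (Num.min d2 d3)) (Num.min d4 (Num.min d5 d6)).
have dm0 : 0 < dm by rewrite !lt_min d10 d20 d30 d40 d50 d60.
have N0 : 0 < 2 * kap ^+ 2 + 1 by rewrite ltr_wpDl// mulr_ge0// ltW.
(* The step will satisfy [|v| <= 2 * kap ^+ 2 * |u|], so this radius places both [u] and [v] within
   [dm]. *)
exists (dm / (2 * kap ^+ 2 + 1)); first by rewrite divr_gt0.
move=> x; rewrite ltr_pdivlMr// => xd.
pose u := x - xp; rewrite -/u in xd *.
have u0 : 0 <= `|u| := normr_ge0 u.
have small (r : R) : r < dm ->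
  [/\ r < d1, r < d2 & r < d3] /\ [/\ r < d4, r < d5 & r < d6].
  by rewrite !lt_min => /andP[/andP[-> /andP[-> ->]] /andP[-> /andP[-> ->]]].
have udm : `|u| < dm.
  by apply: le_lt_trans xd; rewrite ler_peMr// lerDr mulr_ge0// ltW.
have [[u1 u2 u3] [u4 u5 u6]] := small _ udm.
have near0 (r : R) : `|u| < r -> `|(x, 0 : 'rV[R]_n) - z0| < r.
  by move=> ur; apply: norm_pairB => //; rewrite normr0 (le_lt_trans u0).
have Wx : W (x, 0) := (S1 _ (near0 _ u1)).1.
have A1 v w : `|'D_(vert v) ('D_(vert w) k) (x, 0) - ip v (w *m H)| <=
  eta * tn v * tn w.
  rewrite HE -(derive2_k Bo Wo j3 P2 WB kE Wz0 Pz0 DPhi crit).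
  have [_ /(_ v w) h] := S1 _ (near0 _ u1); apply: le_trans h _.
  apply: le_trans (_ : C1 * `|u| * (kap * tn v) * (kap * tn w) <= _).
    have zu : `|(x, 0 : 'rV[R]_n) - z0| = `|u|.
      by rewrite prod_normE /= subrr normr0 max_l.
    rewrite zu; apply: ler_pM => //; first by rewrite !mulr_ge0.
    by apply: ler_wpM2l; [rewrite mulr_ge0|exact: k1].
  rewrite (_ : _ * (kap * tn w) = `|u| * (C1 * kap ^+ 2) * tn v * tn w);
    last first.
    by move: `|u| (tn v) (tn w) => *; ring.
  do 2 (apply: ler_wpM2r; first exact: tnorm_ge0).
  move: (ltW u6); rewrite /d6 ler_pdivlMr//; apply: le_trans.
  by rewrite ler_wpM2l// lerDl.
have A2 y w : `|y - xp| < d2 -> `|'D_w j y - ip (y - xp) (w *m H)| <=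
    eta * tn (y - xp) * tn w.
  move=> yd; have [_ /(_ w)] := S2 y yd; rewrite crit subr0 -HE => h.
  apply: le_trans h _.
  apply: le_trans (_ : eta / kap ^+ 2 * (kap * tn (y - xp)) * (kap * tn w) <=
    _).
    apply: ler_pM => //; first by rewrite mulr_ge0// ltW.
    by apply: ler_wpM2l; [exact: ltW|exact: k1].
  rewrite le_eqVlt; apply/orP; left; apply/eqP.
  by move: (tn _) (tn w) => s t; field; rewrite gt_eqF.
have U0 : 0 <= tn u := tnorm_ge0 u.
split=> //.
  move=> v v0; have tv0 := tnorm_ge0 (p := p) v.
  have h : tn v <= b * (eta * tn v).
    apply: hess_coercive => [|w]; first by rewrite mulr_ge0// ltW.
    have := A1 w v; rewrite v0 sub0r normrN -Hsa innerC => h.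
    by rewrite mulrAC.
  apply/eqP; apply: contraTT isT => vn0; have tpos := tnorm_gt0 (p := p) vn0.
  move: h; rewrite mulrA -{1}[tn v]mul1r ler_pM2r// => h.
  by have := le_trans h eta_b; rewrite leNgt ltr_pdivrMr// mul1r ltr1n.
move=> v newt; have V0 := tnorm_ge0 (p := p) v.
have Dk0 w : 'D_(vert w) k (x, 0) = 'D_w j x.
  by rewrite (derive_k Wo j3 P2 WB kE w Wx) (DPhi Wx).1 (DPhi Wx).2.
(* The Newton equation equates the fibre Hessian applied to [v], close to [H] applied to [v], with
   minus the differential of [j] at [x], close to minus [H] applied to [u]. Hence [v] is [- u] up to
   a small relative error. *)
have vu : tn (v + u) <= b * (eta * (tn v + tn u)).
  apply: hess_coercive => [|w];
    first by rewrite mulr_ge0 ?(ltW eta0)// addr_ge0.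
  rewrite innerDl; have h1 := A1 v w; have h2 := A2 x w u2; rewrite -/u in h2.
  have := newt w; rewrite Dk0 => nw.
  have E : 'D_(vert v) ('D_(vert w) k) (x, 0) = - 'D_w j x.
    by apply/eqP; rewrite -addr_eq0 addrC nw.
  rewrite E in h1; move: h1 h2;
    move: ('D_w j x) (ip v _) (ip u _) => D X Y h1 h2.
  rewrite (_ : X + Y = - (- D - X) - (D - Y)); last by ring.
  apply: le_trans (ler_normB _ _) _; rewrite normrN mulrDr mulrDl; exact: lerD.
have v2u : tn v <= 2 * tn u.
  have tri : tn v <= tn (v + u) + tn u.
    by rewrite -{1}[v](addrK u) -(tnormN u); exact: tnormD.
  have : b * (eta * (tn v + tn u)) <= 1 / 4 * (tn v + tn u).
    by rewrite mulrA ler_wpM2r// addr_ge0.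
  by move=> /(le_trans vu) h; exact: (absorb_quarter tri h U0).
have vdm : `|v| < dm.
  apply: le_lt_trans xd; apply: le_trans (k1 v) _.
  apply: le_trans (_ : kap * (2 * (kap * `|u|)) <= _).
    rewrite ler_wpM2l ?(ltW kap0)//; apply: le_trans v2u _.
    by rewrite ler_wpM2l.
  rewrite (_ : kap * _ = `|u| * (2 * kap ^+ 2)); last by move: `|u| => *; ring.
  by rewrite ler_wpM2l// lerDl.
have [[v1 v2 v3] [v4 v5 v6]] := small _ vdm.
have zx (r : R) : `|u| < r -> `|v| < r -> `|(x, v) - z0| < r.
  by move=> ur vr; exact: norm_pairB.
have [Wxv DP] := S4 _ (zx _ u4 v4); split=> //.
set N := Phi (x, v) in DP *.
have Nd : `|N - xp| < d2 := S5 _ (zx _ u5 v5).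
pose e := tn (N - xp); have e0 : 0 <= e := tnorm_ge0 _.
(* The Newton equation cancels the constant and linear terms of the expansion in [v]. Half of the
   third derivative remains, and [tn v <= 2 * tn u] turns [a / 2] into [2 * a]. *)
have Dk1 w : `|'D_(vert w) k (x, v)| <=
  (2 * a * tn u ^+ 2 + eta * tn u ^+ 2) * tn w.
  have w0 := tnorm_ge0 (p := p) w.
  have := S3 (x, 0) v w (near0 _ u3) v3; rewrite /vert_lin /=.
  have -> : (x, 0) + vert v = (x, v) by congr pair; rewrite /= ?addr0 ?add0r.
  have := newt w; have := Ha v w.
  move: ('D_(vert w) k (x, v)) ('D_(vert w) k (x, 0)) ('D_(vert v) _ (x, 0))
    => X Y Z.
  move: ('D_(vert v) _ z0) => T hT hYZ hX.
  have {}hX : `|X - T / 2| <= eta * tn u ^+ 2 * tn w.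
    have E : X - Y - Z - T / 2 =
      X - T / 2 by rewrite -(addrA X) -opprD hYZ subr0.
    rewrite E in hX; apply: le_trans hX _.
    have zu : `|(x, 0 : 'rV[R]_n) - z0| = `|u|.
      by rewrite prod_normE /= subrr normr0 max_l.
    rewrite zu.
    apply: le_trans (_ : eta / (6 * kap ^+ 3) * (kap * tn u + kap * (2 * tn
      u)) *
       (kap * (2 * tn u)) * (kap * tn w) <= _); last first.
      rewrite le_eqVlt; apply/orP; left; apply/eqP.
      by move: (tn u) (tn w) => s t; field; rewrite gt_eqF.
    have vk : `|v| <= kap * (2 * tn u).
      by apply: le_trans (k1 v) _; rewrite ler_wpM2l// ltW.
    have sum0 : 0 <= eta / (6 * kap ^+ 3) * (`|u| + `|v|).
      by apply: mulr_ge0; [exact: ltW|exact: addr_ge0].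
    apply: ler_pM => //; first exact: mulr_ge0.
    apply: ler_pM => //.
    apply: ler_wpM2l; first exact: ltW.
    exact: (lerD (k1 u) vk).
  have hT2 : `|T / 2| <= 2 * a * tn u ^+ 2 * tn w.
    rewrite normrM (ger0_norm (x := 2^-1)) ?invr_ge0// ler_pdivrMr//.
    apply: le_trans hT _.
    rewrite (_ : 2 * a * tn u ^+ 2 * tn w * 2 = a * (2 * tn u) ^+ 2 * tn w);
      last first.
      by move: (tn u) (tn w) => *; ring.
    rewrite ler_wpM2r// ler_wpM2l// ler_sqr ?nnegrE// mulr_ge0//.
  rewrite mulrDl -[X](subrK (T / 2)) addrC.
  by apply: le_trans (ler_normD _ _) _; exact: lerD.
(* The fibre derivative of [k] at the new point is the derivative of [j] at [N] in the direction
   [w'], the image of [w] under the fibre derivative of [Phi]. Linearising [j] at [xp] costs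
   [2 * eta * e], since [tn w' <= 2 * tn w], and replacing [w'] by [w] costs [c * eta * e]. *)
have key : e <= b * (2 * a * tn u ^+ 2 + eta * tn u ^+ 2 + eta * (c + 2) * e).
  apply: hess_coercive.
    by rewrite !addr_ge0 ?mulr_ge0 ?sqr_ge0 ?(ltW eta0) ?(ltW c2).
  move=> w; have w0 := tnorm_ge0 (p := p) w.
  set w' := 'D_(vert w) Phi (x, v) in DP.
  have hw : tn ('D_(vert w) Phi (x, v) - w) <= eta * tn w.
    apply: le_trans (k2 _) _;
      apply: le_trans (_ : kap * (eta / kap ^+ 2 * (kap * tn w)) <= _).
      rewrite ler_wpM2l ?(ltW kap0)//; apply: le_trans (DP w) _.
      by rewrite ler_wpM2l// ltW.
    rewrite le_eqVlt; apply/orP; left; apply/eqP.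
    by move: (tn w) => t; field; rewrite gt_eqF.
  have tw' : tn w' <= 2 * tn w.
    rewrite -[w'](subrK w); apply: le_trans (tnormD _ _) _.
    rewrite mulr_natl mulr2n lerD2r; apply: le_trans hw _.
    by rewrite -[leRHS]mul1r ler_wpM2r.
  have h1 := A2 N w' Nd.
  have h2 := Dk1 w; rewrite (derive_k Wo j3 P2 WB kE w Wxv) -/N -/w' in h2.
  have h3 : `|ip (N - xp) ((w' - w) *m H)| <= e * (c * (eta * tn w)).
    apply: le_trans (inner_cauchy _ _) _; rewrite ler_wpM2l//.
    by apply: le_trans (Hc _) _; rewrite ler_wpM2l.
  have E : ip (N - xp) (w *m H) = 'D_w' j N -
      ('D_w' j N - ip (N - xp) (w' *m H)) - ip (N - xp) ((w' - w) *m H).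
    rewrite mulmxBl innerDr innerNr.
    by move: ('D_w' j N) (ip _ (w *m H)) (ip _ (w' *m H)) => *; ring.
  rewrite E; apply: le_trans (ler_normB _ _) _.
  apply: le_trans (lerD (le_trans (ler_normB _ _) (lerD h2 h1)) h3) _.
  have : eta * e * tn w' <= eta * e * (2 * tn w).
    by rewrite ler_wpM2l// mulr_ge0// ltW.
  rewrite -/e; move: (eta * e * tn w') => q hq.
  apply: le_trans (_ : (2 * a * tn u ^+ 2 + eta * tn u ^+ 2) * tn w +
    eta * e * (2 * tn w) + e * (c * (eta * tn w)) <= _).
    by rewrite lerD2r lerD2l.
  rewrite le_eqVlt; apply/orP; left; apply/eqP.
  by move: (tn u) (tn w) e {e0 hq h1 h3} => *; ring.
move: key; rewrite -/e.
have U2 : 0 <= tn u ^+ 2 by exact: sqr_ge0.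
have abU : 0 <= a * b * tn u ^+ 2 by rewrite !mulr_ge0.
have q1 : b * eta * tn u ^+ 2 <= 1 / 4 * tn u ^+ 2 by rewrite ler_wpM2r.
have q2 : b * eta * (c + 2) * e <= 1 / 4 * e by rewrite ler_wpM2r.
move: (tn u ^+ 2) e e0 U2 abU q1 q2 {Dk1 DP} => U e e0 U2 abU q1 q2.
rewrite (_ : b * _ = 2 * (a * b * U) + b * eta * U + b * eta * (c + 2) * e);
  last by ring.
rewrite (_ : (4 * a * b + 2) * U = 4 * (a * b * U) + 2 * U); last by ring.
exact: absorb_final.
Qed.

End NewtonEstimate.

(** * Operator norm and norm of the third derivative *)

Section OperatorNorms.
Context {R : realType} {n : nat} {M : riemannianManifold R n} (p : M).
Implicit Types (u v w : 'rV[R]_n).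
Local Notation tn := (tnorm (p := p)).

Lemma tnorm_unit v : v != 0 -> exists2 v', tn v' <= 1 & v = tn v *: v'.
Proof.
move=> v0; have t0 := tnorm_gt0 (p := p) v0.
exists ((tn v)^-1 *: v); last by rewrite scalerA mulfV ?scale1r// gt_eqF.
by rewrite tnormZ ger0_norm ?invr_ge0 ?tnorm_ge0// mulVf// gt_eqF.
Qed.

(** [sup] takes the default value 0 on an unbounded set, so boundedness must be known before
    [opnorm] dominates anything. *)
Lemma opnorm_has_sup (A : 'M[R]_n) :
  has_sup [set tn (v *m A) | v in [set v : tangent p | tn v <= 1]].
Proof.
split; first by exists (tn (0 *m A)); exists 0 => //=; rewrite tnorm0.
have [k [k0 k1 k2]] := tnorm_equiv (p := p).
pose C := \sum_(i : 'I_n * 'I_n) `|A i.1 i.2|.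
have AC i j : `|A i j| <= C.
  by rewrite /C (bigD1 (i, j))//= lerDl; exact: sumr_ge0.
have C0 : 0 <= C by exact: sumr_ge0.
exists (k * (n%:R * (k * C))) => _ [v v1 <-].
apply: le_trans (k2 _) _; rewrite ler_wpM2l ?(ltW k0)//.
apply: rV_norm_le => [|j]; first by rewrite !mulr_ge0// ltW.
rewrite mxE; apply: le_trans (norm_sum_le (v : 'rV[R]_n) (fun i => AC i j)) _.
rewrite ler_wpM2l// ler_wpM2r//; apply: le_trans (k1 _) _.
by rewrite -[leRHS]mulr1 ler_wpM2l// ltW.
Qed.

Lemma opnorm_ge0 A : 0 <= opnorm p A.
Proof.
apply: le_trans (_ : tn (0 *m A) <= _); first exact: tnorm_ge0.
apply: ub_le_sup; first by case: (opnorm_has_sup A).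
by exists 0 => //=; rewrite tnorm0.
Qed.

Lemma tnorm_mulmx_le A v : tn (v *m A) <= opnorm p A * tn v.
Proof.
have [->|v0] := eqVneq v 0; first by rewrite mul0mx tnorm0 mulr0.
have [v' v'1 vE] := tnorm_unit v0.
rewrite {1}vE -scalemxAl tnormZ ger0_norm ?tnorm_ge0// mulrC.
rewrite ler_wpM2r ?tnorm_ge0//; apply: ub_le_sup;
  first by case: (opnorm_has_sup A).
by exists v'.
Qed.

Variables (h : 'rV[R]_n -> R) (A : set 'rV[R]_n).
Hypotheses (Ao : open A) (h3 : kdiff 3 A h) (A0 : A 0).

Let d l i j := 'D_'e_l ('D_'e_i ('D_'e_j h)) 0.

Lemma derive3E u v w : 'D_u ('D_v ('D_w h)) 0 =
  \sum_i v 0 i * \sum_j w 0 j * \sum_l u 0 l * d l i j.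
Proof.
have := @derive3_rV2 R _ n idfun A h Ao 0 u v w h3 A0; rewrite /= => ->.
apply: eq_bigr => i _; congr (_ * _); apply: eq_bigr => j _; congr (_ * _).
have [_ /(_ 'e_j)[_ /(_ 'e_i)[D _]]] := h3.
exact: (derive_rV idfun u (D 0 A0)).
Qed.

Lemma derive3Z (a b c : R) u v w :
  'D_(a *: u) ('D_(b *: v) ('D_(c *: w) h)) 0 =
  a * b * c * 'D_u ('D_v ('D_w h)) 0.
Proof.
rewrite [LHS]derive3E (derive3E u v w) mulr_sumr; apply: eq_bigr => i _.
have -> : \sum_j (c *: w) 0 j * \sum_l (a *: u) 0 l * d l i j =
    a * c * \sum_j w 0 j * \sum_l u 0 l * d l i j.
  rewrite mulr_sumr; apply: eq_bigr => j _.
  have -> : \sum_l (a *: u) 0 l * d l i j = a * \sum_l u 0 l * d l i j.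
    by rewrite mulr_sumr; apply: eq_bigr => l _; rewrite mxE mulrA.
  by rewrite mxE; move: (w 0 j) (\sum_l _) => x y; ring.
by rewrite mxE; move: (v 0 i) (\sum_j _) => x y; ring.
Qed.

Lemma norm_D3_has_sup : has_sup [set x | exists u v w : tangent p,
  [/\ tn u <= 1, tn v <= 1, tn w <= 1 & x = `|'D_u ('D_v ('D_w h)) 0|]].
Proof.
split; first by exists `|'D_0 ('D_0 ('D_0 h)) 0|, 0, 0, 0; rewrite !tnorm0.
have [k [k0 k1 _]] := tnorm_equiv (p := p).
pose C := \sum_(i : 'I_n * ('I_n * 'I_n)) `|d i.1 i.2.1 i.2.2|.
have dC l i j : `|d l i j| <= C.
  by rewrite /C (bigD1 (l, (i, j)))//= lerDl; exact: sumr_ge0.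
have C0 : 0 <= C by exact: sumr_ge0.
have kk (v : 'rV[R]_n) : tn v <= 1 -> `|v| <= k.
  move=> v1; apply: le_trans (k1 _) _.
  by rewrite -[leRHS]mulr1 ler_wpM2l// ltW.
exists (n%:R ^+ 2 * (n%:R * (k * C)) * k * k) => _ [u [v [w [u1 v1 w1 ->]]]].
rewrite derive3E; apply: le_trans (norm_sum2_le v w (C := n%:R * (k * C)) _) _.
  move=> i j; apply: le_trans (norm_sum_le u (fun l => dC l i j)) _.
  by rewrite ler_wpM2l// ler_wpM2r// kk.
have K0 : 0 <= n%:R ^+ 2 * (n%:R * (k * C)).
  by rewrite mulr_ge0 ?sqr_ge0// mulr_ge0// mulr_ge0// ltW.
apply: ler_pM => //; [exact: mulr_ge0| |exact: kk].
by rewrite ler_wpM2l// kk.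
Qed.

Lemma norm_D3_ge0 : 0 <= norm_D3 (p := p) h.
Proof.
apply: le_trans (_ : `|'D_0 ('D_0 ('D_0 h)) 0| <= _); first exact: normr_ge0.
apply: ub_le_sup; first by case: norm_D3_has_sup.
by exists 0, 0, 0; rewrite !tnorm0.
Qed.

Lemma derive3_le v w : `|'D_v ('D_v ('D_w h)) 0| <=
  norm_D3 (p := p) h * tn v ^+ 2 * tn w.
Proof.
have [->|v0] := eqVneq v 0.
  by rewrite derive0 normr0 tnorm0 expr0n mulr0 mul0r.
have [->|w0] := eqVneq w 0.
  rewrite tnorm0 mulr0 (_ : 'D_0 h = cst 0); last first.
    by apply/funext => y; rewrite derive0.
  rewrite (_ : 'D_v (cst 0) = cst 0); first by rewrite derive_cst normr0.
  by apply/funext => y; rewrite derive_cst.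
have [v' v'1 vE] := tnorm_unit v0; have [w' w'1 wE] := tnorm_unit w0.
rewrite {1 2}vE {1}wE derive3Z -expr2 normrM ger0_norm; last first.
  by rewrite mulr_ge0 ?sqr_ge0 ?tnorm_ge0.
rewrite -[leRHS]mulrA mulrC ler_wpM2r ?mulr_ge0 ?sqr_ge0 ?tnorm_ge0//.
apply: ub_le_sup; first by case: norm_D3_has_sup.
by exists v', v', w'.
Qed.

End OperatorNorms.

(* [2 * (4 * a * b + 2) * 8 ^+ 2]: the factors come from [dist_center_le],
   [newton_estimate] and [chart_dist_center_le]. *)
Definition newton_constant (R : realType) (a b : R) : R :=
  512 * `|a| * `|b| + 256.

(** The absolute values ensure positivity for all real arguments; at the two norms, which are
    nonnegative, they have no effect. *)
Lemma newton_constant_gt0 (R : realType) (a b : R) : 0 < newton_constant a b.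
Proof.
apply: ltr_wpDl; last by rewrite ltr0n.
by apply: mulr_ge0; [apply: mulr_ge0; [rewrite ler0n|]|].
Qed.

(** * From the chart estimate to the geodesic distance *)

Section NewtonOnManifold.
Context {R : realType} {n : nat} {M : riemannianManifold R n}.
Variables (F : forall p : M, tangent p -> M) (J : M -> R) (ps : M).
Arguments F : clear implicits.
Hypotheses (Fb : smooth_from_bundle F) (Fr : forall p, retraction 1 (F p)).
Hypotheses (J3 : times_differentiable 3 J) (crit : critical_point J ps).
Local Notation x0 := (chart ps ps).
Local Notation V := ('rV[R]_n * 'rV[R]_n)%type.
Implicit Types (p q : M) (u v w x : 'rV[R]_n).

Let Fp (z : V) : M := F (param ps z.1) (tframe ps z.1 z.2).
Let W : set V := [set z | chart_codom ps z.1] `&` [set z | dom ps (Fp z)].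
Let Phi : V -> 'rV[R]_n := chart ps \o Fp.
Let j : 'rV[R]_n -> R := J \o param ps.
Let k : V -> R := J \o Fp.

(** All tangent spaces are the same type of row vectors, so the base point can be rewritten while
    the coordinates stay fixed. *)
Let F_eq p q v : p = q -> F p v = F q v.
Proof. by move=> ->. Qed.

Let Fp_chart p v : dom ps p ->
  Fp (chart ps p, v) = F p (tframe ps (chart ps p) v).
Proof. by move=> pp; apply: F_eq; exact: chartK. Qed.

Let tframe_is_linear x : linear (fun v => tframe ps x v : 'rV[R]_n).
Proof. by move=> a u v; exact: tframe_linear. Qed.

Let tframe0 x : tframe ps x 0 = 0 :> 'rV[R]_n.
Proof. by rewrite /tframe linear0. Qed.

Let Fp0 p : dom ps p -> Fp (chart ps p, 0) = p.
Proof. by move=> pp; rewrite Fp_chart// tframe0; exact: retraction0. Qed.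

Let W0 p : dom ps p -> W (chart ps p, 0).
Proof. by move=> pp; split; [exact: codom_chart|rewrite /= Fp0]. Qed.

Let W_open : open W.
Proof.
rewrite openE => z [Az Wz].
have [Fc _] := Fb ps.
have nA : \forall z' \near z, chart_codom ps z'.1 by exact: (cvg_fst
  (codom_nbhs Az)).
have nW : \forall z' \near z, dom ps (Fp z') by exact: (Fc z Az _ (dom_nbhs
  Wz)).
by apply: filterS2 nA nW => z' A1 A2; split.
Qed.

Let Phi_kdiff l : kdiff l W Phi.
Proof. by have [_ S] := Fb ps; exact: (S ps l). Qed.

Let WB z : W z -> chart_codom ps (Phi z).
Proof. by move=> [_ Wz]; exact: codom_chart. Qed.

Let kE z : W z -> k z = j (Phi z).
Proof. by move=> [_ Wz]; rewrite /j /Phi /= chartK. Qed.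

Let k_kdiff : kdiff 3 W k.
Proof.
have K := @kdiff_comp _ _ _ 3 W (chart_codom ps) Phi j W_open WB (Phi_kdiff 3)
  (J3 ps).
by apply: kdiff_congr W_open _ K => z Wz; rewrite kE.
Qed.

(** On the fibre over [p], [Phi] is [tframe] into the chart at [p], followed by the retraction,
    whose differential at 0 is the identity there, followed by the transition back to the chart at
    [ps]. The two changes of chart are inverse to each other. *)
Let DPhi x : W (x, 0) -> Phi (x, 0) = x /\ forall w, 'D_(vert w) Phi (x, 0) = w.
Proof.
move=> [/= [p pp <-] _]; split; first by rewrite /Phi /= Fp0.
move=> w; pose T v : 'rV[R]_n := tframe ps (chart ps p) v.
pose f : 'rV[R]_n -> M := F p.
have E v : Phi (chart ps p, v) = (chart ps \o f) (T v).
  by rewrite /Phi /= Fp_chart.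
rewrite (derive_vert 0 w (tframe_is_linear (chart ps p)) E) -/T tframe0.
have d1 := retraction_differentiable (Fr p).
have f0 : f 0 = p := retraction0 (Fr p).
have d2 : differentiable (chart ps \o param p) ((chart p \o f) 0).
  by rewrite /= f0; apply: transition_differentiable => //; exact: dom_center.
have -> : 'D_(T w) (chart ps \o f) 0 =
    'D_(T w) ((chart ps \o param p) \o (chart p \o f)) 0.
  apply: near_eq_derive.
  have := open_nbhs_nbhs (conj (pullback_dom_open (Fr p)) (pullback_dom0 (Fr
    p))).
  by apply: filterS => v pv; rewrite /= chartK.
have f0' : (chart p \o f) 0 = chart p p by rewrite /= f0.
have := derive_chain (T w) d1 d2; rewrite (retraction_derive (Fr p)) => ->.
rewrite [X in 'D__ _ X]f0' /T tframeE//.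
by apply: transitionK => //; exact: dom_center.
Qed.

Let crit_j w : 'D_w j x0 = 0.
Proof.
rewrite deriveE; first exact: crit.
by apply: (J3 ps).1; exact: codom_chart (dom_center ps).
Qed.

(** Over [ps] the bundle chart is the identity of the fibre. The fibre derivatives of [k] at the
    centre are therefore those of [J \o F ps], and the constant is expressed by its third
    derivative. *)
Let k_center v : k (x0, v) = (J \o (F ps : 'rV[R]_n -> M)) (id v).
Proof. by rewrite /k /= Fp_chart ?tframe_center//; exact: dom_center. Qed.

Let id_linear : linear (id : 'rV[R]_n -> 'rV[R]_n).
Proof. by []. Qed.

Let derive_k1 v w : 'D_(vert w) k (x0, v) = 'D_w (J \o (F ps : 'rV[R]_n ->
  M)) v.
Proof. exact: (derive_vert v w id_linear k_center). Qed.

Let derive_k2 u v w : 'D_(vert u) ('D_(vert w) k) (x0, v) =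
  'D_u ('D_w (J \o (F ps : 'rV[R]_n -> M))) v.
Proof. exact: (derive_vert v u id_linear (fun v => derive_k1 v w)). Qed.

Let derive_k3 t u v w : 'D_(vert t) ('D_(vert u) ('D_(vert w) k)) (x0, v) =
  'D_t ('D_u ('D_w (J \o (F ps : 'rV[R]_n -> M)))) v.
Proof. exact: (derive_vert v t id_linear (fun v => derive_k2 u v w)). Qed.

Lemma dist_ge0 p q : (0 <= dist p q)%E.
Proof.
apply/ereal_infP => _ [c _ <-].
by apply: integral_ge0 => t _; rewrite lee_fin tnorm_ge0.
Qed.

Hypothesis Hunit : hess J (F ps) \in unitmx.
Let a := norm_D3 (J \o F ps).
Let b := opnorm ps (invmx (hess J (F ps))).

(** [newton_estimate] speaks of fibre coordinates over the chart at [ps], while gradient and Hessian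
    at [p] live in the chart at [p]. The maps [T] and [S] translate between the two. *)
Lemma newton_chart_estimate : exists2 d : R, 0 < d & forall p, dom ps p ->
  `|chart ps p - x0| < d ->
  [/\ hess J (F p) \in unitmx, dom ps (newton J F p) &
      tnorm (p := ps) (chart ps (newton J F p) - x0) <=
        (4 * a * b + 2) * tnorm (p := ps) (chart ps p - x0) ^+ 2].
Proof.
have h3 := pullback_kdiff (Fr ps) J3.
have hA := pullback_dom_open (Fr ps).
have h0 := pullback_dom0 (Fr ps).
have hB : open (chart_codom ps) by exact: codom_open.
have Wz0 := W0 (dom_center ps).
have Pz0 : Phi (x0, 0) = x0 by have [] := DPhi Wz0.
have HE u w : inner (p := ps) u (w *m hess J (F ps)) = 'D_u ('D_w j) x0.
  rewrite (inner_hess (Fr ps) J3) -(derive_k2 u 0 w).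
  exact: (derive2_k hB W_open (J3 ps) (Phi_kdiff 2) WB kE Wz0 Pz0 DPhi crit_j).
have Ha v w : `|'D_(vert v) ('D_(vert v) ('D_(vert w) k)) (x0, 0)| <=
    a * tnorm (p := ps) v ^+ 2 * tnorm (p := ps) w.
  by rewrite derive_k3; exact: (derive3_le ps hA h3 h0).
have [d d0 dP] := newton_estimate hB W_open (J3 ps) (Phi_kdiff 2)
  k_kdiff WB kE Wz0 Pz0 DPhi crit_j (norm_D3_ge0 ps hA h3 h0) (opnorm_ge0 ps _)
  (opnorm_ge0 ps _) Hunit HE (hess_self_adjoint (Fr ps) J3) (tnorm_mulmx_le ps
    _)
  (tnorm_mulmx_le ps _) Ha.
exists d => // p pp pd; have [_ nondeg newt] := dP _ pd.
pose T v : 'rV[R]_n := tframe ps (chart ps p) v.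
pose S v := 'D_v (chart ps \o param p) (chart p p).
pose m : 'rV[R]_n -> R := J \o F p.
have TS v : T (S v) = v.
  by rewrite /T tframeE//; apply: transitionK => //; exact: dom_center.
have kT v : k (chart ps p, v) = m (T v) by rewrite /k /= Fp_chart.
have Tl : linear T := tframe_is_linear (chart ps p).
have T0 : T 0 = 0 := tframe0 _.
have k1 v w : 'D_(vert w) k (chart ps p, v) = 'D_(T w) m (T v) :=
  derive_vert v w Tl kT.
have k2 u v w : 'D_(vert u) ('D_(vert w) k) (chart ps p, v) =
  'D_(T u) ('D_(T w) m) (T v) := derive_vert v u Tl (fun v => k1 v w).
have Hp : hess J (F p) \in unitmx.
  rewrite -row_free_unit -kermx_eq0; apply/eqP/row_matrixP => i; rewrite row0.
  set v := row i _; have vH : v *m hess J (F p) = 0.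
    by rewrite -row_mul mulmx_ker row0.
  rewrite -(TS v) (nondeg (S v)) ?T0// => w.
  rewrite k2 TS T0 -(inner_hess (Fr p) J3) vH.
  by rewrite innerC inner0l.
pose s := - (grad J (F p) *m invmx (hess J (F p))).
have nE : newton J F p = Fp (chart ps p, S s).
  by rewrite Fp_chart// -/(T (S s)) TS.
(* The Newton equation is tested in the direction [T w], on which the Hessian acts here;
   self-adjointness moves it onto the step [s], where it cancels its inverse. *)
have [|[_ Ws] est] := newt (S s).
  move=> w; rewrite k1 k2 TS T0 -(inner_grad (Fr p) J3) -(inner_hess (Fr p) J3).
  rewrite -(hess_self_adjoint (Fr p) J3) /s mulNmx mulmxKV// innerNl.
  by rewrite (innerC (T w)) subrr.
by split; rewrite // nE.
Qed.

Theorem newton_quadratic : exists2 U : set M, nbhs ps U & forall p, U p ->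
  hess J (F p) \in unitmx /\
  (dist (newton J F p) ps <= (newton_constant a b)%:E * dist p ps ^+ 2)%E.
Proof.
have a0 : 0 <= a.
  exact: (norm_D3_ge0 ps (pullback_dom_open (Fr ps)) (pullback_kdiff (Fr ps) J3)
    (pullback_dom0 (Fr ps))).
have b0 : 0 <= b := opnorm_ge0 ps _.
have [d d0 dP] := newton_chart_estimate.
have [r1 r10 up] := dist_center_le ps.
have [r2 r20 low] := chart_dist_center_le ps.
have [kap [kap0 _ k2]] := tnorm_equiv (p := ps).
pose C := 4 * a * b + 2.
have C0 : 0 < C by rewrite ltr_wpDl// !mulr_ge0.
(* The bound [r2] makes the lower distance estimate available at [p]. From [t <= 1] and
   [t <= r1 / C] follows [C * t ^+ 2 <= r1], so the upper estimate applies at the new point. *)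
pose r := Num.min r2 (Num.min 1 (r1 / C)).
have r0 : 0 < r by rewrite !lt_min r20 ltr01 divr_gt0.
exists [set p | dom ps p /\ `|chart ps p - x0| < Num.min d (r / kap)].
  apply: filterI; first exact: dom_nbhs (dom_center ps).
  have e0 : 0 < Num.min d (r / kap) by rewrite lt_min d0 divr_gt0.
  have := chart_continuous (dom_center ps) => /cvgrPdist_lt /(_ _ e0).
  by apply: filterS => q; rewrite distrC.
move=> p [pp]; rewrite lt_min => /andP[pd pr].
have [Hp np est] := dP p pp pd; split=> //.
set t := tnorm (p := ps) (chart ps p - x0) in est *.
have t0 : 0 <= t := tnorm_ge0 _.
have tr : t <= r.
  by apply: le_trans (k2 _) _; rewrite mulrC -ler_pdivlMr// ltW.
have [tr2 t1 tr1] : [/\ t <= r2, t <= 1 & t <= r1 / C].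
  by move: tr; rewrite !le_min => /andP[-> /andP[-> ->]].
have near_r1 : C * t ^+ 2 <= r1.
  move: tr1; rewrite ler_pdivlMr// mulrC => h; apply: le_trans h.
  by rewrite ler_wpM2l ?(ltW C0)// expr2 ler_piMr.
apply: le_trans (up _ np (le_trans est near_r1)) _.
(* An infinite distance makes the right-hand side infinite as well, because the constant is
   positive; the lower estimate concerns real distances. *)
case dE : (dist p ps) (dist_ge0 p ps) => [e||//] e0; last first.
  by rewrite expe2 mulyy gt0_muley ?leey// lte_fin newton_constant_gt0.
rewrite lee_fin in e0.
have t8 : t <= 8 * e by apply: low => //; rewrite dE.
rewrite -EFin_expe -EFinM lee_fin.
apply: le_trans (_ : 2 * (C * t ^+ 2) <= _); first by rewrite ler_wpM2l.
apply: le_trans (_ : 2 * (C * (8 * e) ^+ 2) <= _).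
  rewrite ler_wpM2l// ler_wpM2l ?(ltW C0)// ler_sqr ?nnegrE//.
  exact: mulr_ge0.
rewrite /newton_constant !ger0_norm// le_eqVlt; apply/orP; left; apply/eqP.
by rewrite /C; move: a b => x y; ring.
Qed.

End NewtonOnManifold.

Theorem theorem3 (R : realType) :
  exists K : R -> R -> R, (forall a b, 0 < K a b) /\
  forall (n : nat) (M : riemannianManifold R n)
    (F : forall p : M, tangent p -> M) (J : M -> R) (pstar : M),
    smooth_from_bundle F ->
    (forall p, retraction 1 (F p)) ->
    times_differentiable 3 J ->
    critical_point J pstar ->
    hess J (F pstar) \in unitmx ->
    let C := K (norm_D3 (J \o F pstar))
               (opnorm pstar (invmx (hess J (F pstar)))) in
    exists2 U : set M, nbhs pstar U &
      forall p, U p ->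
        hess J (F p) \in unitmx /\
        (dist (newton J F p) pstar <= C%:E * dist p pstar ^+ 2)%E.
Proof.
exists (@newton_constant R); split; first exact: newton_constant_gt0.
by move=> n M F J pstar Fb Fr J3 crit Hunit; exact: newton_quadratic.
Qed.
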